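(* Let $0<p_0\leq \infty$, $s_0\in \mathbb{R}$, and let $f \in \mathcal{S}'(\mathbb{T})\setminus\mathcal{S}(\mathbb{T})$ be such that $s_f(p_0) > s_0$. (1) Assume that $\alpha_0(f) = 1$. Then, for any $p > 0$, $s_f(p) = \frac{1}{p} + s_f(\infty)$, and $\kappa^{p_0,s_0}(f) = \infty$. (2) Assume that $\alpha_0(f) < 1$. Then there exists a unique $p(f)\in(0,p_0)$ such that $s_f(p(f)) = \left( \frac{1}{p(f)} - \frac{1}{p_0} \right) + s_0$, and $$\kappa^{p_0,s_0}(f) = \frac{1}{p(f)} - \frac{1}{p_0} < \infty.$$ (3) If there exists $0 < \tilde{p}(f) < \infty$ such that $\partial_-s_f(\tilde{p}(f))= 1$ and $\partial_+s_f(\tilde{p}(f))= 0$, then $$\kappa^{p_0,s_0}(f) = s_f(\tilde{p}(f)) - s_0 = \lim_{p\rightarrow 0} s_f(p) - s_0.$$ Moreover, the same conclusion holds with $\tilde p(f)=\infty$ if $\partial_+ s_f ( \infty ) = 0$, in which case $s_f(p) = s_f(\infty)$ for any $0 < p \leq \infty$.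
   Context: Convention: $1/\infty = 0$ and $1/0=\infty$. $\mathbb{T} = \mathbb{R}/\mathbb{Z}$ is the one-dimensional torus, $\mathcal{S}(\mathbb{T})$ is the space of infinitely smooth periodic functions with its usual Fréchet topology, and $\mathcal{S}'(\mathbb{T})$ is its topological dual. $(\widehat{f}_k)_{k\in\mathbb{Z}}$ denotes the Fourier coefficients of $f \in \mathcal{S}'(\mathbb{T})$ with respect to $e^{2 i\pi k\cdot}$. Besov spaces: fix non-negative $\varphi_0,\varphi_1$ in the Schwartz class $\mathcal{S}(\mathbb{R})$ with $\mathrm{Supp}\,\varphi_0 \subset \{|x|\le 2\}$, $\mathrm{Supp}\,\varphi_1\subset\{1\le |x|\le 4\}$, and $\sum_{j\ge 0}\varphi_j = 1$, where $\varphi_j = \varphi_1(2^{-(j-1)}\cdot)$ for $j\ge 2$. For $0<p,q\le\infty$ and $s\in\mathbb{R}$, $B_{p,q}^s(\mathbb{T})$ is the space of $f\in\mathcal{S}'(\mathbb{T})$ such that $$\|f\|_{B^s_{p,q}} = \Big(\sum_{j\ge 0} 2^{jsq} \Big\| \sum_{k\in\mathbb{Z}} \varphi_j(k)\widehat{f}_k e^{2 i\pi k\cdot}\Big\|_{L_p}^q\Big)^{1/q}<\infty$$ (with a supremum over $j$ of $2^{js}\|\cdot\|_{L_p}$ if $q=\infty$). Write $B_p^s(\mathbb{T})=B_{p,p}^s(\mathbb{T})$. Critical smoothness: $s_f(p)=\sup\{s\in\mathbb{R} : f\in B^s_{p,q}(\mathbb{T})\}\in(-\infty,\infty]$, which does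 not depend on $q\in(0,\infty]$. For $f\notin\mathcal{S}(\mathbb{T})$, the function $u\mapsto s_f(1/u)$ is real-valued, non-decreasing, concave and $1$-Lipschitz on $[0,\infty)$; for $p\in(0,\infty]$ (resp. $p\in(0,\infty)$), $\partial_+s_f(p)$ (resp. $\partial_-s_f(p)$) denotes its right (resp. left) derivative at $u=1/p$. Set $\alpha_0(f)=\lim_{p\to 0}\partial_+s_f(p)\in[0,1]$. Wavelet basis: fix an orthonormal basis $(\psi_\lambda)_{\lambda\in\Lambda}=(\Psi_{j,k})_{j\ge0,k\in X_j}$ of $L_2(\mathbb{T})$, with functions in $\mathcal{S}(\mathbb{T})$, where the $X_j$ are finite sets with $2^j\le \#X_j\le C2^j$ for $j\ge1$ ($C\ge 1$ independent of $j$), which is $(0,\infty)$-admissible: for all $0<p,q\le\infty$, $s\in\mathbb{R}$ and $f \in \mathcal{S}'(\mathbb{T})$, with $a_{j,k}=2^{j/2}\langle f,\Psi_{j,k}\rangle$, one has $f\in B^s_{p,q}(\mathbb{T})$ if and only if $\|a\|_{b^s_{p,q}}<\infty$, and $\|f\|_{B^s_{p,q}}$ and $\|a\|_{b^s_{p,q}}$ are equivalent (quasi-)norms, where $$\|a\|_{b^s_{p,q}}=\Big(\sum_{j\ge0}2^{j(s-\frac1p)q}\Big(\sum_{k\in X_j}|a_{j,k}|^p\Big)^{q/p}\Big)^{1/q}$$ (usual modification if $p$ or $q$ is $\infty$). Compressibility: for $f$ with $s_f(p_0)>s_0$ (so that $f\in B_{p_0}^{s_0}(\mathbb{T})$), the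 best $N$-term approximation error is $$\sigma_N^{p_0,s_0}(f)=\inf_{\Lambda_N\subset\Lambda,\ |\Lambda_N|=N}\Big\|f-\sum_{\lambda\in\Lambda_N}\langle f,\psi_\lambda\rangle\psi_\lambda\Big\|_{B_{p_0}^{s_0}},$$ and the $(p_0,s_0)$-compressibility of $f$ is $$\kappa^{p_0,s_0}(f)=\sup\{\kappa\ge0 : N^\kappa\,\sigma_N^{p_0,s_0}(f)\to0 \text{ as } N\to\infty\}\in[0,\infty].$$ *)

(* Defs.v *)
From HB Require Import structures.
From mathcomp Require Import all_boot all_order all_algebra.
From mathcomp Require Import finmap.
From mathcomp Require Import complex ring.
From mathcomp Require Import all_classical all_reals all_analysis.

Set Implicit Arguments.
Unset Strict Implicit.
Unset Printing Implicit Defensive.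

Import Order.TTheory GRing.Theory Num.Theory.
Import numFieldNormedType.Exports.

Local Open Scope classical_set_scope.
Local Open Scope complex_scope.
Local Open Scope ring_scope.

Definition smooth (R : realType) (h : R -> R) : Prop :=
  forall (n : nat) (x : R), derivable (derive1n n h) x 1.

Section smooth_closure.
Variable R : realType.
Implicit Types h k : R -> R.

Lemma smooth_lincomb_derive1n h k (a b : R) : smooth h -> smooth k ->
  forall n, derive1n n (fun x => a * h x + b * k x) =
            (fun x => a * derive1n n h x + b * derive1n n k x).
Proof.
move=> sh sk; elim=> [//|n IHn]; rewrite derive1nS IHn; apply/funext => x.
have dh := sh n x; have dk := sk n x.
rewrite !derive1nS derive1E.
have -> : (fun x => a * derive1n n h x + b * derive1n n k x) =
    (a *: derive1n n h) + (b *: derive1n n k) by apply/funext.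
rewrite deriveD; [|exact: derivableZ|exact: derivableZ].
by rewrite deriveZ; [rewrite deriveZ; [rewrite !derive1E|]|].
Qed.

Lemma smooth_lincomb h k (a b : R) : smooth h -> smooth k ->
  smooth (fun x => a * h x + b * k x).
Proof.
move=> sh sk n x; rewrite smooth_lincomb_derive1n//.
have -> : (fun x => a * derive1n n h x + b * derive1n n k x) =
    (a *: derive1n n h) + (b *: derive1n n k) by apply/funext.
by apply: derivableD; apply: derivableZ.
Qed.

Lemma smooth0 : smooth (fun _ : R => 0 : R).
Proof.
have E n : derive1n n (fun _ : R => 0 : R) = (fun _ => 0).
  elim: n => // n IHn; rewrite derive1nS IHn; apply/funext => x.
  exact: derive1_cst.
by move=> n x; rewrite E; exact: derivable_cst.
Qed.

Lemma smooth_trig (w c d : R) :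
  smooth (fun x => c * cos (w * x) + d * sin (w * x)).
Proof.
have D (c' d' x : R) : is_derive x 1
    (fun x : R => c' * cos (w * x) + d' * sin (w * x))
    (d' * w * cos (w * x) + - (c' * w) * sin (w * x)).
  apply: is_derive_eq.
  rewrite /GRing.scale/= !mulr1.
  ring.
have E n : exists c' d' : R, 
    derive1n n (fun x => c * cos (w * x) + d * sin (w * x)) =
    (fun x => c' * cos (w * x) + d' * sin (w * x)).
  elim: n => [|n [c' [d' IHn]]]; first by exists c, d.
  exists (d' * w), (- (c' * w)); rewrite derive1nS IHn; apply/funext => x.
  by rewrite derive1E; apply: derive_val.
by move=> n x; have [c' [d' ->]] := E n.
Qed.

End smooth_closure.

Section test_functions.
Variable R : realType.

(* Functions on R/Z are represented by 1-periodic functions on R. *)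
Definition smooth_periodic : set (R -> R[i]) :=
  [set g | [/\ smooth (fun x => complex.Re (g x)),
               smooth (fun x => complex.Im (g x))
             & periodic g 1]].

Definition testT_pred : {pred R -> R[i]} := mem smooth_periodic.

Lemma testT_pred_submod_closed : submod_closed testT_pred.
Proof.
split; first by rewrite inE; split => //=; exact: smooth0.
move=> a g h; rewrite !inE => -[rg ig pg] [rh ih ph]; split => [||x].
- have -> : (fun x => complex.Re ((a *: g + h) x)) =
      (fun x => 1 * (complex.Re a * complex.Re (g x) +
                 - complex.Im a * complex.Im (g x)) + 1 * complex.Re (h x)).
    apply/funext => x; rewrite !mul1r mulNr.
    by rewrite /GRing.scale/= /GRing.add/=; case: (g x); case: (h x); case: a.
  have s1 := @smooth_lincomb R _ _ (complex.Re a) (- complex.Im a) rg ig.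
  exact: (@smooth_lincomb R _ _ 1 1 s1 rh).
- have -> : (fun x => complex.Im ((a *: g + h) x)) =
      (fun x => 1 * (complex.Re a * complex.Im (g x) +
                 complex.Im a * complex.Re (g x)) + 1 * complex.Im (h x)).
    apply/funext => x; rewrite !mul1r.
    by rewrite /GRing.scale/= /GRing.add/=; case: (g x); case: (h x); case: a.
  have s1 := @smooth_lincomb R _ _ (complex.Re a) (complex.Im a) ig rg.
  exact: (@smooth_lincomb R _ _ 1 1 s1 ih).
- by rewrite -[LHS]/(a * g (x + 1) + h (x + 1)) pg ph.
Qed.

HB.instance Definition _ := GRing.isSubmodClosed.Build R[i] (R -> R[i])
  testT_pred testT_pred_submod_closed.

Record testT := TestT { testT_fun :> R -> R[i] ; _ : testT_fun \in testT_pred }.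

HB.instance Definition _ := [isSub for testT_fun].
HB.instance Definition _ := [Choice of testT by <:].
HB.instance Definition _ := [SubChoice_isSubLmodule of testT by <:].

Lemma conjT_subproof (g : testT) : (fun x => conjc (g x)) \in testT_pred.
Proof.
case: g => g /=; rewrite !inE => -[rg ig pg]; split => [||x];
  last by rewrite pg.
- have -> : (fun x => complex.Re (conjc (g x))) =
      (fun x => 1 * complex.Re (g x) + 0 * complex.Re (g x)).
    by apply/funext => x; rewrite mul1r mul0r addr0; case: (g x).
  exact: smooth_lincomb.
- have -> : (fun x => complex.Im (conjc (g x))) =
      (fun x => (-1) * complex.Im (g x) + 0 * complex.Im (g x)).
    by apply/funext => x; rewrite mulN1r mul0r addr0; case: (g x).
  exact: smooth_lincomb.
Qed.

Definition conjT (g : testT) : testT := TestT (conjT_subproof g).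

Lemma cos_sin_period (k : int) (x : R) :
  cos (2 * pi * k%:~R * (x + 1)) = cos (2 * pi * k%:~R * x) /\
  sin (2 * pi * k%:~R * (x + 1)) = sin (2 * pi * k%:~R * x).
Proof.
have Ec n (y : R) : cos (y + 2 * pi * n%:R) = cos y.
  rewrite -(periodicn (@cosD2pi R) n y); congr (cos (_ + _)).
  ring.
have Es n (y : R) : sin (y + 2 * pi * n%:R) = sin y.
  rewrite -(periodicn (@sinD2pi R) n y); congr (sin (_ + _)).
  ring.
case: k => n; first by rewrite mulrDr mulr1 -!pmulrn Ec Es.
rewrite mulrDr mulr1 NegzE mulrNz -!pmulrn mulrN.
by rewrite -(Ec n.+1) -(Es n.+1) addrNK.
Qed.

Lemma expT_subproof (k : int) :
  (fun x : R => cos (2 * pi * k%:~R * x) +i* sin (2 * pi * k%:~R * x))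
    \in testT_pred.
Proof.
rewrite inE; split => [||x] /=.
- have -> : (fun x : R => cos (2 * pi * k%:~R * x)) = (fun x =>
      1 * cos (2 * pi * k%:~R * x) + 0 * sin (2 * pi * k%:~R * x)).
    by apply/funext => x; rewrite mul1r mul0r addr0.
  exact: smooth_trig.
- have -> : (fun x : R => sin (2 * pi * k%:~R * x)) = (fun x =>
      0 * cos (2 * pi * k%:~R * x) + 1 * sin (2 * pi * k%:~R * x)).
    by apply/funext => x; rewrite mul1r mul0r add0r.
  exact: smooth_trig.
- by have [-> ->] := cos_sin_period k x.
Qed.

Definition expT (k : int) : testT := TestT (expT_subproof k).

End test_functions.

Section distributions.
Variable R : realType.
Implicit Types (f : testT R -> R[i]) (g h : testT R).

(* The Haar measure of R/Z, carried by the fundamental domain [0, 1]. *)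
Definition muT : {measure set (measurableTypeR R) -> \bar R} :=
  mrestr (@lebesgue_measure R) (measurable_itv `[0, 1]).

Definition integralT (g : R -> R[i]) : R[i] :=
  (\int[muT]_x complex.Re (g x)) +i* (\int[muT]_x complex.Im (g x)).

Definition cderive1n (n : nat) (g : R -> R[i]) (x : R) : R[i] :=
  derive1n n (fun y => complex.Re (g y)) x +i*
  derive1n n (fun y => complex.Im (g y)) x.

(* The Fréchet topology of the test functions is generated by the seminorms
   g |-> sup_x |g^(i)(x)|, i : nat. *)
Definition continuousT f : Prop :=
  forall g (e : R), 0 < e -> exists (n : nat) (d : R), 0 < d /\
    forall h, (forall i x, (i <= n)%N ->
                 Normc.normc (cderive1n i (h - g) x) < d) ->
      Normc.normc (f h - f g) < e.

Definition periodic_distribution : set (testT R -> R[i]) :=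
  [set f | scalar f /\ continuousT f].

Definition embedT (u : testT R) : testT R -> R[i] :=
  fun h => integralT (fun x => u x * h x).

(* The bracket <f, g> is antilinear in g, so that it is the L_2 inner product
   when f is a function. *)
Definition bracket f g : R[i] := f (conjT g).

Definition fourier_coef f (k : int) : R[i] := bracket f (expT R k).

End distributions.

Section besov.
Variable R : realType.
Implicit Types (f : testT R -> R[i]) (p q : \bar R).

Definition schwartz (h : R -> R) : Prop :=
  smooth h /\
  forall m n : nat, exists M : R, forall x, `|x ^+ m * derive1n n h x| <= M.

Definition support_in (h : R -> R) (A : set R) : Prop :=
  closure [set x | h x != 0] `<=` A.

Definition dyadic (phi0 phi1 : R -> R) (j : nat) (x : R) : R :=
  if j is j'.+1 then phi1 (2 ^- j' * x) else phi0 x.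

Record dyadic_partition (phi0 phi1 : R -> R) : Prop := DyadicPartition {
  dyadic_schwartz0 : schwartz phi0 ;
  dyadic_schwartz1 : schwartz phi1 ;
  dyadic_ge0 : forall x, 0 <= phi0 x ;
  dyadic_ge1 : forall x, 0 <= phi1 x ;
  dyadic_supp0 : support_in phi0 [set x | `|x| <= 2] ;
  dyadic_supp1 : support_in phi1 [set x | 1 <= `|x| <= 4] ;
  dyadic_sum : forall x,
    series (fun j => dyadic phi0 phi1 j x) @ \oo --> (1 : R)
}.

(* The sum over k has finite support when phi0 and phi1 have compact support. *)
Definition dyadic_block (phi0 phi1 : R -> R) f (j : nat) (x : R) : R[i] :=
  \sum_(k \in [set: int])
    (dyadic phi0 phi1 j k%:~R)%:C * fourier_coef f k * expT R k x.

(* inve already satisfies 1/oo = 0 and 1/0 = oo. *)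
Definition rinv p : R := fine p^-1%E.

(* Meaningful for 0 < q <= +oo and u >= 0 only. *)
Definition lq_norm q (u : nat -> \bar R) : \bar R :=
  match q with
  | r%:E => ((\sum_(0 <= j <oo) u j `^ r) `^ r^-1)%E
  | _ => ereal_sup (range u)
  end.

Definition besov_norm (phi0 phi1 : R -> R) p q (s : R) f : \bar R :=
  lq_norm q (fun j => ((2 `^ (j%:R * s))%:E *
    'N[muT R]_p[(fun x => (Normc.normc (dyadic_block phi0 phi1 f j x))%:E)])%E).

Definition besov (phi0 phi1 : R -> R) p q (s : R) : set (testT R -> R[i]) :=
  [set f | periodic_distribution f /\ (besov_norm phi0 phi1 p q s f < +oo)%E].

(* The supremum does not depend on q, which is kept as a parameter. *)
Definition crit_smoothness (phi0 phi1 : R -> R) q f p : \bar R :=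
  ereal_sup [set s%:E | s in [set s : R | besov phi0 phi1 p q s f]].

(* fine is harmless here: s_f is finite when f is not smooth. *)
Definition crit_smoothness_inv (phi0 phi1 : R -> R) q f (u : R) : R :=
  fine (crit_smoothness phi0 phi1 q f (u%:E^-1)%E).

Definition crit_dright (phi0 phi1 : R -> R) q f p : R :=
  lim (h^-1 * (crit_smoothness_inv phi0 phi1 q f (rinv p + h) -
               crit_smoothness_inv phi0 phi1 q f (rinv p)) @[h --> 0^'+]).

Definition crit_dleft (phi0 phi1 : R -> R) q f p : R :=
  lim (h^-1 * (crit_smoothness_inv phi0 phi1 q f (rinv p + h) -
               crit_smoothness_inv phi0 phi1 q f (rinv p)) @[h --> 0^'-]).

Definition alpha0 (phi0 phi1 : R -> R) q f : R :=
  lim (crit_dright phi0 phi1 q f p%:E @[p --> 0^'+]).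

End besov.

Section wavelets.
Variables (R : realType) (X : nat -> finType) (Psi : forall j, X j -> testT R).
Implicit Types (f : testT R -> R[i]) (p q : \bar R).

Definition waveletIndex : choiceType := {j : nat & X j}.

Definition wavelet (l : waveletIndex) : testT R := Psi (tagged l).

Definition squareIntegrableT : set (R -> R[i]) :=
  [set g : R -> R[i] | [/\ measurable_fun (`[0, 1] : set R) (fun x : R => complex.Re (g x)),
               measurable_fun (`[0, 1] : set R) (fun x : R => complex.Im (g x))
             & ('N[muT R]_2[(fun x => (Normc.normc (g x))%:E)] < +oo)%E]].

Record wavelet_basis : Prop := WaveletBasis {
  wavelet_orthonormal : forall l m : waveletIndex,
    integralT (fun x => wavelet l x * conjc (wavelet m x)) = (l == m)%:R ;
  wavelet_total : forall g, squareIntegrableT g -> forall e : R, 0 < e ->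
    exists (A : {fset waveletIndex}) (c : waveletIndex -> R[i]),
      ('N[muT R]_2[(fun x =>
         (Normc.normc (g x - \sum_(l <- A) c l * wavelet l x))%:E)] < e%:E)%E ;
  wavelet_card : exists C : R, 1 <= C /\ forall j, (1 <= j)%N ->
    (2 ^ j <= #|X j|)%N /\ #|X j|%:R <= C * 2 ^+ j
}.

Definition wavelet_coef f (j : nat) (k : X j) : R[i] :=
  (2 `^ (j%:R / 2))%:C * bracket f (Psi k).

(* Meaningful for 0 < p <= +oo only. *)
Definition level_norm p (j : nat) (a : X j -> R[i]) : R :=
  match p with
  | r%:E => (\sum_(k : X j) Normc.normc (a k) `^ r) `^ r^-1
  | _ => \big[Num.max/0]_(k : X j) Normc.normc (a k)
  end.

Definition besov_seq_norm p q (s : R) (a : forall j, X j -> R[i]) : \bar R :=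
  lq_norm q (fun j => (2 `^ (j%:R * (s - rinv p)) * level_norm p (a j))%:E).

Definition wavelet_admissible (phi0 phi1 : R -> R) : Prop :=
  forall p q (s : R), (0 < p)%E -> (0 < q)%E ->
    (forall f, periodic_distribution f ->
       (besov phi0 phi1 p q s f <->
        (besov_seq_norm p q s (wavelet_coef f) < +oo)%E)) /\
    (exists c C : R, [/\ 0 < c, 0 < C & forall f, besov phi0 phi1 p q s f ->
       (c%:E * besov_norm phi0 phi1 p q s f
          <= besov_seq_norm p q s (wavelet_coef f)
          <= C%:E * besov_norm phi0 phi1 p q s f)%E]).

Definition best_approx_error (phi0 phi1 : R -> R) (p0 : \bar R) (s0 : R)
    f (N : nat) : \bar R :=
  ereal_inf
    [set besov_norm phi0 phi1 p0 p0 s0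
       (fun h => f h - \sum_(l <- A) bracket f (wavelet l) *
                          embedT (wavelet l) h)
    | A in [set A : {fset waveletIndex} | #|` A| = N]].

Definition compressibility (phi0 phi1 : R -> R) (p0 : \bar R) (s0 : R)
    f : \bar R :=
  ereal_sup [set k%:E | k in [set k : R | 0 <= k /\
    ((N%:R `^ k)%:E * best_approx_error phi0 phi1 p0 s0 f N)%E
       @[N --> \oo] --> 0%E]].

End wavelets.

(* Main.v *)
Require Import Defs.
From HB Require Import structures.
From mathcomp Require Import all_boot all_order all_algebra.
From mathcomp Require Import finmap.
From mathcomp Require Import complex ring lra.
From mathcomp Require Import all_classical all_reals all_analysis.
From mathcomp Require Import measurable_realfun.

(** Put u = 1/p and u0 = 1/p0, and let a be the family of absolute values of
    the wavelet coefficients of f. Everything is read on a through one function: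
    G u ([rate a u]), the supremum of the exponents t such that 2^(j t) times the
    l^(1/u) norm of the level j of a stays bounded in j. A margin 2^(-j e)
    makes every l^q sum over the levels converge, so that, whatever q, the
    membership of f in B^s_(p,q) is decided by comparing s - u with G u, and
    s_f(p) = G u + u, denoted by S u ([crit_smoothnessE]). The l^(1/u) norm of a
    level increases with u; its growth is limited by the number of elements of the
    level, of order 2^j; and it is log-convex in u by Hoelder's inequality. Hence G
    is nonincreasing, and S is nondecreasing and concave.

    Removing from f its components on a set A of wavelets erases the
    corresponding coefficients, so up to constants sigma_N is the error of the best
    N-term approximation in l^p0 of the family b = 2^(j (s0 - u0)) a.
    If b is in l^(1/u) with geometrically decreasing levels, keeping the entries
    above a suitable threshold gives an error of order N^(-(u - u0))
    ([stechkin_direct]). Conversely an error of order N^(-k) forces the n-th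
    largest entry of b to be of order n^(-(u0 + k)), hence the levels of b to be
    bounded in l^(1/u) for all u < u0 + k ([stechkin_inverse]). Since b is in
    l^(1/u) when G u > s0 - u0, and only when G u >= s0 - u0, the number u0 + kappa is
    the abscissa where S u - u crosses the value s0 - u0: there the graph of S
    meets the line of slope 1 through (u0, s0).

    The function S u - u is concave, nonincreasing, and greater than s0 - u0 at
    u0, so there is at most one crossing. If the slope alpha_0 of S at infinity
    is less than 1 there is one, which is (2). If alpha_0 = 1 all the slopes of S
    are 1 and there is none, which is (1). Under the hypotheses of (3) S has
    slope 1 up to some point (possibly 0) and is constant afterwards; the
    crossing takes place on the plateau and its abscissa is explicit.

    It remains to see that S is finite. If it were +oo at some u then it would be so
    everywhere, and f would belong to all the spaces B^s_(1,oo); the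
    Fourier coefficients of f, which are integrals of its dyadic blocks against
    exponentials, would decrease rapidly, and f would be the sum of a smooth
    Fourier series ([besov_smooth]), contrary to the hypothesis. That a
    distribution is determined by its Fourier coefficients ([distribution_eq])
    follows from the density of trigonometric polynomials among test functions
    ([trigconvT_dense]): the convolution of a test function with the kernel
    proportional to cos(pi y)^(2n) is a trigonometric polynomial, commutes with
    the derivative, and converges uniformly to the function. *)

Set Implicit Arguments.
Unset Strict Implicit.
Unset Printing Implicit Defensive.

Import Order.TTheory GRing.Theory Num.Theory.
Import numFieldNormedType.Exports.

Local Open Scope classical_set_scope.
Local Open Scope complex_scope.
Local Open Scope ring_scope.


(** * Integration over the period *)

Section torus_integral.
Variable R : realType.
Implicit Types h k : R -> R.

Definition intT h : R := \int[muT R]_x h x.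

Let D : set (measurableTypeR R) := `[0, 1].
Let mD : measurable D. Proof. exact: measurable_itv. Qed.

Lemma muT_setC : muT R (~` D) = 0%E.
Proof. by rewrite /= /mrestr setICl measure0. Qed.

Lemma muT_setT : muT R setT = 1%E.
Proof. by rewrite /= /mrestr setTI lebesgue_measure_itv/= lte01 oppr0 adde0. Qed.

Lemma integrable_muT h : continuous h ->
  (muT R).-integrable setT (fun x => (h x)%:E).
Proof.
move=> ch.
have mh : measurable_fun setT (fun x => (h x)%:E).
  by apply/measurable_EFinP; exact: continuous_measurable_fun.
apply/(@negligible_integrable _ _ _ (muT R) setT (~` D)) => //.
- exact: measurableC.
- exact: muT_setC.
rewrite setTD setCK.
have /integrableP[m l] : (@lebesgue_measure R).-integrable D
    (fun x => (h x)%:E).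
  apply: continuous_compact_integrable; first exact: segment_compact.
  exact: continuous_subspaceT.
apply/integrableP; split => //.
rewrite (@eq_measure_integral _ _ _ _ (@lebesgue_measure R))// => A mA AD.
by rewrite /= /mrestr setIidl.
Qed.

Lemma intT_lebesgue h : continuous h ->
  intT h = \int[@lebesgue_measure R]_(x in `[0, 1]) h x.
Proof.
move=> ch; rewrite /intT /Rintegral; congr fine.
rewrite (@negligible_integral _ _ _ (muT R) setT (~` D)) //.
- rewrite setTD setCK (@eq_measure_integral _ _ _ _ (@lebesgue_measure R))// => A mA AD.
  by rewrite /= /mrestr setIidl.
- exact: measurableC.
- exact: integrable_muT.
- exact: muT_setC.
Qed.

Lemma intTD h k : continuous h -> continuous k ->
  intT (fun x => h x + k x) = intT h + intT k.
Proof. by move=> ch ck; rewrite /intT RintegralD//; exact: integrable_muT. Qed.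

Lemma intTB h k : continuous h -> continuous k ->
  intT (fun x => h x - k x) = intT h - intT k.
Proof. by move=> ch ck; rewrite /intT RintegralB//; exact: integrable_muT. Qed.

Lemma intTZ (a : R) h : continuous h ->
  intT (fun x => a * h x) = a * intT h.
Proof. by move=> ch; rewrite /intT RintegralZl//; exact: integrable_muT. Qed.

Lemma intTN h : continuous h -> intT (fun x => - h x) = - intT h.
Proof.
move=> ch; rewrite -mulN1r -intTZ//; congr intT; apply/funext => x.
by rewrite mulN1r.
Qed.

Lemma intT_cst (c : R) : intT (fun=> c) = c.
Proof. by rewrite /intT Rintegral_cst// muT_setT/= mulr1. Qed.

Lemma intT_le h k : continuous h -> continuous k ->
  (forall x, h x <= k x) -> intT h <= intT k.
Proof.
by move=> ch ck hk; rewrite /intT le_Rintegral//; exact: integrable_muT.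
Qed.

Lemma continuous_normr h : continuous h -> continuous (fun x => `|h x|).
Proof. by move=> ch x; apply: continuous_comp; [exact: ch|exact: norm_continuous]. Qed.

Lemma intT_norm h : continuous h -> `|intT h| <= intT (fun x => `|h x|).
Proof. by move=> ch; apply: le_normr_Rintegral => //; exact: integrable_muT. Qed.

Lemma intT_bound h (M : R) : continuous h -> (forall x, `|h x| <= M) ->
  `|intT h| <= M.
Proof.
move=> ch hM; apply: (le_trans (intT_norm ch)); rewrite -[leRHS]intT_cst.
by apply: intT_le => //; [exact: continuous_normr|exact: cst_continuous].
Qed.

Lemma intT_derive h : (forall x, derivable h x 1) -> continuous (derive1 h) ->
  intT (derive1 h) = h 1 - h 0.
Proof.
move=> dh ch; rewrite (intT_lebesgue ch) /Rintegral.
have c x : {for x, continuous h}.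
  by apply: differentiable_continuous; apply/derivable1_diffP.
have dcc : derivable_oo_LRcontinuous h 0 1.
  split; first by move=> x _; exact: dh.
    exact: cvg_at_right_filter (c 0).
  exact: cvg_at_left_filter (c 1).
by rewrite (continuous_FTC2 ltr01 (continuous_subspaceT ch) dcc (fun x _ => erefl)).
Qed.

(** The form in which the fundamental theorem of calculus is used throughout:
    over a full period the boundary terms cancel. *)
Lemma intT_derive_periodic h k : (forall x : R, is_derive x 1 h (k x)) ->
  continuous k -> periodic h 1 -> intT k = 0.
Proof.
move=> dh ck ph.
have E : derive1 h = k.
  by apply/funext => x; have ? := dh x; rewrite derive1E derive_val.
rewrite -E intT_derive ?E//; first by rewrite -[1]add0r ph subrr.
Qed.

End torus_integral.


(** * Smooth periodic functions *)

Section smooth_functions.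
Variable R : realType.
Implicit Types h k : R -> R.

Lemma smooth_continuous h : smooth h -> continuous h.
Proof.
move=> sh x; apply: differentiable_continuous; apply/derivable1_diffP.
exact: (sh 0%N).
Qed.

Lemma smooth_derive h : smooth h -> smooth (derive1 h).
Proof. by move=> sh n x; rewrite -derive1Sn; exact: (sh n.+1). Qed.

Lemma smooth_is_derive h (x : R) : smooth h -> is_derive x 1 h (derive1 h x).
Proof.
by move=> sh; rewrite derive1E; apply: DeriveDef => //; exact: (sh 0%N).
Qed.

Lemma smooth_derive1n h n : smooth h -> smooth (derive1n n h).
Proof.
by move=> sh m x; rewrite -[derive1n m _]/(iter m _ _) -iterD; exact: (sh (m + n)%N).
Qed.

Lemma periodic_derive h : periodic h 1 -> periodic (derive1 h) 1.
Proof.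
move=> ph x; rewrite /derive1; apply: (congr1 (fun F : R -> R => lim (F y @[y --> 0^']))).
by apply/funext => y; rewrite addrA !ph.
Qed.

Lemma periodic_derive1n h n : periodic h 1 -> periodic (derive1n n h) 1.
Proof.
by elim: n => [//|n IH] ph; rewrite derive1nS; apply: periodic_derive; exact: IH.
Qed.

Lemma periodic_int h (z : int) (x : R) : periodic h 1 -> h (x + z%:~R) = h x.
Proof.
move=> ph; have E n (y : R) : h (y + n%:R) = h y.
  elim: n y => [|n IH] y; first by rewrite addr0.
  by rewrite mulrSr addrA ph IH.
case: z => n; first exact: E.
by rewrite NegzE mulrNz -{2}[x](subrK (n.+1%:R : R)) E.
Qed.

(** A translation by an integer brings any point into the compact interval
    [0, 1], where continuity gives a bound. *)
Lemma periodic_bounded h : continuous h -> periodic h 1 ->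
  exists2 M : R, 0 < M & forall x, `|h x| <= M.
Proof.
move=> ch ph.
have [c c01 cM] : exists2 c, c \in `[(0:R), 1]%R &
    forall t, t \in `[(0:R), 1]%R -> `|h t| <= `|h c|.
  apply: EVT_max => //; apply: continuous_subspaceT.
  exact: continuous_normr.
exists (`|h c| + 1); first by rewrite ltr_wpDl.
move=> x; rewrite -(@periodic_int h (- Num.floor x) x) // mulrNz.
have : `|h (x - (Num.floor x)%:~R)| <= `|h c|.
  apply: cM; rewrite in_itv/= subr_ge0 floor_le lerBlDl.
  by rewrite ltW// (lt_le_trans (floorD1_gt x))// intrD.
by move=> /le_trans; apply; rewrite lerDl.
Qed.

Lemma smooth_periodic_lipschitz h : smooth h -> periodic h 1 ->
  exists2 L : R, 0 < L & forall x y, `|h x - h y| <= L * `|x - y|.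
Proof.
move=> sh ph.
have [L L0 hL] := periodic_bounded (smooth_continuous (smooth_derive sh))
                    (periodic_derive ph).
exists L => // x y; wlog xy : x y / y <= x.
  by move=> W; case: (leP y x) => [/W//|/ltW/W]; rewrite distrC (distrC x).
have [|//|c _ ->] := @MVT_segment R h (derive1 h) y x xy.
- by move=> z _; exact: smooth_is_derive.
- by apply: continuous_subspaceT; exact: smooth_continuous.
by rewrite normrM ler_wpM2r.
Qed.

Lemma smoothD h k : smooth h -> smooth k -> smooth (fun x => h x + k x).
Proof.
move=> sh sk; have := @smooth_lincomb _ h k 1 1 sh sk.
by congr smooth; apply/funext => x; rewrite !mul1r.
Qed.

Lemma derive1n_sub h k n : smooth h -> smooth k ->
  derive1n n (fun x => h x - k x) = fun x => derive1n n h x - derive1n n k x.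
Proof.
move=> sh sk; have := @smooth_lincomb_derive1n _ h k 1 (-1) sh sk n.
under eq_fun do rewrite mul1r mulN1r.
by move=> ->; apply/funext => x; rewrite mul1r mulN1r.
Qed.

End smooth_functions.

(** * Complex-valued test functions and the distributions they define *)

Section complex_numbers.
Variable R : realType.
Implicit Types z w : R[i].

Lemma cReD z w : complex.Re (z + w) = complex.Re z + complex.Re w.
Proof. by case: z; case: w. Qed.
Lemma cImD z w : complex.Im (z + w) = complex.Im z + complex.Im w.
Proof. by case: z; case: w. Qed.
Lemma cReB z w : complex.Re (z - w) = complex.Re z - complex.Re w.
Proof. by case: z; case: w. Qed.
Lemma cImB z w : complex.Im (z - w) = complex.Im z - complex.Im w.
Proof. by case: z; case: w. Qed.
Lemma cReM z w : complex.Re (z * w) =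
  complex.Re z * complex.Re w - complex.Im z * complex.Im w.
Proof. by case: z; case: w. Qed.
Lemma cImM z w : complex.Im (z * w) =
  complex.Re z * complex.Im w + complex.Im z * complex.Re w.
Proof. by case: z; case: w. Qed.

Lemma complex_eqP z w : complex.Re z = complex.Re w ->
  complex.Im z = complex.Im w -> z = w.
Proof. by case: z => a b; case: w => c d /= -> ->. Qed.

Lemma Re_le_normc z : `|complex.Re z| <= Normc.normc z.
Proof.
case: z => a b /=; rewrite -sqrtr_sqr ler_wsqrtr// lerDl; exact: sqr_ge0.
Qed.
Lemma Im_le_normc z : `|complex.Im z| <= Normc.normc z.
Proof.
case: z => a b /=; rewrite -sqrtr_sqr ler_wsqrtr// lerDr; exact: sqr_ge0.
Qed.
Lemma normc_le z : Normc.normc z <= `|complex.Re z| + `|complex.Im z|.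
Proof.
case: z => a b /=; rewrite -(@ler_pXn2r _ 2)// ?nnegrE ?addr_ge0 ?sqrtr_ge0//.
rewrite sqr_sqrtr ?addr_ge0 ?sqr_ge0// sqrrD !real_normK ?num_real//.
by rewrite lerD2r lerDl mulrn_wge0// mulr_ge0.
Qed.

Lemma normc_ge0 z : 0 <= Normc.normc z.
Proof. by case: z => a b; exact: sqrtr_ge0. Qed.

Lemma normcB_le z w : Normc.normc (z - w) <= Normc.normc z + Normc.normc w.
Proof. by rewrite -(normcN w); exact: le_normcD. Qed.

Lemma normc_real (a : R) : Normc.normc (a%:C) = `|a|.
Proof. by rewrite /= expr0n/= addr0 sqrtr_sqr. Qed.

End complex_numbers.

Section test_functions.
Variable R : realType.
Implicit Types g h u v : testT R.

Lemma testTP g : smooth_periodic (g : R -> R[i]).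
Proof. by case: g => g /=; rewrite inE. Qed.

Lemma smoothRe g : smooth (fun x => complex.Re (g x)).
Proof. by have [] := testTP g. Qed.
Lemma smoothIm g : smooth (fun x => complex.Im (g x)).
Proof. by have [] := testTP g. Qed.
Lemma periodicRe g : periodic (fun x => complex.Re (g x)) 1.
Proof. by have [_ _ pg] := testTP g => x; rewrite pg. Qed.
Lemma periodicIm g : periodic (fun x => complex.Im (g x)) 1.
Proof. by have [_ _ pg] := testTP g => x; rewrite pg. Qed.

Lemma testT_eqP g h : (forall x, g x = h x) -> g = h.
Proof. by move=> gh; apply/val_inj/funext. Qed.

Lemma testTZ (a : R[i]) g x : (a *: g) x = a * g x. Proof. by []. Qed.
Lemma testTD g h x : (g + h) x = g x + h x. Proof. by []. Qed.
Lemma testTB g h x : (g - h) x = g x - h x. Proof. by []. Qed.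
Lemma testT_sum (I : Type) (s : seq I) (F : I -> testT R) x :
  (\sum_(i <- s) F i) x = \sum_(i <- s) F i x.
Proof.
elim: s => [|i s IH]; first by rewrite !big_nil.
by rewrite !big_cons testTD IH.
Qed.

Lemma testT_bounded g : exists2 M : R, 0 < M & forall x, Normc.normc (g x) <= M.
Proof.
have [M M0 hM] := periodic_bounded (smooth_continuous (@smoothRe g)) (@periodicRe g).
have [N N0 hN] := periodic_bounded (smooth_continuous (@smoothIm g)) (@periodicIm g).
exists (M + N); first exact: addr_gt0.
by move=> x; apply: (le_trans (normc_le _)); exact: lerD.
Qed.

End test_functions.

Section complex_integral.
Variable R : realType.
Implicit Types g h : R -> R[i].

Definition ccontinuous g :=
  continuous (fun x => complex.Re (g x)) /\ continuous (fun x => complex.Im (g x)).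

Lemma testT_ccontinuous (g : testT R) : ccontinuous g.
Proof. by split; apply: smooth_continuous; [exact: smoothRe|exact: smoothIm]. Qed.

Lemma ccontinuousM g h : ccontinuous g -> ccontinuous h ->
  ccontinuous (fun x => g x * h x).
Proof.
move=> [gr gi] [hr hi]; split.
  under eq_fun do rewrite cReM.
  by move=> x; apply: cvgB; apply: cvgM; [exact: gr|exact: hr|exact: gi|exact: hi].
under eq_fun do rewrite cImM.
by move=> x; apply: cvgD; apply: cvgM; [exact: gr|exact: hi|exact: gi|exact: hr].
Qed.

Lemma ccontinuous_cst (a : R[i]) : ccontinuous (fun=> a).
Proof. by split; exact: cst_continuous. Qed.

Lemma integralTE g : integralT g =
  intT (fun x => complex.Re (g x)) +i* intT (fun x => complex.Im (g x)).
Proof. by []. Qed.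

Lemma integralTD g h : ccontinuous g -> ccontinuous h ->
  integralT (fun x => g x + h x) = integralT g + integralT h.
Proof.
move=> [gr gi] [hr hi]; rewrite !integralTE; apply: complex_eqP => /=.
  by rewrite -intTD//; congr intT; apply/funext => x; rewrite cReD.
by rewrite -intTD//; congr intT; apply/funext => x; rewrite cImD.
Qed.

Lemma integralTZ (a : R[i]) g : ccontinuous g ->
  integralT (fun x => a * g x) = a * integralT g.
Proof.
move=> [gr gi]; rewrite !integralTE; apply: complex_eqP; rewrite ?cReM ?cImM/=.
  rewrite -!intTZ// -intTB//.
  - by congr intT; apply/funext => x; rewrite cReM.
  - by move=> x; apply: cvgM; [exact: cst_continuous|exact: gr].
  - by move=> x; apply: cvgM; [exact: cst_continuous|exact: gi].
rewrite -!intTZ// -intTD//.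
- by congr intT; apply/funext => x; rewrite cImM.
- by move=> x; apply: cvgM; [exact: cst_continuous|exact: gi].
- by move=> x; apply: cvgM; [exact: cst_continuous|exact: gr].
Qed.

Lemma integralT_bound g (M : R) : ccontinuous g ->
  (forall x, Normc.normc (g x) <= M) -> Normc.normc (integralT g) <= 2 * M.
Proof.
move=> [gr gi] gM; rewrite integralTE; apply: (le_trans (normc_le _)) => /=.
rewrite mulr2n mulrDl mul1r; apply: lerD; apply: intT_bound => // x.
  exact: le_trans (Re_le_normc _) (gM x).
exact: le_trans (Im_le_normc _) (gM x).
Qed.

End complex_integral.

Section embedding.
Variable R : realType.
Implicit Types g h u v : testT R.

Lemma embedTC u h : embedT u h = embedT h u.
Proof. by rewrite /embedT; congr integralT; apply/funext => x; rewrite mulrC. Qed.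

Lemma embedT_scalar u : scalar (embedT u).
Proof.
move=> a g h; rewrite /embedT.
have cu := testT_ccontinuous u; have cg := testT_ccontinuous g.
have ch := testT_ccontinuous h.
rewrite -integralTZ; last exact: ccontinuousM.
rewrite -integralTD; [|by apply: ccontinuousM;
  [exact: ccontinuous_cst|exact: ccontinuousM]|exact: ccontinuousM].
congr integralT; apply/funext => x.
by rewrite testTD testTZ mulrDr mulrCA.
Qed.

Lemma embedT_bound u h (M d : R) : (forall x, Normc.normc (u x) <= M) ->
  (forall x, Normc.normc (h x) <= d) -> Normc.normc (embedT u h) <= 2 * (M * d).
Proof.
move=> uM hd; apply: integralT_bound.
  exact: ccontinuousM (testT_ccontinuous _) (testT_ccontinuous _).
by move=> x; rewrite Normc.normcM; apply: ler_pM => //; exact: normc_ge0.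
Qed.

Lemma scalarB (f : testT R -> R[i]) g h : scalar f -> f (g - h) = f g - f h.
Proof. by move=> sf; rewrite addrC -scaleN1r sf mulN1r addrC. Qed.

Lemma cderive1n0 (g : R -> R[i]) x : cderive1n 0 g x = g x.
Proof. exact: complex_eqP. Qed.

Lemma embedT_distribution u : periodic_distribution (embedT u).
Proof.
split; first exact: embedT_scalar.
move=> g e e0; have [M M0 uM] := testT_bounded u.
exists 0%N, (e / (4 * M)); split; first by rewrite divr_gt0// mulr_gt0.
move=> h hd; rewrite -scalarB; last exact: embedT_scalar.
apply: (@le_lt_trans _ _ (2 * (M * (e / (4 * M))))).
  apply: embedT_bound => // x.
  by rewrite -cderive1n0 ltW// hd.
rewrite (_ : 2 * _ = e / 2); last by field; rewrite gt_eqF.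
by rewrite gtr_pMr// invf_lt1// ltr1n.
Qed.

End embedding.


(** * Exponentials and trigonometric kernels *)

Section exponentials.
Variable R : realType.
Implicit Types (j k : int) (x : R).

Definition cosT k x : R := cos (2 * pi * k%:~R * x).
Definition sinT k x : R := sin (2 * pi * k%:~R * x).

Lemma expTE k x : expT R k x = cosT k x +i* sinT k x. Proof. by []. Qed.

Lemma is_derive_cosT k x :
  is_derive x 1 (@cosT k) (- (2 * pi * k%:~R) * sinT k x).
Proof.
by apply: is_derive_eq; rewrite /GRing.scale/= /sinT; ring.
Qed.

Lemma is_derive_sinT k x :
  is_derive x 1 (@sinT k) ((2 * pi * k%:~R) * cosT k x).
Proof. by apply: is_derive_eq; rewrite /GRing.scale/= /cosT; ring. Qed.

Lemma continuous_cosT k : continuous (@cosT k).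
Proof.
move=> x; apply: differentiable_continuous; apply/derivable1_diffP.
by have ? := is_derive_cosT k x; exact: ex_derive.
Qed.

Lemma continuous_sinT k : continuous (@sinT k).
Proof.
move=> x; apply: differentiable_continuous; apply/derivable1_diffP.
by have ? := is_derive_sinT k x; exact: ex_derive.
Qed.

Lemma periodic_cosT k : periodic (@cosT k) 1.
Proof. by move=> x; have [] := cos_sin_period k x. Qed.
Lemma periodic_sinT k : periodic (@sinT k) 1.
Proof. by move=> x; have [] := cos_sin_period k x. Qed.

Lemma cosTN k x : cosT (- k) x = cosT k x.
Proof. by rewrite /cosT mulrNz mulrN mulNr cosN. Qed.
Lemma sinTN k x : sinT (- k) x = - sinT k x.
Proof. by rewrite /sinT mulrNz mulrN mulNr sinN. Qed.

Lemma expTM j k x : expT R j x * expT R k x = expT R (j + k) x.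
Proof.
rewrite !expTE /cosT /sinT; move: (2 * pi) => w.
rewrite intrD mulrDr mulrDl cosD sinD.
by apply: complex_eqP; rewrite ?cReM ?cImM //= addrC.
Qed.

Lemma conjT_expT k : conjT (expT R k) = expT R (- k).
Proof. by apply: testT_eqP => x; rewrite !expTE cosTN sinTN. Qed.

Lemma intT_cosT k : intT (@cosT k) = (k == 0)%:R.
Proof.
have [->|k0] := eqVneq k 0.
  rewrite -[RHS]intT_cst; congr intT; apply/funext => x.
  by rewrite /cosT mulr0 mul0r cos0.
have w0 : 2 * pi * k%:~R != 0 :> R.
  by rewrite !mulf_neq0 ?intr_eq0// gt_eqF// pi_gt0.
have : intT (fun x => (2 * pi * k%:~R) * cosT k x) = 0.
  apply: (@intT_derive_periodic _ (@sinT k)).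
  - by move=> x; exact: is_derive_sinT.
  - by move=> x; apply: cvgM; [exact: cst_continuous|exact: continuous_cosT].
  - exact: periodic_sinT.
rewrite intTZ; last exact: continuous_cosT.
by move/eqP; rewrite mulf_eq0 (negbTE w0)/= => /eqP.
Qed.

Lemma intT_sinT k : intT (@sinT k) = 0.
Proof.
have [->|k0] := eqVneq k 0.
  rewrite -[RHS]intT_cst; congr intT; apply/funext => x.
  by rewrite /sinT mulr0 mul0r sin0.
have w0 : - (2 * pi * k%:~R) != 0 :> R.
  by rewrite oppr_eq0 !mulf_neq0 ?intr_eq0// gt_eqF// pi_gt0.
have : intT (fun x => - (2 * pi * k%:~R) * sinT k x) = 0.
  apply: (@intT_derive_periodic _ (@cosT k)).
  - by move=> x; exact: is_derive_cosT.
  - by move=> x; apply: cvgM; [exact: cst_continuous|exact: continuous_sinT].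
  - exact: periodic_cosT.
rewrite intTZ; last exact: continuous_sinT.
by move/eqP; rewrite mulf_eq0 (negbTE w0)/= => /eqP.
Qed.

Lemma integralT_expT k : integralT (expT R k) = (k == 0)%:R.
Proof.
rewrite integralTE; apply: complex_eqP => /=.
  by rewrite [LHS]intT_cosT; case: (k == 0).
by rewrite [LHS]intT_sinT; case: (k == 0).
Qed.

Lemma embedT_expT j k : embedT (expT R j) (expT R k) = (j + k == 0)%:R.
Proof.
rewrite -integralT_expT /embedT; congr integralT; apply/funext => x.
exact: expTM.
Qed.

Lemma normc_expT k x : Normc.normc (expT R k x) = 1.
Proof. by rewrite /= cos2Dsin2 sqrtr1. Qed.

End exponentials.

Section kernel.
Variable R : realType.
Implicit Types (h : R -> R) (s : seq (R * int)).

(** The square is taken first so that the kernel has period 1 and is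
    nonnegative; this is the de la Vallee Poussin kernel up to its mass. *)
Definition kern (n : nat) (y : R) : R := cos (pi * y) ^+ 2 ^+ n.

Definition trigsum s (y : R) : R := \sum_(a <- s) a.1 * cosT a.2 y.

(** Each factor cos(pi y)^2 = (1 + cos(2 pi y)) / 2 replaces a frequency k by
    the frequencies k, k + 1 and k - 1. Frequencies are integers of either
    sign so that k - 1 needs no special case at k = 0. *)
Lemma kern_trigsum n : exists s, forall y, kern n y = trigsum s y.
Proof.
elim: n => [|n [s hs]].
  exists [:: (1, 0)] => y; rewrite /trigsum big_seq1 /cosT/= !mulr0 mul0r cos0.
  by rewrite mulr1 /kern expr0.
exists ([seq (a.1 / 2, a.2) | a <- s] ++ [seq (a.1 / 4, a.2 + 1) | a <- s]
        ++ [seq (a.1 / 4, a.2 - 1) | a <- s]) => y.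
rewrite /kern exprS -/(kern n y) hs /trigsum !big_cat !big_map/= mulr_sumr.
rewrite -!big_split/=; apply: eq_bigr => -[a k] _ /=.
have cosTD (j l : int) : cosT (j + l) y = cosT j y * cosT l y - sinT j y * sinT l y.
  have := congr1 (@complex.Re R) (expTM j l y). by rewrite cReM.
have c1 : cosT 1 y = cos (pi * y) ^+ 2 *+ 2 - 1.
  rewrite -cos_mulr2n /cosT; congr cos; move: pi => w; ring.
rewrite !cosTD cosTN sinTN c1 mulrN; by field.
Qed.

Lemma kern_ge0 n y : 0 <= kern n y.
Proof. by rewrite /kern exprn_ge0// sqr_ge0. Qed.

(** The derivative that makes the recursion of Wallis integrals appear:
    sin cos^(2n+1) is periodic, so that the integral of the right-hand side
    vanishes. *)
Lemma is_derive_sincos n (x t : R) :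
  is_derive t 1 (fun t => sin (pi * (x - t)) * cos (pi * (x - t)) * kern n (x - t))
    (pi * ((n.*2.+1)%:R * kern n (x - t) - (n.*2.+2)%:R * kern n.+1 (x - t))).
Proof.
rewrite /kern; move: pi => w.
have dy : is_derive t 1 (fun t => w * (x - t)) (- w).
  by apply: is_derive_eq; rewrite /GRing.scale/=; ring.
have ds : is_derive t 1 (fun t => sin (w * (x - t))) (- w * cos (w * (x - t))).
  by apply: is_derive_eq; rewrite mulrC.
have dc : is_derive t 1 (fun t => cos (w * (x - t))) (w * sin (w * (x - t))).
  by apply: is_derive_eq; rewrite mulrNN mulrC.
have D := is_deriveM ds (is_deriveX n.*2.+1 dc).
rewrite (_ : (fun t => _) = (fun t => sin (w * (x - t))) *
    (fun t => cos (w * (x - t))) ^+ (n.*2.+1)); last first.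
  apply/funext => u /=; rewrite -exprM mul2n -mulrA -exprS.
  by rewrite exprfctE.
apply: (is_derive_eq D); rewrite /GRing.scale/= exprfctE.
rewrite [n.*2.+2%:R]mulrSr [cos _ ^+ 2 ^+ n.+1]exprS -!exprM mul2n exprS.
move: (sin _) (cos _) (sin2cos2 (w * (x - t))) => a b ab.
move: (b ^+ n.*2) (n.*2.+1%:R : R) => E N.
transitivity (w * (N * E * a ^+ 2 - b ^+ 2 * E)); first by ring.
by rewrite ab; ring.
Qed.

Lemma periodic_kern n : periodic (kern n) 1.
Proof.
move=> y; rewrite /kern mulrDr mulr1.
by rewrite [in LHS](_ : cos _ = - cos (pi * y)) ?sqrrN//; exact: cosDpi.
Qed.

Lemma continuous_kern n : continuous (kern n).
Proof.
have [s hs] := kern_trigsum n.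
rewrite (_ : kern n = trigsum s); last exact/funext.
rewrite /trigsum; elim: s {hs} => [|a s IH].
  rewrite (_ : (fun y => _) = fun=> 0); first exact: cst_continuous.
  by apply/funext => y; rewrite big_nil.
rewrite (_ : (fun y => _) = fun y => a.1 * cosT a.2 y + \sum_(i <- s) i.1 * cosT i.2 y).
  move=> x; apply: cvgD; last exact: IH.
  by apply: cvgM; [exact: cst_continuous|exact: continuous_cosT].
by apply/funext => y; rewrite big_cons.
Qed.

Lemma continuous_reflect h (x : R) : continuous h -> continuous (fun t => h (x - t)).
Proof.
move=> ch t; apply: (@continuous_comp _ _ _ (fun t => x - t) h); last exact: ch.
by apply: cvgB; [exact: cst_continuous|exact: cvg_id].
Qed.

Definition wallis (n : nat) : R := \prod_(i < n) ((i.*2.+1)%:R / (i.*2.+2)%:R).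

Lemma wallis_gt0 n : 0 < wallis n.
Proof. by apply: prodr_gt0 => i _; rewrite divr_gt0. Qed.

(** The mass of the kernel does not depend on the centre x: both sides satisfy
    the recursion (2n+2) I_(n+1) = (2n+1) I_n with I_0 = 1. *)
Lemma intT_kern n (x : R) : intT (fun t => kern n (x - t)) = wallis n.
Proof.
elim: n => [|n IH].
  rewrite /wallis big_ord0 -[RHS]intT_cst; congr intT.
rewrite /wallis big_ord_recr/= -/(wallis n) -IH.
have ck m := @continuous_reflect _ x (@continuous_kern m).
have := @intT_derive_periodic _ _ _ (is_derive_sincos n x).
under [X in intT X]eq_fun do rewrite mulrBr !mulrA.
rewrite intTB; [|by move=> t; apply: cvgM; [exact: cst_continuous|exact: ck]
  |by move=> t; apply: cvgM; [exact: cst_continuous|exact: ck]].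
rewrite !intTZ//.
move=> W; have : pi * n.*2.+1%:R * intT (fun t => kern n (x - t)) =
    pi * n.*2.+2%:R * intT (fun t => kern n.+1 (x - t)).
  apply/eqP; rewrite -subr_eq0; apply/eqP; apply: W.
    under eq_fun do rewrite mulrBr !mulrA.
    by move=> t; apply: cvgB; apply: cvgM; [exact: cst_continuous|exact: ck|exact: cst_continuous|exact: ck].
  move=> t; rewrite opprD addrA; set y := x - t.
  rewrite -[in RHS](subrK 1 y); move: (y - 1) => z.
  rewrite periodic_kern mulrDr mulr1.
  by rewrite (sinDpi (pi * z)) (cosDpi (pi * z)) mulrNN.
move=> E; apply: (@mulfI _ (pi * n.*2.+2%:R)).
  by rewrite mulf_neq0// gt_eqF// pi_gt0.
by rewrite -E; field.
Qed.

End kernel.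


(** * Density of trigonometric polynomials among test functions *)

Section convolution.
Variable R : realType.
Implicit Types (h : R -> R) (s : seq (R * int)) (g : testT R).

(** The convolution of h with [trigsum s], expanded by the addition formula of
    the cosine: written in this form it is visibly a trigonometric polynomial. *)
Definition trigconv s h (x : R) : R := \sum_(a <- s) a.1 *
  (cosT a.2 x * intT (fun t => h t * cosT a.2 t) +
   sinT a.2 x * intT (fun t => h t * sinT a.2 t)).

Lemma trigconvE s h x : continuous h ->
  trigconv s h x = intT (fun t => h t * trigsum s (x - t)).
Proof.
move=> ch; rewrite /trigconv /trigsum.
have cts (k : int) : continuous (fun t : R => cosT k (x - t)).
  by apply: (@continuous_reflect R (@cosT R k) x); exact: continuous_cosT.
elim: s => [|[a k] s IH].
  rewrite big_nil -[LHS]intT_cst; congr intT; apply/funext => t.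
  by rewrite big_nil mulr0.
have cs : continuous (fun t => \sum_(i <- s) i.1 * cosT i.2 (x - t)).
  elim: (s) => [|b r IHr].
    rewrite (_ : (fun y => _) = fun=> 0); first exact: cst_continuous.
    by apply/funext => y; rewrite big_nil.
  rewrite (_ : (fun y => _) = fun y => b.1 * cosT b.2 (x - y) + \sum_(i <- r) i.1 * cosT i.2 (x - y)).
    move=> t; apply: cvgD; last exact: IHr.
    by apply: cvgM; [exact: cst_continuous|exact: cts].
  by apply/funext => y; rewrite big_cons.
rewrite big_cons IH.
rewrite -!intTZ; do 1?[by move=> t; apply: cvgM; [exact: ch|exact: continuous_cosT]
  | by move=> t; apply: cvgM; [exact: ch|exact: continuous_sinT]].
have c1 : continuous (fun t => cosT k x * (h t * cosT k t)).
  by move=> t; apply: cvgM; [exact: cst_continuous|apply: cvgM; [exact: ch|exact: continuous_cosT]].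
have c2 : continuous (fun t => sinT k x * (h t * sinT k t)).
  by move=> t; apply: cvgM; [exact: cst_continuous|apply: cvgM; [exact: ch|exact: continuous_sinT]].
have c3 : continuous (fun t => cosT k x * (h t * cosT k t) + sinT k x * (h t * sinT k t)).
  by move=> t; apply: cvgD; [exact: c1|exact: c2].
rewrite -intTD// -intTZ// -intTD.
- congr intT; apply/funext => t; rewrite big_cons [RHS]mulrDr; congr (_ + _) => /=.
  have -> : cosT k (x - t) = cosT k x * cosT k t + sinT k x * sinT k t.
    by rewrite /cosT /sinT mulrBr cosB.
  by rewrite /=; ring.
- by move=> t; apply: cvgM; [exact: cst_continuous|exact: c3].
- by move=> t; apply: cvgM; [exact: ch|exact: cs].
Qed.

Lemma intT_by_parts h k (dh dk : R -> R) :
  (forall x : R, is_derive x 1 h (dh x)) -> (forall x : R, is_derive x 1 k (dk x)) ->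
  continuous dh -> continuous dk -> periodic h 1 -> periodic k 1 ->
  intT (fun t => dh t * k t) = - intT (fun t => h t * dk t).
Proof.
move=> Dh Dk cdh cdk ph pk.
have c f df : (forall x : R, is_derive x 1 f (df x)) -> continuous (f : R -> R).
  move=> Df x; apply: differentiable_continuous; apply/derivable1_diffP.
  by have ? := Df x; exact: ex_derive.
apply/eqP; rewrite -addr_eq0 -intTD.
- apply/eqP; apply: (@intT_derive_periodic _ (fun x => h x * k x)).
  + move=> x; have D := is_deriveM (Dh x) (Dk x).
    by apply: (is_derive_eq D); rewrite /GRing.scale/= addrC [k x * _]mulrC.
  + by move=> x; apply: cvgD; apply: cvgM; [exact: cdh|exact: c Dk x|exact: c Dh x|exact: cdk].
  + by move=> x; rewrite ph pk.
- by move=> x; apply: cvgM; [exact: cdh|exact: c Dk x].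
- by move=> x; apply: cvgM; [exact: c Dh x|exact: cdk].
Qed.

(** Convolution commutes with the derivative: the derivative falls on the
    trigonometric polynomials, and integration by parts moves it to h. *)
Lemma is_derive_trigconv s h (x : R) : smooth h -> periodic h 1 ->
  is_derive x 1 (trigconv s h) (trigconv s (derive1 h) x).
Proof.
move=> sh ph; rewrite /trigconv.
elim: s => [|[a k] s IH].
  rewrite (_ : (fun y => _) = cst 0) ?big_nil; last by apply/funext => y; rewrite big_nil.
  exact: is_derive_cst.
rewrite big_cons /=.
rewrite (_ : (fun y => _) = (fun y =>
   a * (cosT k y * intT (fun t => h t * cosT k t) +
        sinT k y * intT (fun t => h t * sinT k t))) +
   (fun y => \sum_(a <- s) a.1 *
  (cosT a.2 y * intT (fun t => h t * cosT a.2 t) +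
   sinT a.2 y * intT (fun t => h t * sinT a.2 t)))); last first.
  by apply/funext => y; rewrite big_cons.
apply: is_deriveD.
have -> : intT (fun t => h^`()%classic t * cosT k t) =
    2 * pi * k%:~R * intT (fun t => h t * sinT k t).
  rewrite (intT_by_parts (k := cosT k) (fun y => smooth_is_derive y sh) (is_derive_cosT k)) //.
  - rewrite -intTN; last first.
      move=> t; apply: cvgM; [exact: smooth_continuous|].
      by apply: cvgM; [exact: cst_continuous|exact: continuous_sinT].
    rewrite -intTZ; last first.
      by move=> t; apply: cvgM; [exact: smooth_continuous|exact: continuous_sinT].
    congr intT; apply/funext => t; ring.
  - by apply: smooth_continuous; exact: smooth_derive.
  - by move=> t; apply: cvgM; [exact: cst_continuous|exact: continuous_sinT].
  - exact: periodic_cosT.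
have -> : intT (fun t => h^`()%classic t * sinT k t) =
    - (2 * pi * k%:~R) * intT (fun t => h t * cosT k t).
  rewrite (intT_by_parts (k := sinT k) (fun y => smooth_is_derive y sh) (is_derive_sinT k)) //.
  - rewrite mulNr -intTZ; last first.
      by move=> t; apply: cvgM; [exact: smooth_continuous|exact: continuous_cosT].
    congr (- intT _); apply/funext => t; ring.
  - by apply: smooth_continuous; exact: smooth_derive.
  - by move=> t; apply: cvgM; [exact: cst_continuous|exact: continuous_cosT].
  - exact: periodic_sinT.
move: (intT _) (intT _) => P Q.
have dc := is_derive_cosT k x; have ds := is_derive_sinT k x.
apply: is_derive_eq; rewrite /GRing.scale/=; ring.
Qed.

Lemma derive1n_trigconv s h n : smooth h -> periodic h 1 ->
  derive1n n (trigconv s h) = trigconv s (derive1n n h).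
Proof.
move=> sh ph; elim: n => [//|n IH]; rewrite !derive1nS IH; apply/funext => x.
have ? := @is_derive_trigconv s _ x (@smooth_derive1n _ _ n sh) (@periodic_derive1n _ _ n ph).
by rewrite derive1E derive_val.
Qed.

Lemma smooth_trigconv s h : smooth h -> periodic h 1 -> smooth (trigconv s h).
Proof.
move=> sh ph n x; rewrite derive1n_trigconv//.
have ? := @is_derive_trigconv s _ x (@smooth_derive1n _ _ n sh) (@periodic_derive1n _ _ n ph).
exact: ex_derive.
Qed.

(** Near t = x (modulo 1) this is the uniform continuity of h; elsewhere
    sin^2 is bounded below, and a multiple of it absorbs the bound 2 sup |h|. *)
Lemma sin2_modulus h (e : R) : smooth h -> periodic h 1 -> 0 < e ->
  exists2 M : R, 0 < M & forall x t, `|h t - h x| <= e + M * sin (pi * (x - t)) ^+ 2.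
Proof.
move=> sh ph e0.
have [L L0 hL] := smooth_periodic_lipschitz sh ph.
have [B B0 hB] := periodic_bounded (smooth_continuous sh) ph.
pose d := Num.min (e / L) 2^-1.
have d0 : 0 < d by rewrite lt_min divr_gt0//= invr_gt0.
have d2 : d <= 2^-1 by rewrite ge_min lexx orbT.
have sd : 0 < sin (pi * d) ^+ 2.
  rewrite exprn_gt0// sin_gt0_pi// mulr_gt0 ?pi_gt0//=.
  rewrite gtr_pMr ?pi_gt0// (le_lt_trans d2)// invf_lt1// ltr1n//.
exists ((B + B) / sin (pi * d) ^+ 2); first by rewrite divr_gt0// addr_gt0.
move=> x t.
(* x - t - z is the representative of x - t modulo 1 that is closest to 0 *)
have [z zP] : exists z : int, `|x - t - z%:~R| <= 2^-1.
  exists (Num.floor (x - t + 2^-1)).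
  have := floor_le (x - t + 2^-1); have := floorD1_gt (x - t + 2^-1).
  rewrite intrD; set w := (Num.floor _)%:~R => w1 w2.
  by rewrite ler_norml; apply/andP; split; lra.
have ps : periodic (fun y : R => sin (pi * y) ^+ 2) 1.
  by move=> y; rewrite mulrDr mulr1 (sinDpi (pi * y)) sqrrN.
rewrite -(periodic_int (- z) (x - t) ps) -(periodic_int z t ph) mulrNz.
set y := x - t - z%:~R in zP *.
have hyt : t + z%:~R - x = - y by rewrite /y; ring.
have s0 : 0 <= sin (pi * y) ^+ 2 by exact: sqr_ge0.
case: (leP `|y| d) => yd.
  apply: (@le_trans _ _ e).
    apply: (le_trans (hL _ _)); rewrite hyt normrN mulrC -ler_pdivlMr//.
    by apply: (le_trans yd); rewrite ge_min lexx.
  by rewrite lerDl mulr_ge0// divr_ge0 ?addr_ge0 ?ltW.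
apply: (@le_trans _ _ (B + B)).
  by apply: (le_trans (ler_normB _ _)); exact: lerD.
rewrite -[leLHS]add0r; apply: lerD; first exact: ltW.
rewrite mulrAC ler_pdivlMr// ler_pM2l ?addr_gt0//.
have -> : sin (pi * y) ^+ 2 = sin (pi * `|y|) ^+ 2.
  by case: (ler0P y) => _; rewrite ?mulrN ?sinN ?sqrrN.
have p2 (r : R) : 0 < r <= 2^-1 -> pi * r \in `[- (pi / 2), pi / 2].
  move=> /andP[r0 r2]; have := pi_gt0 R => p0; rewrite in_itv/=; apply/andP; split.
    by rewrite (@le_trans _ _ 0)// ?oppr_le0 ?mulr_ge0 ?invr_ge0// ltW.
  by rewrite ler_pM2l.
rewrite ler_sqr ?nnegrE; last 2 first.
- apply: sin_ge0_pi; rewrite mulr_ge0 ?pi_ge0 ?(ltW d0)//=.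
  by rewrite ger_pMr ?pi_gt0// (le_trans d2)// invf_le1// ler1n.
- apply: sin_ge0_pi; rewrite mulr_ge0 ?pi_ge0//=.
  by rewrite ger_pMr ?pi_gt0// (le_trans zP)// invf_le1// ler1n.
rewrite ltW// ltr_sin.
- by rewrite ltr_pM2l// pi_gt0.
- by apply: p2; rewrite d0.
- by apply: p2; rewrite zP (lt_trans d0).
Qed.

End convolution.


Section density.
Variable R : realType.
Implicit Types (h : R -> R) (s : seq (R * int)) (g : testT R).

Lemma normalized_kern_trigsum (n : nat) :
  exists s, forall y : R, kern n y / wallis R n = trigsum s y.
Proof.
have [s hs] := kern_trigsum R n; exists [seq (a.1 / wallis R n, a.2) | a <- s] => y.
rewrite hs /trigsum big_map mulr_suml; apply: eq_bigr => a _ /=.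
by rewrite mulrAC.
Qed.

(** By [sin2_modulus], the error is at most e/2 plus M times the ratio of
    the integrals of sin^2 cos^(2n) and cos^(2n). As sin^2 = 1 - cos^2, the
    Wallis recursion makes this ratio equal to 1 / (2n + 2). *)
Lemma trigconv_approx (s : nat -> seq (R * int)) h (e : R) :
  (forall n y, kern n y / wallis R n = trigsum (s n) y) ->
  smooth h -> periodic h 1 -> 0 < e ->
  exists N : nat, forall n, (N <= n)%N -> forall x, `|trigconv (s n) h x - h x| < e.
Proof.
move=> hs sh ph e0; have ch := smooth_continuous sh.
have e20 : 0 < e / 2 by rewrite divr_gt0.
have [M M0 hM] := sin2_modulus sh ph e20.
exists (Num.truncn (M / e)).+1 => n Nn x.
have ck m := @continuous_reflect _ _ x (@continuous_kern R m).
have w0 := wallis_gt0 R n.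
have chk : continuous (fun t => h t * kern n (x - t)).
  by move=> t; apply: cvgM; [exact: ch|exact: ck].
have -> : trigconv (s n) h x - h x =
    (wallis R n)^-1 * intT (fun t => h t * kern n (x - t) - h x * kern n (x - t)).
  rewrite trigconvE// intTB//; last first.
    by move=> t; apply: cvgM; [exact: cst_continuous|exact: ck].
  rewrite intTZ// intT_kern mulrBr (mulrC (h x)) mulKf ?gt_eqF// -intTZ//.
  by congr (intT _ - _); apply/funext => t; rewrite -hs mulrA mulrC.
rewrite normrM gtr0_norm ?invr_gt0// mulrC ltr_pdivrMr//.
have cd : continuous (fun t => h t * kern n (x - t) - h x * kern n (x - t)).
  move=> t; apply: cvgB; first exact: chk.
  by apply: cvgM; [exact: cst_continuous|exact: ck].
apply: (le_lt_trans (intT_norm cd)).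
have c1 : continuous (fun t => e / 2 * kern n (x - t)).
  by move=> t; apply: cvgM; [exact: cst_continuous|exact: ck].
have c2 : continuous (fun t => kern n (x - t) - kern n.+1 (x - t)).
  by move=> t; apply: cvgB; exact: ck.
have c3 : continuous (fun t => M * (kern n (x - t) - kern n.+1 (x - t))).
  by move=> t; apply: cvgM; [exact: cst_continuous|exact: c2].
apply: (@le_lt_trans _ _ (intT (fun t => e / 2 * kern n (x - t) +
    M * (kern n (x - t) - kern n.+1 (x - t))))).
  apply: intT_le; first exact: continuous_normr.
    by move=> t; apply: cvgD; [exact: c1|exact: c3].
  move=> t; rewrite -mulrBl normrM (ger0_norm (kern_ge0 n _)).
  apply: (le_trans (ler_wpM2r (kern_ge0 n _) (hM x t))).
  rewrite mulrDl lerD2l -mulrA ler_pM2l// sin2cos2.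
  by rewrite mulrBl mul1r /kern -exprS.
rewrite intTD// !intTZ// intTB// !intT_kern.
rewrite [wallis R n.+1]/wallis big_ord_recr/= -/(wallis R n).
rewrite (_ : e / 2 * _ + _ = (e / 2 + M / n.*2.+2%:R) * wallis R n); last first.
  have : n.*2.+2%:R != 0 :> R by [].
  by rewrite [n.*2.+2%:R]mulrSr; move: (n.*2.+1%:R : R) => m m0; field.
rewrite ltr_pM2r//.
have : M / e < n.+1%:R.
  apply: (lt_le_trans (truncnS_gt _)); rewrite ler_nat; exact: leq_trans Nn _.
rewrite ltr_pdivrMr// => Mn.
rewrite -ltrBrDl ltr_pdivrMr//.
rewrite (_ : e - e / 2 = e / 2); last by field.
by rewrite (_ : n.*2.+2 = n.+1 * 2)%N ?natrM ?muln2// mulrA mulrAC divfK// mulrC.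
Qed.

(** The complex version of [trigconv], as an element of the span of the
    exponentials: cos(2 pi k (x - t)) is the half-sum of e_k(x) e_(-k)(t) and
    e_(-k)(x) e_k(t). *)
Definition trigconvT s g : testT R := \sum_(a <- s) (a.1 / 2)%:C *:
  (embedT g (expT R (- a.2)) *: expT R a.2 + embedT g (expT R a.2) *: expT R (- a.2)).

Lemma trigconvT_ReIm s g (x : R) :
  complex.Re (trigconvT s g x) = trigconv s (fun t => complex.Re (g t)) x /\
  complex.Im (trigconvT s g x) = trigconv s (fun t => complex.Im (g t)) x.
Proof.
rewrite /trigconvT testT_sum /trigconv.
elim: s => [|[a k] s [IHr IHi]]; first by rewrite !big_nil.
rewrite !big_cons cReD cImD IHr IHi.
have gk (j : int) : embedT g (expT R j) =
  (intT (fun t => complex.Re (g t) * cosT j t) - intT (fun t => complex.Im (g t) * sinT j t)) +i*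
  (intT (fun t => complex.Re (g t) * sinT j t) + intT (fun t => complex.Im (g t) * cosT j t)).
  have [cr ci] := testT_ccontinuous g.
  rewrite /embedT integralTE; apply: complex_eqP => /=.
    rewrite -intTB.
    - by congr intT; apply/funext => t; rewrite cReM.
    - by move=> t; apply: cvgM; [exact: cr|exact: continuous_cosT].
    - by move=> t; apply: cvgM; [exact: ci|exact: continuous_sinT].
  rewrite -intTD.
  - by congr intT; apply/funext => t; rewrite cImM.
  - by move=> t; apply: cvgM; [exact: cr|exact: continuous_sinT].
  - by move=> t; apply: cvgM; [exact: ci|exact: continuous_cosT].
rewrite -[(a, k).2]/k -[(a, k).1]/a testTZ testTD !testTZ !gk !expTE cosTN sinTN.
have [cr ci] := testT_ccontinuous g.
have -> : (fun t => complex.Re (g t) * cosT (- k) t) = (fun t => complex.Re (g t) * cosT k t).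
  by apply/funext => t; rewrite cosTN.
have -> : (fun t => complex.Im (g t) * cosT (- k) t) = (fun t => complex.Im (g t) * cosT k t).
  by apply/funext => t; rewrite cosTN.
have -> : intT (fun t => complex.Re (g t) * sinT (- k) t) = - intT (fun t => complex.Re (g t) * sinT k t).
  rewrite -intTN; last by move=> t; apply: cvgM; [exact: cr|exact: continuous_sinT].
  by congr intT; apply/funext => t; rewrite sinTN mulrN.
have -> : intT (fun t => complex.Im (g t) * sinT (- k) t) = - intT (fun t => complex.Im (g t) * sinT k t).
  rewrite -intTN; last by move=> t; apply: cvgM; [exact: ci|exact: continuous_sinT].
  by congr intT; apply/funext => t; rewrite sinTN mulrN.
by split; congr (_ + _); rewrite ?(cReM, cImM, cReD, cImD) /=; field.
Qed.

(** As convolution commutes with derivatives, one kernel of large order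
    approximates simultaneously the derivatives of order up to n. *)
Lemma trigconvT_dense (g : testT R) (n : nat) (d : R) : 0 < d -> exists s,
  forall i x, (i <= n)%N -> Normc.normc (cderive1n i (trigconvT s g - g) x) < d.
Proof.
move=> d0.
have [s hs] := choice normalized_kern_trigsum.
have d20 : 0 < d / 2 by rewrite divr_gt0.
have srg i := @smooth_derive1n _ _ i (@smoothRe _ g).
have sig i := @smooth_derive1n _ _ i (@smoothIm _ g).
have prg i := @periodic_derive1n _ _ i (@periodicRe _ g).
have pig i := @periodic_derive1n _ _ i (@periodicIm _ g).
have [N HN] : exists N : nat, forall m, (N <= m)%N -> forall i x, (i <= n)%N ->
   `|trigconv (s m) (derive1n i (fun t => complex.Re (g t))) x -
     derive1n i (fun t => complex.Re (g t)) x| < d / 2 /\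
   `|trigconv (s m) (derive1n i (fun t => complex.Im (g t))) x -
     derive1n i (fun t => complex.Im (g t)) x| < d / 2.
  elim: n => [|n [N IH]].
    have [N1 H1] := trigconv_approx hs (srg 0%N) (prg 0%N) d20.
    have [N2 H2] := trigconv_approx hs (sig 0%N) (pig 0%N) d20.
    exists (maxn N1 N2) => m; rewrite geq_max => /andP[m1 m2] i x.
    by rewrite leqn0 => /eqP ->; split; [exact: H1|exact: H2].
  have [N1 H1] := trigconv_approx hs (srg n.+1) (prg n.+1) d20.
  have [N2 H2] := trigconv_approx hs (sig n.+1) (pig n.+1) d20.
  exists (maxn N (maxn N1 N2)) => m; rewrite !geq_max => /and3P[m0 m1 m2] i x.
  rewrite leq_eqVlt => /predU1P[->|]; first by split; [exact: H1|exact: H2].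
  by rewrite ltnS => lin; exact: IH.
exists (s N) => i x lin; have [H1 H2] := HN N (leqnn N) i x lin.
rewrite /cderive1n.
have -> : (fun y => complex.Re ((trigconvT (s N) g - g) y)) =
   (fun y => trigconv (s N) (fun t => complex.Re (g t)) y - complex.Re (g y)).
  by apply/funext => y; rewrite testTB cReB (trigconvT_ReIm _ _ _).1.
have -> : (fun y => complex.Im ((trigconvT (s N) g - g) y)) =
   (fun y => trigconv (s N) (fun t => complex.Im (g t)) y - complex.Im (g y)).
  by apply/funext => y; rewrite testTB cImB (trigconvT_ReIm _ _ _).2.
have sR := @smoothRe _ g; have pR := @periodicRe _ g.
have sI := @smoothIm _ g; have pI := @periodicIm _ g.
rewrite (derive1n_sub i (smooth_trigconv (s := s N) sR pR) sR).
rewrite (derive1n_sub i (smooth_trigconv (s := s N) sI pI) sI).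
rewrite (derive1n_trigconv (s N) i sR pR) (derive1n_trigconv (s N) i sI pI).
apply: (le_lt_trans (normc_le _)) => /=.
by rewrite [d](splitr d) ltrD.
Qed.

(** Continuity and the density of the span of the exponentials. *)
Lemma distribution_eq (f1 f2 : testT R -> R[i]) :
  periodic_distribution f1 -> periodic_distribution f2 ->
  (forall k, f1 (expT R k) = f2 (expT R k)) -> f1 = f2.
Proof.
move=> [s1 c1] [s2 c2] H; apply/funext => g; apply/eqP; rewrite -subr_eq0; apply/eqP.
apply: Normc.eq0_normc; apply/eqP; rewrite eq_le normc_ge0 andbT.
apply/ler_addgt0Pl => e e0; rewrite addr0.
have e20 : 0 < e / 2 by rewrite divr_gt0.
have [n1 [d1 [d10 H1]]] := c1 g _ e20.
have [n2 [d2 [d20 H2]]] := c2 g _ e20.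
have d0 : 0 < Num.min d1 d2 by rewrite lt_min d10.
have [s hs] := trigconvT_dense g (maxn n1 n2) d0.
have E : f1 (trigconvT s g) = f2 (trigconvT s g).
  have D (f : testT R -> R[i]) : scalar f -> {morph f : x y / x + y >-> x + y}.
    by move=> sf x y; rewrite -[x]scale1r sf mul1r scale1r.
  have Z (f : testT R -> R[i]) a x : scalar f -> f (a *: x) = a * f x.
    move=> sf; have f0 : f 0 = 0 by rewrite -[0](subrr (0 : testT R)) scalarB// subrr.
    by rewrite -[a *: x]addr0 sf f0 addr0.
  rewrite /trigconvT; elim: s {hs} => [|a s IH].
    by rewrite !big_nil -[0](subrr (0 : testT R)) !scalarB// !subrr.
  by rewrite !big_cons !(D f1)// !(D f2)// IH !(Z f1)// !(Z f2)// !(D f1)// !(D f2)// !(Z f1)// !(Z f2)// !H.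
rewrite (_ : f1 g - f2 g = (f2 (trigconvT s g) - f2 g) - (f1 (trigconvT s g) - f1 g)); last first.
  by rewrite E opprB addrACA [RHS]addrC; ring.
apply: (le_trans (normcB_le _ _)); rewrite [e](splitr e) lerD// ltW//.
  by apply: H2 => i x i2; apply: lt_le_trans (hs i x _) _; rewrite ?ge_min ?lexx ?orbT// (leq_trans i2) ?leq_maxr.
by apply: H1 => i x i2; apply: lt_le_trans (hs i x _) _; rewrite ?ge_min ?lexx ?orbT// (leq_trans i2) ?leq_maxl.
Qed.

End density.


(** * Trigonometric series with rapidly decreasing coefficients *)

Section trigonometric_series.
Variable R : realType.

Lemma sin_lipschitz (a b : R) : `|sin a - sin b| <= `|a - b|.
Proof.
wlog ab : a b / b <= a.
  by move=> W; case: (leP b a) => [/W//|/ltW/W]; rewrite distrC (distrC a).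
have [|c _ ->] := @MVT_segment R sin cos b a ab.
  by apply: continuous_subspaceT; exact: continuous_sin.
by rewrite normrM ler_piMl// cos_max.
Qed.

Lemma cos_taylor (y t : R) : `|cos (y + t) - cos y + t * sin y| <= t ^+ 2.
Proof.
have [c cyt E] : exists2 c : R, `|y - c| <= `|t| & cos (y + t) - cos y = - sin c * t.
  have d (z : R) : is_derive z 1 (@cos R) (- sin z) by exact: is_derive_cos.
  have cc a b : {within `[a, b], continuous (@cos R)}.
    by apply: continuous_subspaceT; exact: continuous_cos.
  have [t0|t0] := leP 0 t.
    have [|//|c cI ->] := @MVT_segment R cos (fun z => - sin z) y (y + t); first by rewrite lerDl.
    move: cI; rewrite in_itv/= => /andP[c1 c2]; exists c; last by rewrite addrAC subrr add0r.
    by rewrite distrC ger0_norm ?subr_ge0// (ger0_norm t0) lerBlDl.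
  have [|//|c cI E] := @MVT_segment R cos (fun z => - sin z) (y + t) y; first by rewrite gerDl ltW.
  move: cI; rewrite in_itv/= => /andP[c1 c2]; exists c.
    by rewrite ger0_norm ?subr_ge0// (ltr0_norm t0) lerBlDl -lerBlDr opprK.
  by rewrite -opprB E; ring.
rewrite E (_ : _ + _ = t * (sin y - sin c)); last by ring.
rewrite normrM -[t ^+ 2]real_normK ?num_real// expr2 ler_wpM2l//.
exact: le_trans (sin_lipschitz _ _) cyt.
Qed.

Lemma sin_taylor (y t : R) : `|sin (y + t) - sin y - t * cos y| <= t ^+ 2.
Proof.
by have := cos_taylor (y - pi / 2) t; rewrite (addrAC y) !cosBpihalf sinBpihalf mulrN.
Qed.

Implicit Types A B w : nat -> R.

Definition trig_term A B w (x : R) (j : nat) : R :=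
  A j * cos (w j * x) + B j * sin (w j * x).

Definition trig_series A B w (x : R) : R := lim (series (trig_term A B w x) @ \oo).

(** The frequencies w are arbitrary, so that the two halves of a Fourier series
    (k >= 0 and k < 0) are instances of the same notion. All polynomial weights
    are allowed in order that derivatives stay in the class. *)
Definition rapidly_decreasing A B w : Prop :=
  forall m : nat, exists C : R, forall N : nat,
    \sum_(0 <= j < N) (`|A j| + `|B j|) * `|w j| ^+ m <= C.

Lemma rapidly_decreasing_derive A B w : rapidly_decreasing A B w ->
  rapidly_decreasing (fun j => w j * B j) (fun j => - (w j * A j)) w.
Proof.
move=> H m; have [C HC] := H m.+1; exists C => N.
apply: le_trans (HC N); apply: ler_sum_nat => j _.
by rewrite exprS mulrA normrN !normrM -mulrDr [in leRHS](mulrC (_ + _)) addrC.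
Qed.

Lemma trig_term_le A B w (x : R) j : `|trig_term A B w x j| <= `|A j| + `|B j|.
Proof.
apply: (le_trans (ler_normD _ _)); apply: lerD; rewrite normrM ler_piMr//.
  exact: cos_max.
exact: sin_max.
Qed.

Lemma bounded_series_cvg (u : nat -> R) (C : R) : (forall j, 0 <= u j) ->
  (forall N, \sum_(0 <= j < N) u j <= C) -> cvgn (series u).
Proof.
move=> u0 uC; apply: nondecreasing_is_cvgn.
  by apply/nondecreasing_seqP => n; rewrite -subr_ge0 sub_series_geq// big_nat1.
by exists C => _ [N _ <-]; exact: uC.
Qed.

Lemma cvg_trig_series A B w x : rapidly_decreasing A B w ->
  series (trig_term A B w x) @ \oo --> trig_series A B w x.
Proof.
move=> H; have [C HC] := H 0%N.
suff : cvgn (series (trig_term A B w x)) by [].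
apply: normed_cvg; apply: (@bounded_series_cvg _ C) => N.
  by rewrite /=.
apply: le_trans (HC N); apply: ler_sum_nat => j _ /=.
by rewrite expr0 mulr1; exact: trig_term_le.
Qed.

(** The tail of the series of absolute values bounds the error uniformly in x. *)
Lemma trig_series_tail A B w : rapidly_decreasing A B w ->
  exists2 tau : nat -> R, tau @ \oo --> (0 : R) &
   forall N x, `|trig_series A B w x - series (trig_term A B w x) N| <= tau N.
Proof.
move=> H; have [C HC] := H 0%N.
pose W j := `|A j| + `|B j|.
have cW : cvgn (series W).
  apply: (@bounded_series_cvg _ C) => [j|N]; first by rewrite addr_ge0.
  by apply: le_trans (HC N); apply: ler_sum_nat => j _; rewrite expr0 mulr1.
exists (fun N => lim (series W @ \oo) - series W N).
  by rewrite -(subrr (lim (series W @ \oo))); apply: cvgB => //; exact: cvg_cst.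
move=> N x.
have c1 : (fun M => `|series (trig_term A B w x) M - series (trig_term A B w x) N|) @ \oo -->
    `|trig_series A B w x - series (trig_term A B w x) N|.
  by apply: cvg_norm; apply: cvgB; [exact: cvg_trig_series|exact: cvg_cst].
have c2 : (fun M => series W M - series W N) @ \oo --> lim (series W @ \oo) - series W N.
  by apply: cvgB => //; exact: cvg_cst.
apply: (ler_cvg_to c1 c2); near=> M.
have NM : (N <= M)%N by near: M; exact: nbhs_infty_ge.
rewrite !sub_series_geq//; apply: (le_trans (ler_norm_sum _ _ _)).
by apply: ler_sum_nat => j _; exact: trig_term_le.
Unshelve. all: by end_near. Qed.

Lemma trig_term_taylor A B w (x t : R) j :
  `|trig_term A B w (x + t) j - trig_term A B w x j -
    t * trig_term (fun j => w j * B j) (fun j => - (w j * A j)) w x j|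
  <= t ^+ 2 * ((`|A j| + `|B j|) * `|w j| ^+ 2).
Proof.
rewrite /trig_term mulrDr.
set y := w j * x; set u := w j * t.
rewrite (_ : _ - _ = A j * (cos (y + u) - cos y + u * sin y) +
   B j * (sin (y + u) - sin y - u * cos y)); last by rewrite /u; ring.
apply: (le_trans (ler_normD _ _)); rewrite !normrM.
have -> : t ^+ 2 * ((`|A j| + `|B j|) * `|w j| ^+ 2) =
    `|A j| * u ^+ 2 + `|B j| * u ^+ 2.
  by rewrite /u exprMn real_normK ?num_real//; ring.
by apply: lerD; apply: ler_wpM2l => //; [exact: cos_taylor|exact: sin_taylor].
Qed.

(** Second-order error bounds, unlike derivatives, pass to limits: this is how
    series are differentiated term by term. *)
Lemma is_derive_quadratic (V : R -> R) (x l C : R) :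
  (forall t, `|V (x + t) - V x - t * l| <= t ^+ 2 * C) -> is_derive x 1 V l.
Proof.
move=> H; have C0 : 0 <= C.
  by have := le_trans (normr_ge0 _) (H 1); rewrite expr1n mul1r.
suff D : (fun t => t^-1 *: (V (t *: (1 : R) + x) - V x)) @ 0^' --> l.
  by apply: DeriveDef; [apply/cvg_ex; exists l|exact/cvg_lim].
apply/cvgrPdist_le => /= e e0; near=> t.
have t0 : t != 0 by near: t; exact: nbhs_dnbhs_neq.
have -> : l - t^-1 *: (V (t *: (1 : R) + x) - V x) =
    - (t^-1 * (V (x + t) - V x - t * l)).
  by rewrite /GRing.scale/= mulr1 (addrC t); field.
rewrite normrN normrM normfV ler_pdivrMl ?normr_gt0//.
apply: (le_trans (H t)); rewrite -[t ^+ 2]real_normK ?num_real// expr2 -mulrA ler_wpM2l//.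
apply: (@le_trans _ _ (`|t| * (C + 1))); first by rewrite ler_wpM2l// lerDl.
rewrite -ler_pdivlMr; last by rewrite ltr_wpDl.
rewrite ltW//; near: t.
apply: dnbhs0_lt; rewrite divr_gt0// ltr_wpDl//.
Unshelve. all: by end_near. Qed.

(** The Taylor estimate [trig_term_taylor] is summed with the weights w^2, for
    which the coefficients are summable. *)
Lemma is_derive_trig_series A B w (x : R) : rapidly_decreasing A B w ->
  is_derive x 1 (trig_series A B w)
    (trig_series (fun j => w j * B j) (fun j => - (w j * A j)) w x).
Proof.
move=> H; have [C HC] := H 2.
apply: (@is_derive_quadratic _ _ _ C) => t.
have H' := rapidly_decreasing_derive H.
pose S y := series (trig_term A B w y).
have c1 : (fun N => `|S (x + t) N - S x N -
     t * series (trig_term (fun j => w j * B j) (fun j => - (w j * A j)) w x) N|) @ \oo -->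
   `|trig_series A B w (x + t) - trig_series A B w x -
     t * trig_series (fun j => w j * B j) (fun j => - (w j * A j)) w x|.
  apply: cvg_norm; apply: cvgB; first by apply: cvgB; exact: cvg_trig_series.
  by apply: cvgM; [exact: cvg_cst|exact: cvg_trig_series].
apply: (ler_cvg_to c1 (cvg_cst (t ^+ 2 * C))); near=> N.
rewrite /S !seriesEnat mulr_sumr -!sumrB.
apply: (le_trans (ler_norm_sum _ _ _)).
apply: (@le_trans _ _ (t ^+ 2 * \sum_(0 <= j < N) (`|A j| + `|B j|) * `|w j| ^+ 2)).
  by rewrite mulr_sumr; apply: ler_sum_nat => j _; exact: trig_term_taylor.
by rewrite ler_wpM2l ?sqr_ge0.
Unshelve. all: by end_near. Qed.

Lemma smooth_trig_series A B w : rapidly_decreasing A B w ->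
  smooth (trig_series A B w).
Proof.
move=> H n; suff : exists A' B', rapidly_decreasing A' B' w /\
    derive1n n (trig_series A B w) = trig_series A' B' w.
  move=> [A' [B' [H' ->]]] x.
  by have ? := @is_derive_trig_series A' B' w x H'; exact: ex_derive.
elim: n => [|n [A' [B' [H' E]]]]; first by exists A, B.
exists (fun j => w j * B' j), (fun j => - (w j * A' j)); split.
  exact: rapidly_decreasing_derive.
rewrite derive1nS E; apply/funext => x.
have ? := @is_derive_trig_series A' B' w x H'.
by rewrite derive1E derive_val.
Qed.

End trigonometric_series.


(** * Distributions of infinite smoothness are smooth functions *)

Section smooth_from_fourier.
Variable R : realType.

Lemma sum_inv_sqr_le (N : nat) : \sum_(0 <= j < N) (j.+1%:R ^- 2 : R) <= 2.
Proof.
suff : \sum_(0 <= j < N) (j.+1%:R ^- 2 : R) <= 2 - 2 / N.+1%:R.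
  by move=> /le_trans; apply; rewrite gerBl divr_ge0.
elim: N => [|N IH]; first by rewrite big_nil divr1 subrr.
rewrite big_nat_recr//=; apply: (le_trans (lerD IH (lexx _))).
rewrite -subr_ge0 [N.+2%:R]mulrSr.
have : 0 < N.+1%:R :> R by []. 
have : 1 <= N.+1%:R :> R by rewrite ler1n.
move: (N.+1%:R : R) => x x1 x0.
rewrite (_ : _ - _ = (x - 1) / (x ^+ 2 * (x + 1))); last first.
  by field; rewrite !gt_eqF// ltr_wpDl// ltW.
by rewrite divr_ge0 ?subr_ge0// mulr_ge0 ?sqr_ge0// addr_ge0// ltW.
Qed.

Lemma rapidly_decreasing_int (c : int -> R[i]) (kap : nat -> int) (A B : nat -> R) :
  (forall m : nat, exists C : R, forall k : int,
     Normc.normc (c k) * (1 + `|k%:~R : R|) ^+ m <= C) ->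
  (forall j, j.+1%:R <= 1 + `|(kap j)%:~R : R|) ->
  (forall j, `|A j| <= Normc.normc (c (kap j))) ->
  (forall j, `|B j| <= Normc.normc (c (kap j))) ->
  rapidly_decreasing A B (fun j => 2 * pi * (kap j)%:~R).
Proof.
(* two powers more than required make the sum over j converge *)
move=> hc hk hA hB m; have [C HC] := hc (m.+2).
have C0 : 0 <= C.
  apply: le_trans (HC 0); rewrite mulr_ge0 ?normc_ge0// exprn_ge0// addr_ge0//.
have p0 := pi_ge0 R.
exists (2 * (2 * pi) ^+ m * C * 2) => N.
apply: (@le_trans _ _ (\sum_(0 <= j < N) 2 * (2 * pi) ^+ m * C * j.+1%:R ^- 2)); last first.
  rewrite -mulr_sumr ler_wpM2l ?sum_inv_sqr_le// !mulr_ge0// exprn_ge0// mulr_ge0//.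
apply: ler_sum_nat => j _.
set z := Normc.normc (c (kap j)); set q := 1 + `|(kap j)%:~R : R|.
have q0 : 0 < q by rewrite ltr_wpDr.
have z0 : 0 <= z by exact: normc_ge0.
apply: (@le_trans _ _ (2 * z * ((2 * pi) ^+ m * q ^+ m))).
  apply: ler_pM; [exact: addr_ge0|exact: exprn_ge0|by rewrite mulr2n mulrDl !mul1r lerD|].
  rewrite -exprMn lerXn2r ?nnegrE ?mulr_ge0 ?(ltW q0)//.
  by rewrite normrM ger0_norm ?mulr_ge0// ler_wpM2l ?mulr_ge0// lerDr.
rewrite -!mulrA ler_pM2l// mulrCA ler_wpM2l ?exprn_ge0 ?mulr_ge0//.
have := HC (kap j); rewrite -/z -/q -addn2 exprD mulrA -ler_pdivlMr ?exprn_gt0//.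
move=> /le_trans; apply; rewrite ler_wpM2l// lef_pV2 ?posrE ?exprn_gt0//.
by rewrite ler_pXn2r ?nnegrE ?(ltW q0)//; exact: hk.
Qed.

(** The real and imaginary parts of the Fourier series of f are sums of two
    trigonometric series, over the frequencies j and -(j+1). The sum u is
    therefore smooth; uniform convergence shows that it has the same Fourier
    coefficients as f, and [distribution_eq] concludes. *)
Lemma smooth_of_fourier (f : testT R -> R[i]) : periodic_distribution f ->
  (forall m : nat, exists C : R, forall k : int,
     Normc.normc (fourier_coef f k) * (1 + `|k%:~R : R|) ^+ m <= C) ->
  exists u : testT R, f = embedT u.
Proof.
move=> hf hc; set c := fourier_coef f in hc *.
pose w (kap : nat -> int) j : R := 2 * pi * (kap j)%:~R.
pose VR kap := trig_series (fun j => complex.Re (c (kap j)))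
  (fun j => - complex.Im (c (kap j))) (w kap).
pose VI kap := trig_series (fun j => complex.Im (c (kap j)))
  (fun j => complex.Re (c (kap j))) (w kap).
pose kP j := Posz j; pose kN j := Negz j.
have hP j : j.+1%:R <= 1 + `|(kP j)%:~R : R|.
  by rewrite /kP -pmulrn mulrSr addrC lerD2l ler_norm.
have hN j : j.+1%:R <= 1 + `|(kN j)%:~R : R|.
  by rewrite /kN NegzE mulrNz normrN -pmulrn normr_nat lerDr.
have dR kap : (forall j, j.+1%:R <= 1 + `|(kap j)%:~R : R|) ->
    rapidly_decreasing (fun j => complex.Re (c (kap j)))
      (fun j => - complex.Im (c (kap j))) (w kap).
  move=> h; apply: rapidly_decreasing_int hc h _ _ => j; first exact: Re_le_normc.
  by rewrite normrN; exact: Im_le_normc.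
have dI kap : (forall j, j.+1%:R <= 1 + `|(kap j)%:~R : R|) ->
    rapidly_decreasing (fun j => complex.Im (c (kap j)))
      (fun j => complex.Re (c (kap j))) (w kap).
  by move=> h; apply: rapidly_decreasing_int hc h _ _ => j; [exact: Im_le_normc|exact: Re_le_normc].
have per A B kap x : trig_series A B (w kap) (x + 1) = trig_series A B (w kap) x.
  rewrite /trig_series; apply: (congr1 (fun F : nat -> R => lim (series F @ \oo))); apply/funext => j.
  by rewrite /trig_term /w; have [-> ->] := cos_sin_period (kap j) x.
have uP : (fun x => (VR kP x + VR kN x) +i* (VI kP x + VI kN x)) \in @testT_pred R.
  rewrite inE; split => [||x] /=.
  - by apply: smoothD; apply: smooth_trig_series; apply: dR.
  - by apply: smoothD; apply: smooth_trig_series; apply: dI.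
  - by rewrite /VR /VI !per.
pose u : testT R := TestT uP.
exists u; apply: distribution_eq => // [|k]; first exact: embedT_distribution.
pose S N : testT R := \sum_(0 <= j < N) (c (kP j) *: expT R (kP j) + c (kN j) *: expT R (kN j)).
have fk : f (expT R k) = c (- k) by rewrite /c /fourier_coef /bracket conjT_expT opprK.
have cSk N : (`|k| < N)%N -> embedT (S N) (expT R k) = c (- k).
  move=> kNN.
  have lin g : embedT g (expT R k) = embedT (expT R k) g by exact: embedTC.
  have sc := @embedT_scalar R (expT R k).
  have e0 : embedT (expT R k) 0 = 0 by rewrite -[0 in LHS](subrr (0 : testT R)) scalarB// subrr.
  rewrite lin /S (big_morph (embedT (expT R k)) (id1 := 0) (op1 := +%R)) //; last first.
    by move=> x y; rewrite -[x]scale1r sc mul1r scale1r.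
  rewrite (eq_big_nat _ _ (F2 := fun j =>
    c (kP j) * (k + kP j == 0)%:R + c (kN j) * (k + kN j == 0)%:R)); last first.
    move=> j _; rewrite sc embedT_expT; congr (_ + _).
    by rewrite -[_ *: _]addr0 sc e0 addr0 embedT_expT.
  rewrite big_split/= !big_mkord.
  have E (kap : nat -> int) : \sum_(i < N) c (kap i) * (k + kap i == 0)%:R =
     c (- k) * \sum_(i < N) (kap i == - k)%:R.
    rewrite mulr_sumr; apply: eq_bigr => i _.
    by rewrite addrC addr_eq0; case: eqP => [->|]; rewrite ?mulr0.
  rewrite !E -mulrDr -[RHS]mulr1; congr (_ * _).
  have D (a : nat) : (a < N)%N -> \sum_(i < N) ((i : nat) == a)%:R = 1 :> R[i].
    move=> aN; rewrite (bigD1 (Ordinal aN))//= eqxx big1 ?addr0// => i.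
    by rewrite -val_eqE/= => /negbTE ->.
  case: (- k) (abszN k) => [a|a] /= ka.
    rewrite [X in _ + X]big1 ?addr0; last by [].
    by rewrite -[RHS](D a) ?ka//; apply: eq_bigr => i _.
  rewrite [X in X + _]big1 ?add0r; last by [].
  by rewrite -[RHS](D a) ?(ltn_trans _ kNN)// -ka.
have [t1 t10 T1] := trig_series_tail (dR _ hP).
have [t2 t20 T2] := trig_series_tail (dR _ hN).
have [t3 t30 T3] := trig_series_tail (dI _ hP).
have [t4 t40 T4] := trig_series_tail (dI _ hN).
pose t N := t1 N + t2 N + (t3 N + t4 N).
have t0 : t @ \oo --> (0 : R).
  by rewrite -[0](addr0 0) -[X in X + _](addr0 0) -[X in _ + X](addr0 0);
    apply: cvgD; apply: cvgD.
have serE (F : nat -> R) N : series F N = \sum_(0 <= j < N) F j by [].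
have uS N x : Normc.normc ((u - S N) x) <= t N.
  have SR : complex.Re (S N x) = series (trig_term (fun j => complex.Re (c (kP j)))
  (fun j => - complex.Im (c (kP j))) (w kP) x) N + series (trig_term (fun j => complex.Re (c (kN j)))
  (fun j => - complex.Im (c (kN j))) (w kN) x) N.
    rewrite /S testT_sum !serE -big_split (big_morph _ (@cReD R) (erefl : complex.Re 0 = 0)).
    by apply: eq_bigr => j _; rewrite testTD !testTZ cReD !cReM /= /trig_term !mulNr.
  have SI : complex.Im (S N x) = series (trig_term (fun j => complex.Im (c (kP j)))
  (fun j => complex.Re (c (kP j))) (w kP) x) N + series (trig_term (fun j => complex.Im (c (kN j)))
  (fun j => complex.Re (c (kN j))) (w kN) x) N.
    rewrite /S testT_sum !serE -big_split (big_morph _ (@cImD R) (erefl : complex.Im 0 = 0)).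
    apply: eq_bigr => j _; rewrite testTD !testTZ cImD !cImM /= /trig_term.
    by congr (_ + _); rewrite addrC.
  rewrite testTB; apply: (le_trans (normc_le _)); rewrite cReB cImB SR SI /=.
  have le2 (a b a' b' s1 s2 : R) : `|a - a'| <= s1 -> `|b - b'| <= s2 ->
      `|a + b - (a' + b')| <= s1 + s2.
    by move=> h1 h2; rewrite opprD addrACA; apply: (le_trans (ler_normD _ _)); exact: lerD.
  by apply: lerD; apply: le2; [exact: T1|exact: T2|exact: T3|exact: T4].
rewrite fk; apply/eqP; rewrite eq_sym -subr_eq0; apply/eqP.
apply: Normc.eq0_normc; apply/eqP; rewrite eq_le normc_ge0 andbT.
have t2' : (fun N => 2 * (t N * 1)) @ \oo --> (0 : R).
  rewrite -[0](mulr0 2) -[X in _ * X](mul0r 1).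
  by apply: cvgM; [exact: cvg_cst|apply: cvgM => //; exact: cvg_cst].
apply: (ler_cvg_to (cvg_cst _) t2'); near=> N.
have kNN : (`|k| < N)%N by near: N; exact: nbhs_infty_gt.
rewrite -(cSk N kNN) [embedT u _]embedTC [embedT (S N) _]embedTC -scalarB; last exact: embedT_scalar.
rewrite embedTC; apply: embedT_bound => x; first exact: uS.
by rewrite normc_expT.
Unshelve. all: by end_near. Qed.

End smooth_from_fourier.


Section smooth_from_besov.
Variables (R : realType) (phi0 phi1 : R -> R).
Context (hphi : dyadic_partition phi0 phi1).
Implicit Type f : testT R -> R[i].

Lemma dyadic_nonneg j x : 0 <= dyadic phi0 phi1 j x.
Proof. by case: j => [|j]; [exact: (Defs.dyadic_ge0 hphi)|exact: (dyadic_ge1 hphi)]. Qed.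

Lemma dyadic_support j x : dyadic phi0 phi1 j x != 0 -> `|x| <= 2 ^+ j.+1.
Proof.
case: j => [|j] /= h; first by rewrite expr1; apply: (dyadic_supp0 hphi); exact: subset_closure.
have /andP[_] : 1 <= `|2 ^- j * x| <= 4.
  by apply: (dyadic_supp1 hphi); exact: subset_closure.
rewrite normrM gtr0_norm ?invr_gt0 ?exprn_gt0// ler_pdivrMl ?exprn_gt0//.
by rewrite !exprS mulrA mulrC (_ : 2 * 2 = 4)// -natrM.
Qed.

Definition ints (M : nat) : seq int := [seq Posz i | i <- iota 0 M] ++ [seq Negz i | i <- iota 0 M].

Lemma ints_uniq M : uniq (ints M).
Proof.
rewrite cat_uniq !map_inj_uniq ?iota_uniq//=; [|by move=> ? ? []|by move=> ? ? []].
by rewrite andbT; apply/hasPn => x /mapP[i _ ->]; apply/mapP => -[].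
Qed.

Lemma mem_ints M (k : int) : (`|k| < M)%N -> k \in ints M.
Proof.
rewrite mem_cat; case: k => a /= aM; apply/orP; [left|right]; apply: map_f;
  by rewrite mem_iota//= (leq_trans _ aM).
Qed.

Definition blockT f (j : nat) : testT R := \sum_(k <- ints (2 ^ j.+1).+1)
  ((dyadic phi0 phi1 j k%:~R)%:C * fourier_coef f k) *: expT R k.

Lemma dyadic_out j (k : int) : k \notin ints (2 ^ j.+1).+1 ->
  dyadic phi0 phi1 j k%:~R = 0.
Proof.
apply: contraNeq => /dyadic_support; rewrite -natrX => h; apply: mem_ints.
by rewrite ltnS -(ler_nat R) natr_absz intr_norm.
Qed.

(** The defining sum over all integers reduces to the integers of the support of
    the cut-off function, so that each block is a test function. *)
Lemma dyadic_blockE f j x : dyadic_block phi0 phi1 f j x = blockT f j x.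
Proof.
rewrite /dyadic_block /blockT testT_sum.
transitivity (\sum_(k <- ints (2 ^ j.+1).+1)
    (dyadic phi0 phi1 j k%:~R)%:C * fourier_coef f k * expT R k x); last by apply: eq_bigr.
rewrite [RHS]fsbig_seq ?ints_uniq//; symmetry.
apply: fsbig_widen => // k [_ /= /negP/dyadic_out ->].
by rewrite !mul0r.
Qed.

Lemma embedT_blockT f j k :
  embedT (blockT f j) (expT R (- k)) = (dyadic phi0 phi1 j k%:~R)%:C * fourier_coef f k.
Proof.
have sc := @embedT_scalar R (expT R (- k)).
have e0 : embedT (expT R (- k)) 0 = 0 by rewrite -[0 in LHS](subrr (0 : testT R)) scalarB// subrr.
rewrite embedTC /blockT (big_morph (embedT (expT R (- k))) (id1 := 0) (op1 := +%R)) //; last first.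
  by move=> x y; rewrite -[x]scale1r sc mul1r scale1r.
have E l : embedT (expT R (- k)) (((dyadic phi0 phi1 j l%:~R)%:C * fourier_coef f l) *: expT R l)
  = ((dyadic phi0 phi1 j l%:~R)%:C * fourier_coef f l) * (l == k)%:R.
  by rewrite -[_ *: _]addr0 sc e0 addr0 embedT_expT addrC subr_eq0.
rewrite (eq_bigr _ (fun l _ => E l)).
have [kI|kI] := boolP (k \in ints (2 ^ j.+1).+1); last first.
  rewrite dyadic_out// mul0r big1_seq// => l /andP[_ lI].
  by case: eqP lI kI => [-> ->|]; rewrite ?mulr0.
rewrite (bigD1_seq k kI (ints_uniq _)) eqxx mulr1 big1 => [|l /negbTE ->]; first exact: addr0.
by rewrite mulr0.
Qed.

Lemma continuous_normc (g : testT R) : continuous (fun x => Normc.normc (g x)).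
Proof.
have [cr ci] := testT_ccontinuous g.
rewrite (_ : (fun x => _) = fun x =>
  Num.sqrt (complex.Re (g x) * complex.Re (g x) + complex.Im (g x) * complex.Im (g x))); last first.
  by apply/funext => x; case: (g x).
move=> x; apply: (@continuous_comp _ _ _ (fun x => complex.Re (g x) * complex.Re (g x) +
  complex.Im (g x) * complex.Im (g x)) Num.sqrt); last exact: sqrt_continuous.
by apply: cvgD; apply: cvgM; [exact: cr|exact: cr|exact: ci|exact: ci].
Qed.

Lemma Lnorm1_testT (g : testT R) :
  'N[muT R]_1[(fun x => (Normc.normc (g x))%:E)]%E = (intT (fun x => Normc.normc (g x)))%:E.
Proof.
rewrite Lnorm1 /intT /Rintegral fineK; last first.
  by apply: integrable_fin_num => //; apply: integrable_muT; exact: continuous_normc.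
by apply: eq_integral => x _; rewrite gee0_abs// lee_fin normc_ge0.
Qed.

Lemma normc_integralT_le (g h : testT R) : (forall x, Normc.normc (h x) = 1) ->
  Normc.normc (embedT g h) <= 2 * intT (fun x => Normc.normc (g x)).
Proof.
move=> h1; have [cr ci] := ccontinuousM (testT_ccontinuous g) (testT_ccontinuous h).
have H x : Normc.normc (g x) = Normc.normc (g x * h x) by rewrite Normc.normcM h1 mulr1.
rewrite /embedT integralTE; apply: (le_trans (normc_le _)) => /=.
rewrite mulr2n mulrDl mul1r; apply: lerD; apply: (le_trans (intT_norm _)) => //;
  apply: intT_le; do 1?[exact: continuous_normr|exact: continuous_normc] => x; rewrite H.
  exact: Re_le_normc.
exact: Im_le_normc.
Qed.

(** A Fourier coefficient of a block is an integral of the block against an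
    exponential, hence is controlled by its L_1 norm. *)
Lemma besov_coef_le f (s : R) : besov phi0 phi1 1%E +oo%E s f ->
  exists M : R, forall j k,
    dyadic phi0 phi1 j k%:~R * Normc.normc (fourier_coef f k) <= M * 2 `^ (- (j%:R * s)).
Proof.
move=> [_ /=]; rewrite /besov_norm /=.
set F := fun j : nat => _; rewrite -/F => Foo.
have Fj j : F j = (2 `^ (j%:R * s) * intT (fun x => Normc.normc (blockT f j x)))%:E.
  rewrite /F EFinM -Lnorm1_testT; congr (_ * 'N[_]_1[_])%E.
  by apply/funext => x; rewrite dyadic_blockE.
exists (2 * fine (ereal_sup (range F))) => j k.
have F0 : (0 <= ereal_sup (range F))%E.
  apply: le_ereal_sup_tmp; exists (F 0%N); first by exists 0%N.
  by rewrite Fj lee_fin mulr_ge0 ?powR_ge0// /intT Rintegral_ge0// => x _; exact: normc_ge0.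
have : 2 `^ (j%:R * s) * intT (fun x => Normc.normc (blockT f j x)) <= fine (ereal_sup (range F)).
  rewrite -lee_fin fineK ?ge0_fin_numE// -Fj; apply: ereal_sup_ubound; by exists j.
move=> H; rewrite powRN -(ger0_norm (dyadic_nonneg j k%:~R)) -normc_real -Normc.normcM -embedT_blockT.
rewrite ler_pdivlMr ?powR_gt0//.
have := normc_integralT_le (blockT f j) (@normc_expT R (- k)).
move=> /(ler_wpM2r (powR_ge0 2 (j%:R * s))) /le_trans; apply.
by rewrite -!mulrA ler_pM2l// mulrC.
Qed.

(** If the cut-off of level j does not vanish at k then 1 + |k| <= 2^(j+2), so
    the decay 2^(-j (m+1)) of the coefficients of the blocks gives a weight
    (1 + |k|)^m with 2^(-j) to spare; the cut-offs sum to 1. *)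
Lemma besov_smooth f : (forall s, besov phi0 phi1 1%E +oo%E s f) ->
  exists u : testT R, f = embedT u.
Proof.
move=> H; apply: smooth_of_fourier; first by have [] := H 0.
move=> m; have [M HM] := besov_coef_le (H (m.+1)%:R).
(* 4^m comes from 1 + |k| <= 2^(j+2), and 2 is the sum of the powers of 1/2 *)
exists (M * 4 ^+ m * 2) => k.
set z := Normc.normc _; set q := 1 + _.
have z0 : 0 <= z by exact: normc_ge0.
have M0 : 0 <= M.
  have := HM 0%N 0; rewrite mul0r oppr0 powRr0 mulr1; apply: le_trans.
  by rewrite mulr_ge0 ?dyadic_nonneg ?normc_ge0.
have term j : dyadic phi0 phi1 j k%:~R * (z * q ^+ m) <= M * 4 ^+ m * 2^-1 ^+ j.
  have [->|d0] := eqVneq (dyadic phi0 phi1 j k%:~R) 0.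
    by rewrite mul0r !mulr_ge0// exprn_ge0// invr_ge0.
  have qj : q <= 2 ^+ j.+2.
    rewrite exprS mulr_natl mulr2n lerD ?dyadic_support//.
    by rewrite exprn_ege1// ler1n.
  rewrite mulrA; apply: (@le_trans _ _ (M * 2 `^ (- (j%:R * m.+1%:R)) * (2 ^+ j.+2) ^+ m)).
    apply: ler_pM => //; first by rewrite mulr_ge0 ?dyadic_nonneg.
      by rewrite exprn_ge0// addr_ge0.
    by rewrite lerXn2r ?nnegrE// addr_ge0.
  rewrite -!mulrA ler_wpM2l// -natrM powR_invn// exprM exprS exprVn.
  rewrite (_ : 2 ^+ j.+2 = 4 * 2 ^+ j); last by rewrite !exprS mulrA -natrM.
  have : 2 ^+ j != 0 :> R by rewrite expf_neq0.
  move: (2 ^+ j : R) => a a0; rewrite exprMn le_eqVlt; apply/orP; left; apply/eqP.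
  by field; rewrite a0 expf_neq0.
have c1 : (fun N => series (fun j => dyadic phi0 phi1 j k%:~R) N * (z * q ^+ m)) @ \oo --> 1 * (z * q ^+ m).
  by apply: cvgM; [exact: dyadic_sum hphi _|exact: cvg_cst].
rewrite mul1r in c1.
apply: (ler_cvg_to c1 (cvg_cst (M * 4 ^+ m * 2))); near=> N.
rewrite /series/= mulr_suml.
apply: (@le_trans _ _ (\sum_(0 <= j < N) M * 4 ^+ m * 2^-1 ^+ j)); first by apply: ler_sum_nat => j _.
rewrite -mulr_sumr ler_wpM2l ?mulr_ge0 ?exprn_ge0//.
have -> : \sum_(0 <= j < N) 2^-1 ^+ j = 2 - 2 * 2^-1 ^+ N :> R.
  elim: (N) => [|n IH]; first by rewrite big_nil expr0 mulr1 subrr.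
  by rewrite big_nat_recr//= IH exprS; field.
by rewrite gerBl mulr_ge0// exprn_ge0// invr_ge0.
Unshelve. all: by end_near. Qed.

End smooth_from_besov.


(** * Finite l^p norms as functions of 1/p *)

Section finite_lp.
Variables (R : realType) (T : finType).
Implicit Types (a x y : T -> R) (u v : R).

(** The l^p norm indexed by u = 1/p, which makes the interpolation inequality
    affine in u and turns p = +oo into u = 0. It is meant for nonnegative
    families. *)
Definition lnorm u a : R :=
  if u == 0 then \big[Num.max/0]_(k : T) a k else (\sum_(k : T) a k `^ u^-1) `^ u.

Lemma lnormE u a : 0 < u -> lnorm u a = (\sum_(k : T) a k `^ u^-1) `^ u.
Proof. by move=> u0; rewrite /lnorm gt_eqF. Qed.

Lemma powRinvK (z u : R) : u != 0 -> 0 <= z -> (z `^ u^-1) `^ u = z.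
Proof. by move=> u0 z0; rewrite -powRrM mulVf// powRr1. Qed.

Lemma powRKinv (z u : R) : u != 0 -> 0 <= z -> (z `^ u) `^ u^-1 = z.
Proof. by move=> u0 z0; rewrite -powRrM mulfV// powRr1. Qed.

Lemma lnorm_ge0 u a : 0 <= lnorm u a.
Proof.
rewrite /lnorm; case: eqP => _; last exact: powR_ge0.
exact: bigmax_ge_id.
Qed.

Lemma le_lnorm0 a k : a k <= lnorm 0 a.
Proof. by rewrite /lnorm eqxx; exact: le_bigmax. Qed.

Lemma lnorm0_le a (M : R) : 0 <= M -> (forall k, a k <= M) -> lnorm 0 a <= M.
Proof. by move=> M0 aM; rewrite /lnorm eqxx; apply: bigmax_le. Qed.

Lemma le_lnorm u a k : (forall k, 0 <= a k) -> 0 <= u -> a k <= lnorm u a.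
Proof.
move=> a0; rewrite le_eqVlt => /predU1P[<-|u0]; first exact: le_lnorm0.
rewrite /lnorm gt_eqF// -[leLHS](@powRinvK _ u) ?gt_eqF//.
apply: ge0_ler_powR; rewrite ?nnegrE ?powR_ge0 ?(ltW u0)//.
  by apply: sumr_ge0 => i _; exact: powR_ge0.
by rewrite (bigD1 k)//= lerDl; apply: sumr_ge0 => i _; exact: powR_ge0.
Qed.

(** Young's inequality summed over k, after normalising both families to have
    sum 1. *)
Lemma holder_sum (al : R) x y : 0 < al < 1 ->
  (forall k, 0 <= x k) -> (forall k, 0 <= y k) ->
  \sum_k (x k `^ al * y k `^ (1 - al)) <= (\sum_k x k) `^ al * (\sum_k y k) `^ (1 - al).
Proof.
move=> /andP[a0 a1] x0 y0.
have X0 : 0 <= \sum_k x k by exact: sumr_ge0.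
have Y0 : 0 <= \sum_k y k by exact: sumr_ge0.
have b0 : 0 < 1 - al by rewrite subr_gt0.
have [X|Xn] := eqVneq (\sum_k x k) 0.
  rewrite X powR0 ?gt_eqF// mul0r big1// => k _.
  have /eqP := X; rewrite psumr_eq0// => /allP/(_ k (mem_index_enum _))/= /eqP ->.
  by rewrite powR0 ?gt_eqF// mul0r.
have [Y|Yn] := eqVneq (\sum_k y k) 0.
  rewrite Y [0 `^ (1 - al)]powR0 ?gt_eqF// mulr0 big1// => k _.
  have /eqP := Y; rewrite psumr_eq0// => /allP/(_ k (mem_index_enum _))/= /eqP ->.
  by rewrite powR0 ?gt_eqF// mulr0.
set X := \sum_k x k in X0 Xn *; set Y := \sum_k y k in Y0 Yn *.
have Xp : 0 < X by rewrite lt0r Xn.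
have Yp : 0 < Y by rewrite lt0r Yn.
have E k : x k `^ al * y k `^ (1 - al) =
   X `^ al * Y `^ (1 - al) * ((x k / X) `^ al * (y k / Y) `^ (1 - al)).
  rewrite mulrACA -!powRM ?divr_ge0//.
  by rewrite !mulrA ![_ * x k]mulrC ![_ * y k]mulrC !mulfK.
rewrite (eq_bigr _ (fun k _ => E k)) -mulr_sumr ler_piMr ?mulr_ge0 ?powR_ge0//.
apply: (@le_trans _ _ (\sum_k (al * (x k / X) + (1 - al) * (y k / Y)))).
  apply: ler_sum => k _.
  have := @conjugate_powR R ((x k / X) `^ al) ((y k / Y) `^ (1 - al)) al^-1 (1 - al)^-1.
  rewrite !powR_ge0 !invr_gt0 !invrK powRKinv ?gt_eqF ?divr_ge0//.
  rewrite powRKinv ?gt_eqF ?divr_ge0// [_ * al]mulrC [_ * (1 - al)]mulrC.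
  by apply => //; rewrite addrC subrK.
rewrite big_split/= -!mulr_sumr -!mulr_suml -/X -/Y !divff//.
by rewrite !mulr1 addrC subrK.
Qed.

(** With c = a^(1/v) and r = v/u >= 1, c_k^r <= c_k (sum c)^(r-1). *)
Lemma lnorm_mono u v a : (forall k, 0 <= a k) -> 0 <= u -> u <= v ->
  lnorm u a <= lnorm v a.
Proof.
move=> a0; rewrite le_eqVlt => /predU1P[<-|u0] uv.
  by apply: lnorm0_le => [|k]; [exact: lnorm_ge0|exact: le_lnorm].
have v0 : 0 < v := lt_le_trans u0 uv.
have vu : 0 < v / u by rewrite divr_gt0.
rewrite (lnormE a u0) (lnormE a v0).
set B := \sum_k a k `^ v^-1.
have B0 : 0 <= B by apply: sumr_ge0 => k _; exact: powR_ge0.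
have -> : B `^ v = (B `^ (v / u)) `^ u by rewrite -powRrM divfK// gt_eqF.
apply: ge0_ler_powR; rewrite ?nnegrE ?powR_ge0//; first exact: ltW.
  by apply: sumr_ge0 => k _; exact: powR_ge0.
rewrite -mulr_powRB1// {1}/B mulr_suml; apply: ler_sum => k _.
have -> : a k `^ u^-1 = (a k `^ v^-1) `^ (v / u).
  by rewrite -powRrM mulrA mulVf ?mul1r// gt_eqF.
rewrite -mulr_powRB1 ?powR_ge0// ler_wpM2l ?powR_ge0//.
apply: ge0_ler_powR; rewrite ?nnegrE ?powR_ge0//.
  by rewrite subr_ge0 ler_pdivlMr// mul1r.
by rewrite /B (bigD1 k)//= lerDl; apply: sumr_ge0 => i _; exact: powR_ge0.
Qed.

(** Hoelder's inequality against the constant family 1. *)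
Lemma lnorm_power_mean u v a : (forall k, 0 <= a k) -> 0 <= u -> u <= v ->
  lnorm v a <= #|T|%:R `^ (v - u) * lnorm u a.
Proof.
move=> a0 u0; rewrite le_eqVlt => /predU1P[<-|uv]; first by rewrite subrr powRr0 mul1r.
have v0 : 0 < v := le_lt_trans u0 uv.
move: u0; rewrite le_eqVlt => /predU1P[u0|u0].
  rewrite -u0 subr0 (lnormE a v0).
  rewrite -[X in _ * X](@powRinvK _ v) ?gt_eqF ?lnorm_ge0// -powRM ?powR_ge0//.
  apply: ge0_ler_powR; rewrite ?nnegrE ?mulr_ge0 ?powR_ge0 ?(ltW v0)//.
    by apply: sumr_ge0 => k _; exact: powR_ge0.
  rewrite mulr_natl -sumr_const; apply: ler_sum => k _.
  by apply: ge0_ler_powR; rewrite ?nnegrE ?invr_ge0 ?(ltW v0) ?lnorm_ge0// le_lnorm0.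
rewrite (lnormE a u0) (lnormE a v0).
have al : 0 < u / v < 1 by rewrite divr_gt0//= ltr_pdivrMr// mul1r.
have := @holder_sum (u / v) (fun k => a k `^ u^-1) (fun=> 1) al
  (fun k => powR_ge0 _ _) (fun k => ler01).
under eq_bigr do rewrite powR1 mulr1 -powRrM mulrA mulVf ?gt_eqF// mul1r.
rewrite sumr_const => H.
have := @ge0_ler_powR _ v (ltW v0) _ _ _ _ H; rewrite !nnegrE mulr_ge0 ?powR_ge0//.
rewrite sumr_ge0 => [|k _]; last exact: powR_ge0.
move=> /(_ isT isT) /le_trans; apply.
rewrite powRM ?powR_ge0// -!powRrM mulrBl mul1r divfK ?gt_eqF// mulrC.
by rewrite le_eqVlt eqxx.
Qed.

Lemma lnorm_interp0 v (th : R) a : (forall k, 0 <= a k) -> 0 <= v -> 0 < th < 1 ->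
  lnorm (th * v) a <= lnorm 0 a `^ (1 - th) * lnorm v a `^ th.
Proof.
move=> a0 v0 /andP[t0 t1].
have d0 : 0 < 1 - th by rewrite subr_gt0.
move: v0; rewrite le_eqVlt => /predU1P[<-|v0].
  by rewrite mulr0 -powRD ?subrK ?powRr1 ?lnorm_ge0// oner_eq0.
set w := th * v; have w0 : 0 < w by rewrite mulr_gt0.
have M0 := lnorm_ge0 0 a; set M := lnorm 0 a in M0 *.
rewrite (lnormE a w0) (lnormE a v0).
rewrite -powRrM (mulrC v).
have -> : M `^ (1 - th) = (M `^ (w^-1 - v^-1)) `^ w.
  rewrite -powRrM; congr (_ `^ _); rewrite mulrBl mulVf ?gt_eqF//.
  by rewrite /w mulrCA mulVf ?mulr1// gt_eqF.
rewrite -powRM ?powR_ge0//; last by apply: sumr_ge0 => k _; exact: powR_ge0.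
apply: ge0_ler_powR; rewrite ?(ltW w0) ?nnegrE ?mulr_ge0 ?powR_ge0//.
- by apply: sumr_ge0 => k _; exact: powR_ge0.
- by apply: sumr_ge0 => k _; exact: powR_ge0.
rewrite mulr_sumr; apply: ler_sum => k _.
have wv : 0 < w^-1 - v^-1.
  by rewrite subr_gt0 ltf_pV2 ?posrE// /w gtr_pMl.
rewrite -[w^-1 in leLHS](subrK v^-1) powRD; last first.
  by rewrite subrK gt_eqF// invr_gt0.
rewrite ler_wpM2r ?powR_ge0//.
by apply: ge0_ler_powR; rewrite ?nnegrE ?(ltW wv)//; exact: le_lnorm0.
Qed.

(** Log-convexity of the l^p norm in 1/p. Writing w for the intermediate point,
    a^(1/w) is the product of a^(1/u) and a^(1/v) with the Hoelder exponents
    (1 - th) u / w and th v / w. *)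
Lemma lnorm_interp u v (th : R) a : (forall k, 0 <= a k) -> 0 <= u -> 0 <= v ->
  0 < th < 1 ->
  lnorm ((1 - th) * u + th * v) a <= lnorm u a `^ (1 - th) * lnorm v a `^ th.
Proof.
move=> a0 u0 v0 th01; have /andP[t0 t1] := th01.
have d0 : 0 < 1 - th by rewrite subr_gt0.
move: u0; rewrite le_eqVlt => /predU1P[<-|u0].
  by rewrite mulr0 add0r; exact: lnorm_interp0.
move: v0; rewrite le_eqVlt => /predU1P[<-|v0].
  have H : 0 < 1 - th < 1 by rewrite d0 gtrBl.
  rewrite mulr0 addr0.
  rewrite [X in _ <= X]mulrC; have := lnorm_interp0 a0 (ltW u0) H.
  by rewrite subKr.
have w0 : 0 < (1 - th) * u + th * v by rewrite addr_gt0// mulr_gt0.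
have [w wE] : exists w, (1 - th) * u + th * v = w by eexists.
rewrite wE in w0 *; rewrite (lnormE a w0) (lnormE a u0) (lnormE a v0).
pose al := (1 - th) * u / w.
have al1 : 1 - al = th * v / w.
  apply: (mulIf (lt0r_neq0 w0)); rewrite mulrBl mul1r !divfK ?lt0r_neq0//.
  by rewrite -wE addrAC subrr add0r.
have al01 : 0 < al < 1.
  by rewrite -[al < 1]subr_gt0 al1 !divr_gt0 ?mulr_gt0.
have := @holder_sum al (fun k => a k `^ u^-1) (fun k => a k `^ v^-1) al01
  (fun k => powR_ge0 _ _) (fun k => powR_ge0 _ _).
have S : u^-1 * al + v^-1 * (1 - al) = w^-1.
  by rewrite al1 /al; field; rewrite (gt_eqF u0) (gt_eqF v0) (gt_eqF w0).
have E k : (a k `^ u^-1) `^ al * (a k `^ v^-1) `^ (1 - al) = a k `^ w^-1.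
  by rewrite -!powRrM -powRD S// gt_eqF// invr_gt0.
under eq_bigr do rewrite E.
move=> H.
have := @ge0_ler_powR _ w (ltW w0) _ _ _ _ H; rewrite !nnegrE mulr_ge0 ?powR_ge0//.
rewrite sumr_ge0 => [|k _]; last exact: powR_ge0.
move=> /(_ isT isT) /le_trans; apply.
move: (\sum_k a k `^ u^-1) (\sum_k a k `^ v^-1) => A B.
rewrite powRM; [|exact: powR_ge0|exact: powR_ge0].
rewrite -!powRrM al1 /al (divfK (lt0r_neq0 w0)) (divfK (lt0r_neq0 w0)).
by rewrite (mulrC u) (mulrC v).
Qed.

End finite_lp.


(** * Growth rates of the levels of a sequence *)

Section growth.
Variables (R : realType) (X : nat -> finType) (a : forall j, X j -> R).
Context (a0 : forall j k, 0 <= a (j := j) k).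
Implicit Types (u v s t : R).

Definition grows u t : Prop :=
  exists M : R, forall j : nat, 2 `^ (j%:R * t) * lnorm u (a (j := j)) <= M.

Lemma pow2_gt0 (x : R) : 0 < 2 `^ x. Proof. exact: powR_gt0. Qed.

Lemma pow2D (x y : R) : 2 `^ (x + y) = 2 `^ x * 2 `^ y.
Proof. by rewrite powRD// pnatr_eq0 implybT. Qed.

Lemma pow2_le (x y : R) : x <= y -> 2 `^ x <= 2 `^ y :> R.
Proof. by apply: ler_powR; rewrite ler1n. Qed.

Lemma grows_le u s t : s <= t -> grows u t -> grows u s.
Proof.
move=> st [M H]; exists M => j; apply: le_trans (H j).
by rewrite ler_wpM2r ?lnorm_ge0// pow2_le// ler_wpM2l.
Qed.

Lemma grows_ge0 u t : grows u t -> exists2 M : R, 0 <= M &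
  forall j : nat, 2 `^ (j%:R * t) * lnorm u (a (j := j)) <= M.
Proof.
move=> [M H]; exists M => //; apply: le_trans (H 0%N).
by rewrite mulr_ge0 ?powR_ge0 ?lnorm_ge0.
Qed.

Lemma grows_anti u v t : 0 <= u -> u <= v -> grows v t -> grows u t.
Proof.
move=> u0 uv [M H]; exists M => j; apply: le_trans (H j).
by apply: ler_wpM2l; [exact: powR_ge0|exact: lnorm_mono].
Qed.

Lemma grows_shift (K : R) u v t : (forall j, #|X j|%:R <= K * 2 ^+ j) ->
  0 <= u -> u <= v -> grows u t -> grows v (t - (v - u)).
Proof.
move=> hK u0 uv /grows_ge0[M M0 H].
have K0 : 0 <= K by have := le_trans (ler0n _ _) (hK 0%N); rewrite expr0 mulr1.
exists (K `^ (v - u) * M) => j.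
apply: (@le_trans _ _ (2 `^ (j%:R * (t - (v - u))) * ((K * 2 ^+ j) `^ (v - u) * lnorm u (a (j := j))))).
  rewrite ler_wpM2l ?powR_ge0//; apply: (le_trans (lnorm_power_mean (a0 (j := j)) u0 uv)).
  rewrite ler_wpM2r ?lnorm_ge0//; apply: ge0_ler_powR; rewrite ?subr_ge0 ?nnegrE ?mulr_ge0 ?exprn_ge0//.
rewrite powRM ?exprn_ge0// -powR_mulrn// -powRrM.
rewrite (_ : _ * _ = K `^ (v - u) * (2 `^ (j%:R * t) * lnorm u (a (j := j)))); last first.
  rewrite mulrBr pow2D powRN; have := pow2_gt0 (j%:R * (v - u)).
  by move: (2 `^ (j%:R * (v - u))) => P P0; field; rewrite gt_eqF.
by rewrite ler_wpM2l ?powR_ge0.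
Qed.

(** The source of the concavity of the critical smoothness. *)
Lemma grows_interp u v s t (th : R) : 0 <= u -> 0 <= v -> 0 < th < 1 ->
  grows u s -> grows v t -> grows ((1 - th) * u + th * v) ((1 - th) * s + th * t).
Proof.
move=> u0 v0 th01 /grows_ge0[M M0 H] /grows_ge0[N N0 H'].
have /andP[t0 t1] := th01.
have d0 : 0 < 1 - th by rewrite subr_gt0.
exists (M `^ (1 - th) * N `^ th) => j.
apply: (@le_trans _ _ ((2 `^ (j%:R * s) * lnorm u (a (j := j))) `^ (1 - th) *
   (2 `^ (j%:R * t) * lnorm v (a (j := j))) `^ th)); last first.
  by apply: ler_pM; rewrite ?powR_ge0//; apply: ge0_ler_powR;
    rewrite ?nnegrE ?mulr_ge0 ?powR_ge0 ?lnorm_ge0 ?(ltW t0) ?(ltW d0).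
have E : 2 `^ (j%:R * ((1 - th) * s + th * t)) =
    (2 `^ (j%:R * s)) `^ (1 - th) * (2 `^ (j%:R * t)) `^ th.
  by rewrite -!powRrM -pow2D; congr (_ `^ _); ring.
have := lnorm_interp (a0 (j := j)) u0 v0 th01.
move: E (powR_ge0 2 (j%:R * s)) (powR_ge0 2 (j%:R * t)) (lnorm_ge0 u (a (j := j)))
  (lnorm_ge0 v (a (j := j))).
move: (2 `^ (j%:R * s)) (2 `^ (j%:R * t)) (lnorm u _) (lnorm v _)
  (lnorm ((1 - th) * u + th * v) _) => x y l m n.
move=> -> x0 y0 l0 m0 nlm.
rewrite (powRM _ x0 l0) (powRM _ y0 m0) mulrACA ler_wpM2l//.
by rewrite mulr_ge0 ?powR_ge0.
Qed.

(** For the absolute values of the wavelet coefficients of f, the critical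
    smoothness at p = 1/u is [rate u + u]. *)
Definition rate u : R := sup [set t | grows u t].

Context (hsup : forall u, 0 <= u -> has_sup [set t | grows u t]).

Lemma le_rate u t : 0 <= u -> grows u t -> t <= rate u.
Proof. by move=> u0 h; apply: ub_le_sup => //; have [] := hsup u0. Qed.

Lemma rate_le u (b : R) : 0 <= u -> (forall t, grows u t -> t <= b) -> rate u <= b.
Proof. by move=> u0 h; apply: ge_sup => //; have [] := hsup u0. Qed.

Lemma lt_rate u t : 0 <= u -> t < rate u -> grows u t.
Proof.
move=> u0 tr; have rt : 0 < rate u - t by rewrite subr_gt0.
have [s hs ts] := sup_adherent rt (hsup u0).
by apply: grows_le hs; rewrite ltW//; move: ts; rewrite opprB addrC subrK.
Qed.

Lemma rate_anti u v : 0 <= u -> u <= v -> rate v <= rate u.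
Proof.
move=> u0 uv; have v0 := le_trans u0 uv.
by apply: (rate_le v0) => t h; apply: (le_rate u0); exact: grows_anti h.
Qed.

Lemma rate_lip (K : R) u v : (forall j, #|X j|%:R <= K * 2 ^+ j) ->
  0 <= u -> u <= v -> rate u <= rate v + (v - u).
Proof.
move=> hK u0 uv; have v0 := le_trans u0 uv.
apply: (rate_le u0) => t h; rewrite -lerBlDr; apply: (le_rate v0).
exact: grows_shift h.
Qed.

Lemma rate_concave u v (th : R) : 0 <= u -> 0 <= v -> 0 < th < 1 ->
  (1 - th) * rate u + th * rate v <= rate ((1 - th) * u + th * v).
Proof.
move=> u0 v0 th01; have /andP[t0 t1] := th01.
have d0 : 0 < 1 - th by rewrite subr_gt0.
have w0 : 0 <= (1 - th) * u + th * v by rewrite addr_ge0// mulr_ge0// ltW.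
apply/ler_addgt0Pl => e e0; rewrite -lerBlDl.
have lt (x : R) : x - e < x by rewrite gtrBl.
have := le_rate w0 (grows_interp u0 v0 th01 (lt_rate u0 (lt _)) (lt_rate v0 (lt _))).
move: (rate u) (rate v) (rate ((1 - th) * u + th * v)) => x y z H.
by suff -> : (1 - th) * x + th * y - e = (1 - th) * (x - e) + th * (y - e) by []; ring.
Qed.

End growth.

Section lq_norms.
Variable R : realType.
Implicit Types (q : \bar R) (v : nat -> R).

Lemma geometric_nneseries (c z : R) : `|z| < 1 ->
  (\sum_(0 <= j <oo) (c * z ^+ j)%:E)%E = (c / (1 - z))%:E.
Proof.
move=> z1; have h := cvg_geometric_series (a := c) z1; apply/cvg_lim => //.
have -> : (fun n => \sum_(0 <= j < n) (c * z ^+ j)%:E)%E =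
    EFin \o series (geometric c z) by apply/funext => n; rewrite /= sumEFin.
by apply/fine_cvgP; split; [exact: nearW|exact: h].
Qed.

Lemma lq_norm_bounded q v : (0 < q)%E -> (forall j, 0 <= v j) ->
  (lq_norm q (fun j => (v j)%:E) < +oo)%E -> exists M : R, forall j, v j <= M.
Proof.
move=> q0 v0; case: q q0 => [r|_|//] /=.
  rewrite lte_fin => r0 /lty_poweRy; rewrite invr_neq0 ?gt_eqF// => /(_ isT) H.
  have T0 j : (0 <= (v j `^ r)%:E)%E by rewrite lee_fin powR_ge0.
  pose M := fine (\sum_(0 <= j <oo) (v j `^ r)%:E).
  have HM : (\sum_(0 <= j <oo) (v j `^ r)%:E)%E = M%:E.
    by rewrite fineK// ge0_fin_numE// nneseries_ge0.
  exists (M `^ r^-1) => j.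
  rewrite -[leLHS](@powRKinv _ _ r) ?gt_eqF//.
  have vM : v j `^ r <= M.
    rewrite -lee_fin -HM; apply: (le_trans _ (nneseries_lim_ge j.+1 _)) => //.
    rewrite big_nat_recr//= leeDr// sume_ge0//.
  apply: ge0_ler_powR; rewrite ?nnegrE ?invr_ge0 ?(ltW r0) ?powR_ge0//.
  exact: le_trans (powR_ge0 _ _) vM.
move=> H; exists (fine (ereal_sup (range (fun j => (v j)%:E)))) => j.
rewrite -lee_fin fineK.
  by apply: ereal_sup_ubound; exists j.
rewrite ge0_fin_numE//; apply: le_ereal_sup_tmp; exists (v 0%N)%:E; first by exists 0%N.
by rewrite lee_fin.
Qed.

(** Together with [lq_norm_bounded], this shows that the summation exponent q
    over the levels has no influence on critical exponents. *)
Lemma lq_norm_geometric q v (M e : R) : (0 < q)%E -> (forall j, 0 <= v j) -> 0 < e ->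
  (forall j, v j <= M * 2 `^ (- (j%:R * e))) ->
  (lq_norm q (fun j => (v j)%:E) < +oo)%E.
Proof.
move=> q0 v0 e0 vM.
have M0 : 0 <= M by have := le_trans (v0 0%N) (vM 0%N); rewrite mul0r oppr0 powRr0 mulr1.
case: q q0 => [r|_|//] /=; last first.
  apply: (@le_lt_trans _ _ M%:E); last exact: ltry.
  apply: ge_ereal_sup => _ [j _ <-]; rewrite lee_fin; apply: (le_trans (vM j)).
  rewrite ler_piMr// -[leRHS](powRr0 2) ler_powR ?ler1n// oppr_le0 mulr_ge0// ltW//.
rewrite lte_fin => r0; apply: poweR_lty.
pose z : R := 2 `^ (- (e * r)).
have z1 : `|z| < 1.
  rewrite ger0_norm ?powR_ge0// /z powRN invf_lt1 ?powR_gt0//.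
  rewrite -[ltLHS](powRr0 2) /powR pnatr_eq0/= ltr_expR mul0r mulr_gt0// ?mulr_gt0//.
  by rewrite ln_gt0// ltr1n.
apply: (@le_lt_trans _ _ (\sum_(0 <= j <oo) (M `^ r * z ^+ j)%:E)%E); last first.
  by rewrite (geometric_nneseries _ z1) ltry.
apply: lee_nneseries => j _; first by rewrite lee_fin powR_ge0.
rewrite lee_fin /z -powR_mulrn ?powR_ge0// -powRrM.
rewrite (_ : - (e * r) * j%:R = - (j%:R * e) * r); last by ring.
rewrite powRrM -powRM ?powR_ge0//; apply: ge0_ler_powR;
  by rewrite ?nnegrE ?mulr_ge0 ?powR_ge0 ?(ltW r0).
Qed.

End lq_norms.


(** * Best N-term approximation of sequences *)

Section best_approximation.
Variables (R : realType) (X : nat -> finType) (b : forall j, X j -> R).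
Context (b0 : forall j (k : X j), 0 <= b k).
Let L : choiceType := waveletIndex X.

Lemma rinv_fin (r : R) : 0 < r -> rinv r%:E = r^-1.
Proof. by move=> r0; rewrite /rinv inver gt_eqF. Qed.

Lemma rinv_oo : rinv (+oo%E : \bar R) = 0.
Proof. by rewrite /rinv invey. Qed.

Lemma rinv_ge0 (p : \bar R) : (0 < p)%E -> 0 <= rinv p.
Proof.
case: p => [r|_|//]; last by rewrite rinv_oo.
by rewrite lte_fin => r0; rewrite rinv_fin// invr_ge0 ltW.
Qed.

Definition at_level (j : nat) (k : X j) : L := existT (fun j => X j) j k.

Lemma extend_fset (A : {fset L}) (N : nat) : (forall n, exists j, (n <= #|X j|)%N) ->
  (#|` A| <= N)%N -> exists2 B : {fset L}, #|` B| = N & {subset A <= B}.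
Proof.
move=> hX; elim: N => [|N IH]; first by rewrite leqn0 => /eqP ?; exists A.
rewrite leq_eqVlt => /predU1P[?|]; first by exists A.
rewrite ltnS => /IH[B BN AB].
have [j Xj] := hX N.+1.
have [k kB] : exists k : X j, at_level k \notin B.
  apply/existsP; apply: contraT; rewrite negb_exists => /forallP H.
  suff : (#|X j| <= #|` B|)%N by rewrite BN leqNgt Xj.
  have u : uniq [seq at_level k | k <- enum (X j)].
    rewrite map_inj_uniq ?enum_uniq// => x y /eqP.
    by rewrite /at_level -tag_eqE /tag_eq/= eqxx/= tagged_asE => /eqP.
  have := uniq_leq_size u; move=> /(_ B); rewrite size_map -cardE; apply.
  by move=> _ /mapP[k _ ->]; have := H k; rewrite negbK.
exists (at_level k |` B)%fset; first by rewrite cardfsU1 kB BN add1n.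
by move=> l /AB lB; rewrite in_fset1U lB orbT.
Qed.

(** Markov's inequality; the geometric decay over the levels confines the
    large entries to finitely many of them. *)
Lemma level_set_finite (u D z tau : R) : 0 < u -> 0 <= z < 1 -> 0 < D -> 0 < tau ->
  (forall j, \sum_k b (j := j) k `^ u^-1 <= D * z ^+ j) ->
  exists2 A : {fset L}, (forall j (k : X j), tau < b k -> at_level k \in A) &
    (#|` A|)%:R * tau `^ u^-1 <= D / (1 - z).
Proof.
move=> u0 /andP[z0 z1] D0 tau0 hb.
have z1' : `|z| < 1 by rewrite ger0_norm.
have d0 : 0 < 1 - z by rewrite subr_gt0.
have T0 : 0 < tau `^ u^-1 by exact: powR_gt0.
have [J HJ] : exists J, forall j, (J <= j)%N -> D * z ^+ j < tau `^ u^-1.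
  have /cvgr_lt H := cvg_geometric D z1'.
  have [J _ HJ] := H _ T0; exists J => j; exact: HJ.
pose s : seq L := [seq at_level k | j <- iota 0 J, k <- [seq k <- enum (X j) | tau < b k]].
have us : uniq s.
  apply: allpairs_uniq_dep; first exact: iota_uniq.
    by move=> j _; rewrite filter_uniq// enum_uniq.
  by move=> [j k] [j' k'] _ _ /= E; exact: E.
exists [fset l in s]%fset.
  move=> j k tb; rewrite inE /=; apply/allpairsPdep; exists j, k; split=> //.
    rewrite mem_iota leq0n add0n/= ltnNge; apply/negP => /HJ.
    apply/negP; rewrite -leNgt; apply: le_trans (hb j).
    apply: (@le_trans _ _ (b k `^ u^-1)).
      by apply: ge0_ler_powR; rewrite ?nnegrE ?invr_ge0 ?b0 ?(ltW u0) ?(ltW tau0) ?(ltW tb).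
    by rewrite (bigD1 k)//= lerDl; apply: sumr_ge0 => i _; exact: powR_ge0.
  by rewrite mem_filter tb mem_enum.
rewrite card_fseq undup_id// -sum1_size natr_sum mulr_suml.
rewrite /s big_allpairs_dep.
apply: (@le_trans _ _ (\sum_(j <- iota 0 J) D * z ^+ j)).
  apply: ler_sum => j _; apply: le_trans (hb j).
  rewrite big_filter big_enum_cond/= [leRHS](bigID (fun k => tau < b k))/=.
  rewrite -[leLHS]addr0; apply: lerD; last by apply: sumr_ge0 => i _; exact: powR_ge0.
  apply: ler_sum => k tb; rewrite mul1r.
  by apply: ge0_ler_powR; rewrite ?nnegrE ?invr_ge0 ?b0 ?(ltW u0) ?(ltW tau0) ?(ltW tb).
rewrite -lee_fin -geometric_nneseries// -sumEFin.
have := @nneseries_lim_ge R (fun j => (D * z ^+ j)%:E) xpredT 0 J.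
rewrite /index_iota ?subn0; apply => j _ _.
by rewrite lee_fin mulr_ge0 ?exprn_ge0 ?(ltW D0).
Qed.

(** With S = D / (1 - z), which bounds the sum of b^(1/u), the
    threshold tau = (S / N)^u keeps at most N entries; on the others,
    b^(1/u0) <= tau^(1/u0 - 1/u) b^(1/u), which sums up to the announced bound
    (for p0 = +oo the bound is tau itself). *)
Lemma stechkin_direct (p0 : \bar R) (u D z : R) (N : nat) :
  (0 < p0)%E -> rinv p0 < u -> 0 <= z < 1 -> 0 < D ->
  (forall n, exists j, (n <= #|X j|)%N) ->
  (forall j, \sum_k b (j := j) k `^ u^-1 <= D * z ^+ j) -> (0 < N)%N ->
  exists2 A : {fset L}, #|` A| = N &
    (lq_norm p0 (fun j => (lnorm (rinv p0)
        (fun k : X j => if at_level k \in A then 0 else b k))%:E)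
     <= ((D / (1 - z)) `^ u * N%:R `^ (- (u - rinv p0)))%:E)%E.
Proof.
move=> p00 u0u z01 D0 hX hb N0; have /andP[z0 z1] := z01.
have u0 : 0 < u := le_lt_trans (rinv_ge0 p00) u0u.
have d0 : 0 < 1 - z by rewrite subr_gt0.
set S := D / (1 - z); have S0 : 0 < S by rewrite divr_gt0.
have N0' : 0 < N%:R :> R by rewrite ltr0n.
pose tau := (S / N%:R) `^ u.
have SN0 : 0 < S / N%:R by rewrite divr_gt0.
have tau0 : 0 < tau by rewrite powR_gt0.
have tauE : tau `^ u^-1 = S / N%:R by rewrite /tau powRKinv ?ltW// gt_eqF.
have [A0 HA0] := level_set_finite u0 z01 D0 tau0 hb.
rewrite tauE -/S mulrA ler_pdivrMr// mulrC ler_pM2l// ler_nat => A0N.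
have [A AN AA] := extend_fset hX A0N.
exists A => //.
set bt := fun j (k : X j) => if at_level k \in A then 0 else b k.
have bt0 j (k : X j) : 0 <= bt j k by rewrite /bt; case: ifP.
have bttau j (k : X j) : bt j k <= tau.
  rewrite /bt; case: ifPn => [_|kA]; first exact: ltW.
  by rewrite leNgt; apply: contra kA => /HA0/AA.
have btb j (k : X j) : bt j k <= b k by rewrite /bt; case: ifP.
case: p0 p00 u0u => [r|_|//]; last first.
  rewrite rinv_oo subr0 /= => _.
  have E : S `^ u * N%:R `^ (- u) = tau.
    rewrite /tau powRM ?(ltW S0) ?invr_ge0//; congr (_ * _).
    by rewrite -(powR_inv1 (ltW N0')) -powRrM mulN1r.
  rewrite E; apply: ge_ereal_sup => _ [j _ <-]; rewrite lee_fin.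
  by apply: lnorm0_le; [exact: ltW|exact: bttau].
rewrite lte_fin => r0; rewrite rinv_fin// => ru /=.
have rV0 : 0 < r^-1 by rewrite invr_gt0.
have ur : 0 < r - u^-1 by rewrite subr_gt0 -[ltRHS]invrK ltf_pV2 ?posrE.
have step j : (lnorm r^-1 (bt j)) `^ r <= tau `^ (r - u^-1) * D * z ^+ j.
  rewrite lnormE// -[X in _ `^ X <= _]invrK powRKinv ?gt_eqF//; last first.
    by apply: sumr_ge0 => k _; exact: powR_ge0.
  rewrite -mulrA; apply: (le_trans _ (ler_wpM2l (powR_ge0 _ _) (hb j))).
  rewrite mulr_sumr invrK; apply: ler_sum => k _.
  have -> : bt j k `^ r = bt j k `^ (r - u^-1) * bt j k `^ u^-1.
    by rewrite -powRD ?subrK// gt_eqF.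
  apply: ler_pM; rewrite ?powR_ge0//; apply: ge0_ler_powR;
    by rewrite ?nnegrE ?invr_ge0 ?(ltW ur) ?(ltW u0) ?(ltW tau0).
have sumle : (\sum_(0 <= j <oo) (lnorm r^-1 (bt j))%:E `^ r <= (tau `^ (r - u^-1) * S)%:E)%E.
  rewrite /S mulrA -geometric_nneseries ?ger0_norm//.
  apply: lee_nneseries => j _; first by rewrite poweR_ge0.
  by rewrite poweR_EFin lee_fin; exact: step.
have sum0 : (0 <= \sum_(0 <= j <oo) (lnorm r^-1 (bt j))%:E `^ r)%E.
  by apply: nneseries_ge0 => j _ _; exact: poweR_ge0.
have C0 : 0 <= tau `^ (r - u^-1) * S by rewrite mulr_ge0 ?powR_ge0 ?ltW.
have -> : S `^ u * N%:R `^ (- (u - r^-1)) = (tau `^ (r - u^-1) * S) `^ r^-1.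
  have ES : S = (S / N%:R) * N%:R by rewrite divfK// gt_eqF.
  move: ES SN0; rewrite /tau; move: (S / N%:R) => x -> x0.
  rewrite powRM ?(ltW x0) ?(ltW N0')// -mulrA -powRD; last first.
    by rewrite (gt_eqF N0') implybT.
  rewrite opprB addrC subrK -powRrM mulrA -[X in _ * X * _](powRr1 (ltW x0)).
  rewrite -powRD; last by rewrite (gt_eqF x0) implybT.
  have -> : u * (r - u^-1) + 1 = u * r by field; rewrite (gt_eqF u0).
  rewrite powRM ?powR_ge0 ?(ltW N0')// -powRrM.
  by rewrite -mulrA divff ?mulr1// (gt_eqF r0).
move: sumle sum0; move: (\sum_(0 <= j <oo) _)%E => [x|//|//]; rewrite !lee_fin => xle x0.
by apply: ge0_ler_powR; rewrite ?nnegrE ?invr_ge0 ?(ltW r0).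
Qed.

End best_approximation.


Section inverse_estimate.
Variable R : realType.

(** Telescoping: by the mean value theorem, (n+2)^(-s) is at most a constant
    times (n+1)^(1-s) - (n+2)^(1-s). *)
Lemma sum_inv_power_bounded (s : R) : 1 < s -> exists2 Z : R, 0 <= Z &
  forall n : nat, \sum_(i < n) i.+1%:R `^ (- s) <= Z.
Proof.
move=> s1; have s0 : 0 < s - 1 by rewrite subr_gt0.
have step (n : nat) : (n.+2)%:R `^ (- s) <=
    (n.+1%:R `^ (1 - s) - n.+2%:R `^ (1 - s)) / (s - 1).
  have lt12 : n.+1%:R < n.+2%:R :> R by rewrite ltr_nat.
  have pos (x : R) : n.+1%:R <= x -> 0 < x by apply: lt_le_trans; rewrite ltr0n.
  have [||c cI E] := @MVT R (fun x => x `^ (1 - s)) (fun x => (1 - s) * x `^ (1 - s - 1)) _ _ lt12.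
  - move=> x; rewrite in_itv/= => /andP[x1 _].
    by apply: is_derive1_powR; apply: pos; exact: ltW.
  - apply: derivable_within_continuous => x; rewrite in_itv/= => /andP[x1 _].
    by apply: derivable_powR; rewrite in_itv/= andbT; exact: pos.
  move: cI; rewrite in_itv/= => /andP[c1 c2].
  have c0 : 0 < c by apply: pos; exact: ltW.
  rewrite ler_pdivlMr// -[leRHS]opprB E.
  have -> : n.+2%:R - n.+1%:R = 1 :> R by rewrite [n.+2%:R]mulrSr addrAC subrr add0r.
  rewrite (_ : 1 - s - 1 = - s); last by ring.
  rewrite mulr1 -mulNr opprB mulrC ler_pM2l// !powRN lef_pV2 ?posrE ?powR_gt0 ?ltr0n//.
  by apply: ge0_ler_powR; rewrite ?nnegrE ?(ltW c0) ?(ltW c2)// ltW// (lt_trans ltr01).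
have bound n : \sum_(i < n.+1) i.+1%:R `^ (- s) <= 1 + (1 - n.+1%:R `^ (1 - s)) / (s - 1).
  elim: n => [|n IH].
    by rewrite big_ord_recr big_ord0/= add0r !powR1 subrr mul0r addr0.
  rewrite big_ord_recr/=; apply: (le_trans (lerD IH (step n))).
  by rewrite -addrA -mulrDl addrA subrK.
exists (1 + 1 / (s - 1)); first by rewrite addr_ge0// divr_ge0// ltW.
case=> [|n]; first by rewrite big_ord0 addr_ge0// divr_ge0// ltW.
by apply: (le_trans (bound n)); rewrite lerD2l ler_pM2r ?invr_gt0// gerBl powR_ge0.
Qed.

Lemma lnorm_card (T : finType) (x : T -> R) (F : {set T}) (N : nat) (u t : R) :
  (forall k, 0 <= x k) -> 0 <= t -> 0 <= u -> (0 < N <= #|F|)%N ->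
  (forall k, k \in F -> t <= x k) -> N%:R `^ u * t <= lnorm u x.
Proof.
move=> x0 t0 u0 /andP[N0 NF] hF.
move: u0; rewrite le_eqVlt => /predU1P[<-|u0].
  rewrite powRr0 mul1r.
  have /card_gt0P[k kF] : (0 < #|F|)%N by exact: leq_trans NF.
  by apply: (le_trans (hF k kF)); exact: le_lnorm0.
rewrite lnormE// -[X in _ * X](@powRinvK _ t u) ?gt_eqF// -powRM ?powR_ge0//.
have S0 (P : pred T) : 0 <= \sum_(k | P k) x k `^ u^-1.
  by apply: sumr_ge0 => k _; exact: powR_ge0.
apply: ge0_ler_powR; rewrite ?nnegrE ?mulr_ge0 ?powR_ge0 ?(ltW u0)//.
apply: (@le_trans _ _ (\sum_(k in F) x k `^ u^-1)); last first.
  by rewrite [leRHS](bigID (mem F))/= lerDl.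
apply: (@le_trans _ _ (\sum_(k in F) t `^ u^-1)).
  by rewrite sumr_const -[leRHS]mulr_natl ler_wpM2r ?powR_ge0// ler_nat.
apply: ler_sum => k kF; apply: ge0_ler_powR; rewrite ?nnegrE ?invr_ge0 ?(ltW u0)//.
exact: hF.
Qed.

(** The hypothesis says that the n-th largest entry is at most g n. The
    rearrangement need not be constructed: the smallest element of F is at most
    g #|F|, and the induction removes it. *)
Lemma sum_le_rearranged (T : finType) (x : T -> R) (g : nat -> R) (r : R) :
  (forall k, 0 <= x k) -> 0 <= r ->
  (forall (F : {set T}) (t : R), (0 < #|F|)%N -> 0 <= t ->
     (forall k, k \in F -> t <= x k) -> t <= g #|F|) ->
  forall F : {set T}, \sum_(k in F) x k `^ r <= \sum_(i < #|F|) g i.+1 `^ r.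
Proof.
move=> x0 r0 hg F; move E : #|F| => n; elim: n F E => [|n IH] F Fn.
  by move/eqP: Fn; rewrite cards_eq0 => /eqP ->; rewrite big_set0 big_ord0.
have /card_gt0P[k0 k0F] : (0 < #|F|)%N by rewrite Fn.
have [k kF kmin] : exists2 k, k \in F & forall i, i \in F -> x k <= x i.
  by case: (arg_minP x k0F) => k kF H; exists k.
rewrite (big_setD1 k kF)/= big_ord_recr/= addrC.
apply: lerD; first by apply: IH; have := cardsD1 k F; rewrite kF Fn => -[].
have xg : x k <= g n.+1 by rewrite -Fn; apply: hg => //; rewrite Fn.
by apply: ge0_ler_powR; rewrite ?nnegrE// (le_trans (x0 k)).
Qed.

Variables (X : nat -> finType) (b : forall j, X j -> R).
Context (b0 : forall j (k : X j), 0 <= b k).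

(** If n = #|F| entries are at least t, an approximation with N = n/2 terms misses
    at least N of them, so that N^u0 t <= C N^(-kap): the n-th largest entry is
    O(n^(-(u0 + kap))), and its power 1/u is summable. *)
Lemma stechkin_inverse (u0 kap C B u : R) (N0 : nat) : 0 <= u0 -> 0 < kap -> 0 <= C -> 0 <= B ->
  (forall N, (N0 <= N)%N -> exists2 A : {fset waveletIndex X}, #|` A| = N &
    forall j, lnorm u0 (fun k : X j => if at_level k \in A then 0 else b k)
      <= C * N%:R `^ (- kap)) ->
  (forall j (k : X j), b k <= B) -> 0 < u -> u < u0 + kap ->
  exists M : R, forall j, lnorm u (b (j := j)) <= M.
Proof.
move=> u00 kap0 C0 B0 hA hB u_gt0 uK; set K := u0 + kap in uK.
have K0 : 0 < K := lt_trans u_gt0 uK.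
pose N1 := maxn N0 1.
(* the first term covers n < 2 N1, where only the bound B is available; in the
   second, 3 comes from n <= 3 (n / 2) *)
pose D := B * (2 * N1)%:R `^ K + C * 3 `^ K.
have D0 : 0 <= D by rewrite addr_ge0// mulr_ge0// powR_ge0.
pose g (n : nat) : R := D * n%:R `^ (- K).
have hg j (F : {set X j}) (t : R) : (0 < #|F|)%N -> 0 <= t ->
    (forall k, k \in F -> t <= b k) -> t <= g #|F|.
  move=> F0 t0 tF; rewrite /g /D mulrDl; set n := #|F| in F0 *.
  have n0 : 0 < n%:R :> R by rewrite ltr0n.
  have nK : 0 < n%:R `^ K by rewrite powR_gt0.
  rewrite powRN; case: (ltnP n (2 * N1)) => nN.
    have /card_gt0P[k kF] := F0.
    apply: (@le_trans _ _ B); first exact: le_trans (tF k kF) (hB _ _).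
    apply: (@le_trans _ _ (B * (2 * N1)%:R `^ K / n%:R `^ K)); last first.
      by rewrite lerDl mulr_ge0 ?mulr_ge0 ?invr_ge0 ?powR_ge0.
    rewrite ler_pdivlMr// ler_wpM2l//.
    by apply: ge0_ler_powR; rewrite ?nnegrE ?(ltW K0)// ler_nat ltnW.
  set N := n./2.
  have N1N : (N1 <= N)%N by rewrite /N -(doubleK N1) half_leq// -mul2n.
  have Npos : (0 < N)%N by apply: leq_trans N1N; rewrite leq_maxr.
  have [A AN HA] := hA N (leq_trans (leq_maxl _ _) N1N).
  have := HA j; set bt := (fun k : X j => if at_level k \in A then 0 else b k) => btC.
  have bt0 k : 0 <= bt k by rewrite /bt; case: ifP.
  pose F' := [set k in F | at_level k \notin A].
  have cF' : (N <= #|F'|)%N.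
    have FE : (n = #|F :&: [set k | at_level k \in A]| + #|F'|)%N.
      rewrite /n -(cardsID [set k | at_level k \in A] F); congr (_ + _)%N.
      by apply: eq_card => k; rewrite !inE andbC.
    have cA : (#|F :&: [set k | at_level k \in A]| <= N)%N.
      rewrite -AN cardE -(size_map (@at_level X j)); apply: uniq_leq_size.
        rewrite map_inj_uniq ?enum_uniq// => y z /eqP.
        by rewrite /at_level -tag_eqE /tag_eq/= eqxx/= tagged_asE => /eqP.
      by move=> l /mapP[k + ->]; rewrite mem_enum !inE => /andP[].
    have : (N + N <= n)%N by rewrite addnn /N -[leqRHS]odd_double_half leq_addl.
    by rewrite FE => h; rewrite -(leq_add2l N) (leq_trans h)// leq_add2r.
  have tF' k : k \in F' -> t <= bt k.
    by rewrite inE => /andP[kF /negbTE kA]; rewrite /bt kA; exact: tF.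
  have lo : N%:R `^ u0 * t <= lnorm u0 bt.
    by apply: (@lnorm_card _ bt F') => //; rewrite Npos.
  have N0' : 0 < N%:R :> R by rewrite ltr0n.
  have tN : t <= C * N%:R `^ (- K).
    rewrite /K opprD powRD; last by rewrite (gt_eqF N0') implybT.
    rewrite [N%:R `^ (- u0)]powRN mulrCA mulrC ler_pdivlMr ?powR_gt0// mulrC.
    exact: le_trans btC.
  apply: (le_trans tN); apply: (@le_trans _ _ (C * 3 `^ K / n%:R `^ K)); last first.
    by rewrite lerDr mulr_ge0 ?mulr_ge0 ?invr_ge0 ?powR_ge0.
  rewrite -mulrA ler_wpM2l// powRN ler_pdivlMr// mulrC ler_pdivrMr ?powR_gt0//.
  rewrite -powRM// -natrM; apply: ge0_ler_powR; rewrite ?nnegrE ?(ltW K0)// ler_nat.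
  rewrite -[leqLHS]odd_double_half -/N mulSn mul2n leq_add2r.
  exact: leq_trans (leq_b1 _) Npos.
have [|Z Z0 HZ] := @sum_inv_power_bounded (K / u); first by rewrite ltr_pdivlMr// mul1r.
exists ((D `^ u^-1 * Z) `^ u) => j.
rewrite lnormE//; apply: ge0_ler_powR; rewrite ?nnegrE ?mulr_ge0 ?powR_ge0 ?(ltW u_gt0)//.
  by apply: sumr_ge0 => k _; exact: powR_ge0.
have g0 i : 0 <= g i by rewrite /g mulr_ge0 ?powR_ge0.
have uV : 0 <= u^-1 by rewrite invr_ge0 ltW.
have := @sum_le_rearranged _ (b (j := j)) g u^-1 (b0 (j := j)) uV (hg j) [set: X j]%SET.
rewrite (eq_bigl xpredT) => [H|k]; last by rewrite inE.
apply: (le_trans H).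
apply: (@le_trans _ _ (\sum_(i < #|[set: X j]%SET|) D `^ u^-1 * i.+1%:R `^ (- (K / u)))).
  by apply: ler_sum => i _; rewrite /g powRM ?powR_ge0// -powRrM mulNr.
by rewrite -mulr_sumr ler_wpM2l ?powR_ge0.
Qed.

End inverse_estimate.


(** * Besov spaces and approximation errors in wavelet coordinates *)

Section scaling.
Variables (R : realType) (T : finType).

Lemma lnorm_scale (c u : R) (x : T -> R) : 0 <= c -> 0 <= u -> (forall k, 0 <= x k) ->
  lnorm u (fun k => c * x k) = c * lnorm u x.
Proof.
move=> c0; rewrite le_eqVlt => /predU1P[<-|u0] x0.
  rewrite /lnorm eqxx (big_morph (fun y => c * y) (op1 := Num.max) (id1 := 0)) ?mulr0//.
  by move=> y z; rewrite maxr_pMr.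
rewrite !lnormE//.
have -> : \sum_k (c * x k) `^ u^-1 = c `^ u^-1 * \sum_k x k `^ u^-1.
  by rewrite mulr_sumr; apply: eq_bigr => k _; rewrite powRM.
rewrite powRM ?powR_ge0 ?powRinvK ?gt_eqF//.
by apply: sumr_ge0 => k _; exact: powR_ge0.
Qed.

Lemma le_lq_norm (q : \bar R) (v : nat -> R) j : (0 < q)%E -> (forall j, 0 <= v j) ->
  ((v j)%:E <= lq_norm q (fun j => (v j)%:E))%E.
Proof.
move=> q0 v0; case: q q0 => [r|_|//] /=; last by apply: ereal_sup_ubound; exists j.
rewrite lte_fin => r0.
have T0 i : (0 <= (v i `^ r)%:E)%E by rewrite lee_fin powR_ge0.
have vS : ((v j `^ r)%:E <= \sum_(0 <= j <oo) (v j `^ r)%:E)%E.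
  apply: (le_trans _ (nneseries_lim_ge j.+1 _)) => //.
  by rewrite big_nat_recr//= leeDr// sume_ge0.
have rV : 0 < r^-1 by rewrite invr_gt0.
move: vS; move: (\sum_(0 <= j <oo) _)%E => [x|_|//]; last first.
  by rewrite /= (gt_eqF rV) leey.
rewrite lee_fin => vx; rewrite poweR_EFin lee_fin -[leLHS](@powRKinv _ _ r) ?gt_eqF//.
apply: ge0_ler_powR; rewrite ?nnegrE ?(ltW rV) ?powR_ge0//.
exact: le_trans (powR_ge0 _ _) vx.
Qed.

End scaling.

Section wavelets.
Variables (R : realType) (phi0 phi1 : R -> R).
Variables (X : nat -> finType) (Psi : forall j, X j -> testT R).
Context (hphi : dyadic_partition phi0 phi1) (hbasis : wavelet_basis Psi)
        (hadm : wavelet_admissible Psi phi0 phi1).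
Implicit Types (f : testT R -> R[i]) (p q : \bar R).

Definition acoef f (j : nat) (k : X j) : R := Normc.normc (wavelet_coef Psi f k).

Lemma acoef_ge0 f j (k : X j) : 0 <= acoef f k. Proof. exact: normc_ge0. Qed.

Lemma level_normE f p j : (0 < p)%E ->
  level_norm p (wavelet_coef Psi f (j := j)) = lnorm (rinv p) (acoef f (j := j)).
Proof.
case: p => [r|_|//]; last by rewrite rinv_oo /lnorm eqxx.
rewrite lte_fin => r0; have rV : 0 < r^-1 by rewrite invr_gt0.
by rewrite (rinv_fin r0) (lnormE _ rV) invrK.
Qed.

Lemma besov_seq_normE f p q s : (0 < p)%E ->
  besov_seq_norm p q s (wavelet_coef Psi f) = lq_norm q (fun j =>
   (2 `^ (j%:R * (s - rinv p)) * lnorm (rinv p) (acoef f (j := j)))%:E).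
Proof.
move=> p0; rewrite /besov_seq_norm; congr lq_norm.
by apply/funext => j; rewrite level_normE.
Qed.

Lemma card_level_le : exists K : R, forall j, #|X j|%:R <= K * 2 ^+ j.
Proof.
have [C [C1 H]] := wavelet_card hbasis.
exists (Num.max C #|X 0%N|%:R) => -[|j]; first by rewrite expr0 mulr1 le_max lexx orbT.
apply: le_trans (H j.+1 isT).2 _; rewrite ler_wpM2r ?exprn_ge0// le_max lexx//.
Qed.

Lemma card_level_ge n : exists j, (n <= #|X j|)%N.
Proof.
have [C [C1 H]] := wavelet_card hbasis.
by exists n.+1; apply: leq_trans (H n.+1 isT).1; rewrite ltnW// ltnW// ltn_expl.
Qed.

Lemma grows_of_besov f p q s : (0 < p)%E -> (0 < q)%E ->
  besov phi0 phi1 p q s f -> grows (acoef f) (rinv p) (s - rinv p).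
Proof.
move=> p0 q0 hb; have [H _] := hadm s p0 q0.
have [_] := H f hb.1; have /H := hb.1.
move=> [/(_ hb)]; rewrite besov_seq_normE// => + _ _.
by move=> /(lq_norm_bounded q0); apply => j; rewrite mulr_ge0 ?powR_ge0 ?lnorm_ge0.
Qed.

(** The margin between s - 1/p and t is a geometric factor that makes the sum
    over the levels converge. *)
Lemma besov_of_grows f p q s t : (0 < p)%E -> (0 < q)%E -> periodic_distribution f ->
  grows (acoef f) (rinv p) t -> s - rinv p < t -> besov phi0 phi1 p q s f.
Proof.
move=> p0 q0 hf [M HM] st; have [H _] := hadm s p0 q0.
apply/(H f hf); rewrite besov_seq_normE//.
have e0 : 0 < t - (s - rinv p) by rewrite subr_gt0.
apply: (lq_norm_geometric q0 _ e0 (M := M)) => j.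
  by rewrite mulr_ge0 ?powR_ge0 ?lnorm_ge0.
rewrite powRN ler_pdivlMr ?powR_gt0// mulrAC -pow2D -mulrDr [_ + (t - _)]addrC subrK.
exact: HM.
Qed.

Definition remainder f (A : {fset waveletIndex X}) : testT R -> R[i] :=
  fun h => f h - \sum_(l <- A) bracket f (wavelet Psi l) * embedT (wavelet Psi l) h.

Lemma remainder_distribution f A : periodic_distribution f ->
  periodic_distribution (remainder f A).
Proof.
move=> [sf cf].
have step g (c : R[i]) u : periodic_distribution g ->
    periodic_distribution (fun h => g h - c * embedT u h).
  move=> [sg cg]; have [su cu] := embedT_distribution u; split.
    by move=> a x y; rewrite sg su; ring.
  move=> g0 e e0.
  have e20 : 0 < e / 2 by rewrite divr_gt0.
  have c1 : 0 < Normc.normc c + 1 by rewrite ltr_wpDl// normc_ge0.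
  have e3 : 0 < e / 2 / (Normc.normc c + 1) by rewrite divr_gt0.
  have [n1 [d1 [d10 H1]]] := cg g0 _ e20.
  have [n2 [d2 [d20 H2]]] := cu g0 _ e3.
  exists (maxn n1 n2), (Num.min d1 d2); split; first by rewrite lt_min d10.
  move=> h hd.
  rewrite (_ : _ - _ = (g h - g g0) - c * (embedT u h - embedT u g0)); last by ring.
  apply: (le_lt_trans (normcB_le _ _)); rewrite [e](splitr e); apply: ltr_leD.
    apply: H1 => i x i1; apply: (lt_le_trans (hd i x _)); last by rewrite ge_min lexx.
    by rewrite leq_max i1.
  rewrite Normc.normcM; apply: (@le_trans _ _ ((Normc.normc c + 1) * (e / 2 / (Normc.normc c + 1)))).
    apply: ler_pM; rewrite ?normc_ge0 ?lerDl//; apply: ltW; apply: H2 => i x i2.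
    apply: (lt_le_trans (hd i x _)); last by rewrite ge_min lexx orbT.
    by rewrite leq_max i2 orbT.
  by rewrite mulrC divfK// gt_eqF.
rewrite /remainder; elim: (enum_fset A) => [|l s IH].
  by rewrite (_ : (fun h => _) = f)//; apply/funext => h; rewrite big_nil subr0.
have := step _ (bracket f (wavelet Psi l)) (wavelet Psi l) IH.
congr periodic_distribution; apply/funext => h.
by rewrite big_cons opprD [- _ - _]addrC addrA.
Qed.

(** By orthonormality, subtracting the terms of A erases the coefficients of A and
    leaves the others untouched. *)
Lemma remainder_acoef f A j (k : X j) :
  acoef (remainder f A) k = if at_level k \in A then 0 else acoef f k.
Proof.
rewrite /acoef /wavelet_coef.
have -> : bracket (remainder f A) (Psi k) =
    bracket f (Psi k) - \sum_(l <- A) bracket f (wavelet Psi l) * (l == at_level k)%:R.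
  rewrite /bracket /remainder; congr (_ - _); apply: eq_bigr => l _; congr (_ * _).
  by rewrite -(wavelet_orthonormal hbasis).
case: ifPn => kA.
  have -> : \sum_(l <- A) bracket f (wavelet Psi l) * (l == at_level k)%:R = bracket f (Psi k).
    rewrite (big_fsetD1 (at_level k) kA)/= eqxx mulr1 big1_seq; first exact: addr0.
    by move=> l /andP[_]; rewrite in_fsetD1 => /andP[/negbTE -> _]; rewrite mulr0.
  by rewrite subrr mulr0 Normc.normc0.
rewrite big1_seq ?subr0// => l /andP[_ lA].
by case: eqP lA kA => [-> ->//|]; rewrite mulr0.
Qed.

End wavelets.


Section critical_smoothness.
Variables (R : realType) (phi0 phi1 : R -> R).
Variables (X : nat -> finType) (Psi : forall j, X j -> testT R).
Context (hphi : dyadic_partition phi0 phi1) (hbasis : wavelet_basis Psi)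
        (hadm : wavelet_admissible Psi phi0 phi1).
Variables (f : testT R -> R[i]) (hf : periodic_distribution f).
Local Notation a := (acoef Psi f).
Let a0 := @acoef_ge0 R X Psi f.

(** Growth at one u gives growth at every other u, with a loss that depends only
    on the distance. The hypothesis at p thus makes every set of exponents
    nonempty; if one of them were unbounded, f would lie in all the spaces
    B^s_(1,oo) and be smooth. *)
Lemma growth_rates_finite (q p : \bar R) (s : R) : (0 < q)%E -> (0 < p)%E ->
  ~ (exists u : testT R, f = embedT u) ->
  (s%:E < crit_smoothness phi0 phi1 q f p)%E ->
  forall u, 0 <= u -> has_sup [set t | grows a u t].
Proof.
move=> q0 p0 hfS hs.
have [K hK] := card_level_le hbasis.
have [t1 ht1] : exists t, grows a (rinv p) t.
  have [s1 hs1] : exists s1, besov phi0 phi1 p q s1 f.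
    apply: contrapT => /forallNP H; move: hs.
    have -> : crit_smoothness phi0 phi1 q f p = -oo%E.
      by apply/ereal_sup_ninfty => _ [s1 /= hs1 <-]; case: (H s1).
    by rewrite ltNge leNye.
  by exists (s1 - rinv p); exact: (grows_of_besov hadm p0 q0 hs1).
have pq := rinv_ge0 p0.
have trans u v t : 0 <= u -> 0 <= v -> grows a u t -> grows a v (t - `|v - u|).
  move=> u0 v0 h; case: (leP u v) => uv.
    have vu : 0 <= v - u by rewrite subr_ge0.
    by rewrite (ger0_norm vu); exact: (grows_shift a0 hK u0 uv h).
  apply: (@grows_le _ _ _ _ _ t); first by rewrite gerBl.
  exact: (grows_anti a0 v0 (ltW uv)).
move=> u u0; split; first by exists (t1 - `|u - rinv p|); exact: trans.
apply: contrapT => nub; apply: hfS.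
apply: (besov_smooth hphi) => s1.
have [t [ht st]] : exists t, grows a u t /\ s1 - rinv (1 : \bar R) + `|1 - u| < t.
  apply: contrapT => /forallNP H; apply: nub.
  exists (s1 - rinv (1 : \bar R) + `|1 - u|) => t ht /=; rewrite leNgt; apply/negP => lt.
  by apply: (H t).
have r1 : rinv (1 : \bar R) = 1 by rewrite rinv_fin// invr1.
have g1 := trans u 1 t u0 ler01 ht; rewrite -[in X in grows _ X]r1 in g1.
have ooy : (0 < +oo :> \bar R)%E by [].
apply: (besov_of_grows hadm lte01 ooy hf g1).
by rewrite ltrBrDr.
Qed.

Context (hsup : forall u, 0 <= u -> has_sup [set t | grows a u t]).

Lemma crit_smoothnessE (q p : \bar R) : (0 < q)%E -> (0 < p)%E ->
  crit_smoothness phi0 phi1 q f p = (rate a (rinv p) + rinv p)%:E.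
Proof.
move=> q0 p0; have pq := rinv_ge0 p0; apply/eqP; rewrite eq_le; apply/andP; split.
  apply: ge_ereal_sup => _ [s /= hs <-]; rewrite lee_fin -lerBlDr.
  by apply: (le_rate hsup pq); exact: (grows_of_besov hadm p0 q0 hs).
apply/lee_addgt0Pr => e e0; rewrite -leeBlDr// -EFinB.
apply: ereal_sup_ubound; exists (rate a (rinv p) + rinv p - e) => //=.
have e20 : 0 < e / 2 by rewrite divr_gt0.
have g1 : grows a (rinv p) (rate a (rinv p) - e / 2).
  by apply: (lt_rate hsup pq); rewrite gtrBl.
apply: (besov_of_grows hadm p0 q0 hf g1).
rewrite addrAC addrK ltrD2l ltrN2 gtr_pMr// invf_lt1// ltr1n//.
Qed.

Variables (p0 : \bar R) (s0 : R).
Context (p00 : (0 < p0)%E).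
Local Notation u0 := (rinv p0).
Local Notation err := (best_approx_error Psi phi0 phi1 p0 s0 f).

Local Notation b := (fun j (k : X j) => 2 `^ (j%:R * (s0 - u0)) * a k).

Let b_ge0 j (k : X j) : 0 <= b j k.
Proof. by apply: mulr_ge0; [exact: powR_ge0|exact: a0]. Qed.

Let lnorm_b v j : 0 <= v -> lnorm v (b j) = 2 `^ (j%:R * (s0 - u0)) * lnorm v (a (j := j)).
Proof. by move=> v0; exact: (lnorm_scale (powR_ge0 _ _) v0 (@a0 j)). Qed.

Lemma besov_seq_norm_remainder (A : {fset waveletIndex X}) :
  besov_seq_norm p0 p0 s0 (wavelet_coef Psi (remainder Psi f A)) =
  lq_norm p0 (fun j => (lnorm u0 (fun k : X j => if at_level k \in A then 0 else b j k))%:E).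
Proof.
rewrite (besov_seq_normE Psi _ _ _ p00); congr lq_norm; apply/funext => j; congr EFin.
have u00 := rinv_ge0 p00.
rewrite -(lnorm_scale (powR_ge0 2 _) u00 (fun k => acoef_ge0 Psi (remainder Psi f A) k)).
congr lnorm; apply/funext => k; rewrite (remainder_acoef hbasis).
by case: (_ \in _); rewrite ?mulr0.
Qed.

Lemma pow2_geometric (x y : R) j :
  (2 `^ (- (x / y))) ^+ j = (2 `^ (- (j%:R * x))) `^ y^-1.
Proof.
rewrite -(powR_mulrn _ (powR_ge0 _ _)) -!powRrM; congr (_ `^ _); ring.
Qed.

(** The weighted sequence b = 2^(j (s0 - u0)) a has a geometrically decreasing
    l^(1/u) norm by levels, and [stechkin_direct] applies. *)
Lemma error_upper (u t : R) : u0 < u -> s0 - u0 < t -> grows a u t ->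
  exists2 C : R, 0 < C & forall N, (0 < N)%N ->
    (err N <= (C * N%:R `^ (- (u - u0)))%:E)%E.
Proof.
move=> u0u st /grows_ge0 [M M0 HM].
have u00 := rinv_ge0 p00.
have up : 0 < u := le_lt_trans u00 u0u.
have uV : 0 < u^-1 by rewrite invr_gt0.
pose e := t - (s0 - u0); have e0 : 0 < e by rewrite subr_gt0.
pose z : R := 2 `^ (- (e / u)).
have z01 : 0 <= z < 1.
  rewrite /z powR_ge0/= powRN invf_lt1 ?powR_gt0//.
  rewrite -[ltLHS](powRr0 2) /powR pnatr_eq0/= ltr_expR mul0r mulr_gt0//.
    by rewrite divr_gt0.
  by rewrite ln_gt0// ltr1n.
pose D : R := (M + 1) `^ u^-1.
have D0 : 0 < D by rewrite powR_gt0// ltr_wpDl.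
have hb j : \sum_k b j k `^ u^-1 <= D * z ^+ j.
  have -> : \sum_k b j k `^ u^-1 = lnorm u (b j) `^ u^-1.
    rewrite (lnormE _ up) (powRKinv (lt0r_neq0 up))//.
    by apply: sumr_ge0 => k _; exact: powR_ge0.
  have M1 : 0 <= M + 1 by rewrite addr_ge0.
  rewrite /z pow2_geometric /D -(powRM _ M1 (powR_ge0 _ _)).
  apply: ge0_ler_powR; first exact: ltW.
  - exact: lnorm_ge0.
  - by rewrite nnegrE mulr_ge0 ?powR_ge0.
  rewrite (lnorm_b _ (ltW up)) powRN ler_pdivlMr ?powR_gt0// mulrAC -pow2D -mulrDr.
  rewrite /e [_ + (t - _)]addrC subrK.
  by apply: (le_trans (HM j)); rewrite lerDl.
have [_ [c [C [c0 C0 HcC]]]] := hadm s0 p00 p00.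
pose S := (D / (1 - z)) `^ u.
have S0 : 0 < S.
  by rewrite powR_gt0// divr_gt0// subr_gt0; case/andP: z01.
exists (c^-1 * S); first by rewrite mulr_gt0// invr_gt0.
move=> N N0.
have [A AN HA] := stechkin_direct b_ge0 p00 u0u z01 D0 (card_level_ge hbasis) hb N0.
have rd := remainder_distribution Psi A hf.
have E := besov_seq_norm_remainder A.
have hb' : besov phi0 phi1 p0 p0 s0 (remainder Psi f A).
  by apply/(hadm s0 p00 p00).1 => //; rewrite E; apply: (le_lt_trans HA); exact: ltry.
have /andP[H1 _] := HcC _ hb'.
rewrite E in H1; have := le_trans H1 HA => H2.
apply: (@le_trans _ _ (besov_norm phi0 phi1 p0 p0 s0 (remainder Psi f A))).
  by apply: ereal_inf_lbound; exists A.
have cV : (0 <= c^-1%:E)%E by rewrite lee_fin invr_ge0 ltW.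
have := lee_wpmul2l cV H2; rewrite muleA -EFinM mulVf ?gt_eqF// mul1e.
by rewrite -EFinM mulrA.
Qed.

(** [stechkin_inverse] for the same weighted sequence; its conclusion, boundedness of the
    l^(1/u) norms of the levels of b, is a growth property of a. *)
Lemma error_lower (k u : R) : 0 < k -> grows a u0 (s0 - u0) ->
  ((N%:R `^ k)%:E * err N)%E @[N --> \oo] --> 0%E ->
  0 < u -> u < u0 + k -> grows a u (s0 - u0).
Proof.
move=> k0 /grows_ge0[B B0 HB] herr up uk.
have u00 := rinv_ge0 p00.
have bB j (i : X j) : b j i <= B.
  apply: le_trans (HB j); rewrite -(lnorm_b _ u00).
  exact: (le_lnorm i (@b_ge0 j) u00).
have [_ [c [C [c0 C0 HcC]]]] := hadm s0 p00 p00.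
have [N0 HN0] : exists N0, forall N, (N0 <= N)%N -> ((N%:R `^ k)%:E * err N < 1)%E.
  have /fine_cvgP[fin /cvgr_lt lt1] := herr.
  have [N0 _ HN0] : \forall N \near \oo, ((N%:R `^ k)%:E * err N < 1)%E.
    near=> N; rewrite -[ltLHS]fineK; first by rewrite lte_fin; near: N; exact: lt1.
    by near: N; exact: fin.
  by exists N0 => N; exact: HN0.
have HA N : (maxn N0 1 <= N)%N -> exists2 A : {fset waveletIndex X}, #|` A| = N &
    forall j, lnorm u0 (fun k : X j => if at_level k \in A then 0 else b j k)
      <= C * N%:R `^ (- k).
  rewrite geq_max => /andP[N0N N1].
  have Nk : 0 < N%:R `^ k :> R by rewrite powR_gt0// ltr0n.
  have errN : (err N < (N%:R `^ (- k))%:E)%E.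
    by rewrite powRN -[X in (_ < X)%E]mule1 muleC lte_pdivlMr// muleC; exact: HN0.
  have [_ [A AN <-] HA] := ereal_inf_lt errN.
  exists A => // j.
  have rd := remainder_distribution Psi A hf.
  have hb : besov phi0 phi1 p0 p0 s0 (remainder Psi f A).
    by split => //; apply: (lt_trans HA); exact: ltry.
  have E := besov_seq_norm_remainder A.
  have /andP[_] := HcC _ hb; rewrite E => H2.
  rewrite -lee_fin; apply: (le_trans (@le_lq_norm R p0 (fun j => lnorm u0
    (fun k : X j => if at_level k \in A then 0 else b j k)) j p00 (fun j => lnorm_ge0 _ _))).
  apply: (le_trans H2); rewrite EFinM; apply: lee_wpmul2l; first by rewrite lee_fin ltW.
  exact: ltW.
have [M HM] := stechkin_inverse b_ge0 u00 k0 (ltW C0) B0 HA bB up uk.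
by exists M => j; rewrite -(lnorm_b _ (ltW up)); exact: HM.
Unshelve. all: by end_near. Qed.

End critical_smoothness.


(** * Concave functions with slopes between 0 and 1 *)

Section concave_functions.
Variables (R : realType) (S : R -> R).
Context (S_nd : forall u v, 0 <= u -> u <= v -> S u <= S v)
  (S_lip : forall u v, 0 <= u -> u <= v -> S v <= S u + (v - u))
  (S_conc : forall u v th, 0 <= u -> 0 <= v -> 0 < th < 1 ->
     (1 - th) * S u + th * S v <= S ((1 - th) * u + th * v)).
Implicit Types (u v w h t : R).

Lemma three_chords u v w : 0 <= u -> u < v -> v < w ->
  (v - u) * (S w - S u) <= (w - u) * (S v - S u).
Proof.
move=> u0 uv vw.
have vu : 0 < v - u by rewrite subr_gt0.
have wu : 0 < w - u by rewrite subr_gt0 (lt_trans uv).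
have th : 0 < (v - u) / (w - u) < 1.
  by rewrite divr_gt0//= ltr_pdivrMr// mul1r ltrD2r.
have w0 : 0 <= w by rewrite (le_trans u0)// ltW// (lt_trans uv).
have := S_conc u0 w0 th.
have -> : (1 - (v - u) / (w - u)) * u + (v - u) / (w - u) * w = v.
  by field; rewrite gt_eqF.
rewrite -(ler_pM2l wu) (_ : (w - u) * (_ + _) = (w - v) * S u + (v - u) * S w); last first.
  by field; rewrite gt_eqF.
by move: (S u) (S v) (S w) => x y z H; lra.
Qed.

Definition quot u h := h^-1 * (S (u + h) - S u).

Lemma quot_anti u h t : 0 <= u -> 0 < h -> h <= t -> quot u t <= quot u h.
Proof.
move=> u0 h0; rewrite le_eqVlt => /predU1P[->//|ht].
have t0 : 0 < t := lt_trans h0 ht.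
have := @three_chords u (u + h) (u + t) u0; rewrite ltrDl ltrD2l => /(_ h0 ht).
rewrite (_ : u + h - u = h); last by ring.
rewrite (_ : u + t - u = t); last by ring.
rewrite /quot => H.
by rewrite ler_pdivrMl// mulrCA ler_pdivlMl.
Qed.

Lemma quot_ge0 u h : 0 <= u -> 0 < h -> 0 <= quot u h.
Proof.
move=> u0 h0; rewrite /quot mulr_ge0 ?invr_ge0 ?(ltW h0)// subr_ge0 S_nd//.
by rewrite lerDl ltW.
Qed.

Lemma quot_le1 u h : 0 <= u -> 0 < h -> quot u h <= 1.
Proof.
move=> u0 h0; rewrite /quot ler_pdivrMl// mulr1 lerBlDl.
have := S_lip u0 (_ : u <= u + h); rewrite lerDl (ltW h0) => /(_ isT).
by rewrite addrAC subrr add0r.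
Qed.

Definition dright u := lim (quot u h @[h --> 0^'+]).

Lemma dright_sup u : 0 <= u -> dright u = sup (quot u @` [set` Interval (BRight 0) +oo%O]).
Proof.
move=> u0; apply/cvg_lim => //; apply: nonincreasing_at_right_cvgr => //.
  by move=> h t; rewrite !in_itv/= !andbT => h0 t0 ht; exact: quot_anti.
by exists 1 => _ [h /= + <-]; rewrite in_itv/= andbT => h0; exact: quot_le1.
Qed.

Lemma quot_le_dright u h : 0 <= u -> 0 < h -> quot u h <= dright u.
Proof.
move=> u0 h0; rewrite (dright_sup u0); apply: ub_le_sup.
  by exists 1 => _ [t /= + <-]; rewrite in_itv/= andbT => t0; exact: quot_le1.
by exists h => //=; rewrite in_itv/= h0.
Qed.

Lemma dright_le u (M : R) : 0 <= u -> (forall h, 0 < h -> quot u h <= M) -> dright u <= M.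
Proof.
move=> u0 H; rewrite (dright_sup u0); apply: ge_sup.
  by exists (quot u 1); exists 1 => //=; rewrite in_itv/= ltr01.
by move=> _ [t /= + <-]; rewrite in_itv/= andbT; exact: H.
Qed.

Lemma dright_ge0 u : 0 <= u -> 0 <= dright u.
Proof.
by move=> u0; apply: le_trans (quot_le_dright u0 ltr01); exact: quot_ge0.
Qed.

(** The slope of a chord dominates all the slopes to its right. *)
Lemma dright_le_quot u h : 0 <= u -> 0 < h -> dright (u + h) <= quot u h.
Proof.
move=> u0 h0; apply: dright_le => [|t t0]; first by rewrite addr_ge0// ltW.
have := @three_chords u (u + h) (u + h + t) u0; rewrite !ltrDl => /(_ h0 t0).
rewrite (_ : u + h - u = h); last by ring.
rewrite (_ : u + h + t - u = h + t); last by ring.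
rewrite /quot => H; rewrite ler_pdivrMl// mulrCA ler_pdivlMl//.
by move: H; move: (S u) (S (u + h)) (S (u + h + t)) => x y z H; lra.
Qed.

Lemma dright_anti u v : 0 <= u -> u <= v -> dright v <= dright u.
Proof.
move=> u0; rewrite le_eqVlt => /predU1P[->//|uv].
have vu : 0 < v - u by rewrite subr_gt0.
have := dright_le_quot u0 vu; rewrite addrC subrK => /le_trans; apply.
exact: quot_le_dright.
Qed.

Definition dleft u := lim (quot u h @[h --> 0^'-]).

Lemma dleft_le_quot u t : 0 < t -> t <= u -> dleft u <= quot (u - t) t.
Proof.
move=> t0 tu; have u0 : 0 < u := lt_le_trans t0 tu.
have E h : quot u (- h) = quot (u - h) h.
  by rewrite /quot invrN subrK mulNr -mulrN opprB.
have b : has_lbound ((fun h => quot u (- h)) @` [set` Interval (BRight 0) (BRight u)]).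
  exists 0 => _ [h /= + <-]; rewrite in_itv/= => /andP[h0 hu].
  by rewrite E quot_ge0// subr_ge0.
have -> : dleft u = inf ((fun h => quot u (- h)) @` [set` Interval (BRight 0) (BRight u)]).
  apply/cvg_lim => //; apply/cvg_at_leftNP; rewrite oppr0.
  apply: nondecreasing_at_right_cvgr => //.
  move=> h k; rewrite !in_itv/= => /andP[h0 hu] /andP[k0 ku]; rewrite le_eqVlt => /predU1P[->//|hk].
  rewrite !E /quot !subrK.
  have uk0 : 0 <= u - k by rewrite subr_ge0.
  have := @three_chords (u - k) (u - h) u uk0; rewrite ltrD2l ltrN2 gtrBl => /(_ hk h0).
  rewrite (_ : u - h - (u - k) = k - h); last by ring.
  rewrite (_ : u - (u - k) = k); last by ring.
  move=> H; rewrite ler_pdivrMl// mulrCA ler_pdivlMl//.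
  by move: H; move: (S u) (S (u - k)) (S (u - h)) => x y z H; lra.
by rewrite -E; apply: ge_inf => //; exists t => //=; rewrite in_itv/= t0.
Qed.

(** The slope at infinity, parametrised as in the definition of [alpha0] by
    p = 1/u tending to 0. *)
Definition dright_oo := lim (dright p^-1 @[p --> 0^'+]).

Lemma dright_ooE : dright_oo = inf ((fun p => dright p^-1) @` [set` Interval (BRight 0) +oo%O]).
Proof.
apply/cvg_lim => //; apply: nondecreasing_at_right_cvgr => //.
  move=> h t; rewrite !in_itv/= !andbT => h0 t0 ht; apply: dright_anti.
    by rewrite invr_ge0 ltW.
  by rewrite lef_pV2 ?posrE.
exists 0 => _ [h /= + <-]; rewrite in_itv/= andbT => h0.
by apply: dright_ge0; rewrite invr_ge0 ltW.
Qed.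

Lemma dright_oo_le u : 0 < u -> dright_oo <= dright u.
Proof.
move=> u0; rewrite dright_ooE; apply: ge_inf.
  exists 0 => _ [h /= + <-]; rewrite in_itv/= andbT => h0.
  by apply: dright_ge0; rewrite invr_ge0 ltW.
by exists u^-1; rewrite /= ?invrK// in_itv/= invr_gt0 u0.
Qed.

Lemma dright_oo_lt (c : R) : dright_oo < c -> exists2 u, 0 < u & dright u < c.
Proof.
rewrite dright_ooE => H.
have ne : (fun p => dright p^-1) @` [set` Interval (BRight 0) +oo%O] !=set0.
  by exists (dright 1^-1); exists 1 => //=; rewrite in_itv/= ltr01.
have [_ [p /= p0 <-] pc] := inf_lt ne H.
by exists p^-1 => //; move: p0; rewrite in_itv/= andbT invr_gt0.
Qed.

Lemma quotE u v : u < v -> S v = S u + (v - u) * quot u (v - u).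
Proof.
move=> uv; have vu : v - u != 0 by rewrite subr_eq0 gt_eqF.
rewrite /quot mulrA divff// mul1r [u + _]addrC subrK; ring.
Qed.

(** All the slopes lie between the slope at infinity and 1. *)
Lemma affine_of_dright_oo u : dright_oo = 1 -> 0 <= u -> S u = u + S 0.
Proof.
move=> al1; rewrite le_eqVlt => /predU1P[<-|u0]; first by rewrite add0r.
have := dright_le_quot (lexx 0) u0; rewrite add0r => q1.
have q2 := quot_le1 (lexx 0) u0.
have q : quot 0 u = 1.
  by apply/eqP; rewrite eq_le q2 -[leLHS]al1 (le_trans _ q1)// dright_oo_le.
by rewrite (quotE u0) subr0 q mulr1 addrC.
Qed.

Lemma slope_lt1_of_dright_oo : dright_oo < 1 -> exists u c : R, [/\ 0 < u, c < 1 &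
  forall v, u < v -> S v <= S u + c * (v - u)].
Proof.
move=> /dright_oo_lt[u u0 c1]; exists u, (dright u); split=> // v uv.
have vu : 0 < v - u by rewrite subr_gt0.
by rewrite (quotE uv) lerD2l mulrC ler_pM2r// quot_le_dright// ltW.
Qed.

Lemma const_of_dright0 u v : 0 <= u -> u <= v -> dright u = 0 -> S v = S u.
Proof.
move=> u0; rewrite le_eqVlt => /predU1P[->//|uv] d0.
have vu : 0 < v - u by rewrite subr_gt0.
have q : quot u (v - u) = 0.
  by apply/eqP; rewrite eq_le quot_ge0// andbT -[leRHS]d0 quot_le_dright.
by rewrite (quotE uv) q mulr0 addr0.
Qed.

Lemma affine_of_dleft1 u v : 0 <= u -> u <= v -> dleft v = 1 -> S v = S u + (v - u).
Proof.
move=> u0; rewrite le_eqVlt => /predU1P[->|uv] d1; first by rewrite subrr addr0.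
have vu : 0 < v - u by rewrite subr_gt0.
have q : quot u (v - u) = 1.
  apply/eqP; rewrite eq_le quot_le1//= -[leLHS]d1.
  by have := @dleft_le_quot v (v - u) vu; rewrite subKr; apply; rewrite gerBl.
by rewrite (quotE uv) q mulr1.
Qed.

(** A slope less than 1 makes [S u - u] tend to -oo; it is nonincreasing, and
    1-Lipschitz since S is nondecreasing, so the supremum of the points where it
    is at least c is a point where it equals c. *)
Lemma crossing_exists (u0 c : R) : 0 <= u0 -> c < S u0 - u0 -> dright_oo < 1 ->
  exists2 us, u0 < us & S us - us = c.
Proof.
move=> u00 cu0 /slope_lt1_of_dright_oo [u1 [d [u10 d1 H]]].
pose E := [set u | u0 <= u /\ c <= S u - u].
(* past w the line of slope d starting from the graph at u1 is below the line of
   slope 1 and height c *)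
pose w := u1 + 1 + `|S u1 - u1 - c| / (1 - d).
have d0 : 0 < 1 - d by rewrite subr_gt0.
have G_anti u v : 0 <= u -> u <= v -> S v - v <= S u - u.
  by move=> ? uv; have := S_lip (u := u) (v := v); move: (S u) (S v) => x y /(_ _ uv); lra.
have uw : u1 < w.
  by rewrite /w -addrA ltrDl ltr_pwDl// divr_ge0// ltW.
have cw : S w - w < c.
  have := H w uw; have -> : w - u1 = 1 + `|S u1 - u1 - c| / (1 - d) by rewrite /w; ring.
  rewrite mulrDr mulr1 => Sw.
  have e : `|S u1 - u1 - c| / (1 - d) * (1 - d) = `|S u1 - u1 - c| by rewrite divfK// gt_eqF.
  have a := ler_norm (S u1 - u1 - c).
  rewrite ltrBlDr; apply: (le_lt_trans Sw); rewrite /w.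
  move: e a; move: (`|S u1 - u1 - c| / (1 - d)) => A.
  move: (`|S u1 - u1 - c|) => B; move: (S u1) => x e a.
  have -> : d * A = A - B by rewrite -e; ring.
  lra.
have ubE : has_ubound E.
  exists w => u [u0u cu]; rewrite leNgt; apply/negP => wu.
  have := G_anti w u (ltW (lt_trans u10 uw)) (ltW wu); move: cu cw.
  by move: (S u) (S w) => x y; lra.
have supE : has_sup E by split=> //; exists u0; split => //; exact: ltW.
have u0s : u0 <= sup E by apply: ub_le_sup => //; split => //; exact: ltW.
have s0 : 0 <= sup E := le_trans u00 u0s.
have ge : c <= S (sup E) - sup E.
  apply/ler_addgt0Pl => e e0; have [u [u0u cu] us] := sup_adherent e0 supE.
  have us' : u <= sup E by apply: ub_le_sup.
  have := S_nd (le_trans u00 u0u) us'; move: cu us; move: (S u) (S (sup E)) (sup E) => x y z.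
  lra.
have le : S (sup E) - sup E <= c.
  apply/ler_addgt0Pl => e e0.
  have ls : sup E < sup E + e by rewrite ltrDl.
  have lt : S (sup E + e) - (sup E + e) < c.
    rewrite ltNge; apply/negP => h; have : sup E + e <= sup E.
      by apply: ub_le_sup => //; split => //; rewrite (le_trans u0s)// ltW.
    by rewrite leNgt ls.
  have := S_nd s0 (ltW ls); move: lt; move: (S (sup E)) (S (sup E + e)) (sup E) => x y z.
  lra.
exists (sup E); last by apply/eqP; rewrite eq_le le ge.
rewrite lt_neqAle u0s andbT; apply/eqP => E0.
by move: le; rewrite -E0 leNgt cu0.
Qed.

(** [S u - u] lies above its chord between u0 and the crossing point. *)
Lemma below_crossing (u0 us u c : R) : 0 <= u0 -> c < S u0 - u0 -> S us - us = c ->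
  u0 <= u -> u < us -> c < S u - u.
Proof.
move=> u00 cu0 cs; rewrite le_eqVlt => /predU1P[<-//|u0u] uus.
have := three_chords u00 u0u uus.
have a : 0 < u - u0 by rewrite subr_gt0.
have b : 0 < us - u by rewrite subr_gt0.
move: cu0 cs; move: (S u0) (S us) (S u) => x y z H1 H2 H3.
have -> : c = y - us by rewrite -H2.
have H4 : (us - u) * (y - us) < (us - u) * (x - u0) by rewrite ltr_pM2l// H2.
have us0 : 0 < us - u0 by rewrite subr_gt0 (lt_trans u0u).
rewrite -(ltr_pM2l us0); nra.
Qed.

(** By concavity the decrease between u0 and the crossing point goes on after it. *)
Lemma above_crossing (u0 us u c : R) : 0 <= u0 -> c < S u0 - u0 -> S us - us = c ->
  u0 < us -> us < u -> S u - u < c.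
Proof.
move=> u00 cu0 cs u0s su.
have := three_chords u00 u0s su.
have a : 0 < us - u0 by rewrite subr_gt0.
have b : 0 < u - us by rewrite subr_gt0.
move: cu0 cs; move: (S u0) (S us) (S u) => x y z H1 H2 H3.
have -> : c = y - us by rewrite -H2.
have H4 : (u - us) * (y - us) < (u - us) * (x - u0) by rewrite ltr_pM2l// H2.
rewrite -(ltr_pM2l a); nra.
Qed.

End concave_functions.


(** * The compressibility *)

Section compressibility_value.
Variables (R : realType) (phi0 phi1 : R -> R).
Variables (X : nat -> finType) (Psi : forall j, X j -> testT R).
Context (hbasis : wavelet_basis Psi) (hadm : wavelet_admissible Psi phi0 phi1).
Variables (f : testT R -> R[i]) (hf : periodic_distribution f).
Local Notation a := (acoef Psi f).
Context (hsup : forall u, 0 <= u -> has_sup [set t | grows a u t]).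
Variables (p0 : \bar R) (s0 : R).
Context (p00 : (0 < p0)%E).
Local Notation u0 := (rinv p0).
Local Notation err := (best_approx_error Psi phi0 phi1 p0 s0 f).
Local Notation kappa := (compressibility Psi phi0 phi1 p0 s0 f).

Lemma cvg_inv_power (e : R) : 0 < e -> (N%:R `^ (- e)) @[N --> \oo] --> (0 : R).
Proof.
move=> e0; apply/cvgrPdist_le => /= d d0; near=> N.
rewrite sub0r normrN ger0_norm ?powR_ge0//.
have x0 : 0 < d `^ (- e^-1) by rewrite powR_gt0.
have xN : d `^ (- e^-1) <= N%:R by near: N; exact: nbhs_infty_ger.
have N0 : 0 < N%:R :> R := lt_le_trans x0 xN.
rewrite powRN -[leRHS]invrK lef_pV2 ?posrE ?invr_gt0 ?powR_gt0//.
have -> : d^-1 = (d `^ (- e^-1)) `^ e.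
  by rewrite -powRrM mulNr mulVf ?gt_eqF// -powR_inv1 ?(ltW d0).
by apply: ge0_ler_powR; rewrite ?nnegrE ?(ltW e0) ?(ltW x0) ?(ltW N0).
Unshelve. all: by end_near. Qed.

Lemma besov_norm_ge0 p q s (g : testT R -> R[i]) : (0 < q)%E ->
  (0 <= besov_norm phi0 phi1 p q s g)%E.
Proof.
rewrite /besov_norm; case: q => [r|_|//] /=; first by rewrite poweR_ge0.
apply: le_trans (ereal_sup_ubound _); last by exists 0%N.
by apply: mule_ge0; [rewrite lee_fin powR_ge0|exact: Lnorm_ge0].
Qed.

(** The rate k < u - u0 leaves a factor N^(k - (u - u0)) tending to 0. *)
Lemma compressible_lt (u k : R) : u0 < u -> s0 - u0 < rate a u -> 0 <= k -> k < u - u0 ->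
  (k%:E <= kappa)%E.
Proof.
move=> u0u su k0 ku; apply: ereal_sup_ubound; exists k => //; split => //.
have u00 := le_trans (rinv_ge0 p00) (ltW u0u).
pose t := (s0 - u0 + rate a u) / 2.
have [t1 t2] : s0 - u0 < t /\ t < rate a u by rewrite /t midf_lt// midf_lt.
have [C C0 HC] := error_upper hbasis hadm hf p00 u0u t1 (lt_rate hsup u00 t2).
have e0 : 0 < (u - u0) - k by rewrite subr_gt0.
apply: (@squeeze_cvge _ _ _ _ (cst 0%E) _ (fun N => (C * N%:R `^ (- ((u - u0) - k)))%:E)).
- near=> N.
  have N0 : (0 < N)%N by near: N; exact: nbhs_infty_gt.
  have N0' : 0 < N%:R :> R by rewrite ltr0n.
  have P0 : (0 <= (N%:R `^ k)%:E :> \bar R)%E by rewrite lee_fin powR_ge0.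
  apply/andP; split.
    apply: mule_ge0 => //; apply: le_ereal_inf_tmp => _ [A _ <-].
    exact: besov_norm_ge0.
  apply: (le_trans (lee_wpmul2l P0 (HC N N0))).
  rewrite -EFinM lee_fin mulrCA ler_pM2l// -powRD; last by rewrite (gt_eqF N0') implybT.
  by rewrite [X in _ <= _ `^ X]opprB.
- exact: cvg_cst.
apply/fine_cvgP; split; first exact: nearW.
have h : (C * N%:R `^ (- (u - u0 - k))) @[N --> \oo] --> C * 0.
  by apply: cvgM; [exact: cvg_cst|exact: cvg_inv_power].
by rewrite mulr0 in h.
Unshelve. all: by end_near. Qed.

Lemma compressibility_oo : (forall u, u0 < u -> s0 - u0 < rate a u) -> kappa = +oo%E.
Proof.
move=> H; apply/eqyP => k k0.
have u0u : u0 < u0 + (k + 1) by rewrite ltrDl addr_gt0.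
apply: (compressible_lt u0u (H _ u0u) (ltW k0)).
by rewrite addrAC subrr add0r ltrDl.
Qed.

(** The direct estimate for u < us gives the lower bound; a larger compressibility
    would give, by the inverse estimate, growth at some u > us. *)
Lemma compressibility_fin (us : R) : u0 < us ->
  s0 - u0 <= rate a u0 ->
  (forall u, u0 < u -> u < us -> s0 - u0 < rate a u) ->
  (forall u, us < u -> rate a u < s0 - u0) -> grows a u0 (s0 - u0) ->
  kappa = (us - u0)%:E.
Proof.
move=> u0s H0 H1 H2 g0; have u00 := rinv_ge0 p00.
apply/eqP; rewrite eq_le; apply/andP; split.
  apply: ge_ereal_sup => _ [k /= [k0 herr] <-]; rewrite lee_fin leNgt; apply/negP => sk.
  have k1 : 0 < k by apply: lt_trans sk; rewrite subr_gt0.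
  pose u := (us + (u0 + k)) / 2.
  have usk : us < u0 + k by rewrite addrC -ltrBlDr.
  have [us1 us2] : us < u /\ u < u0 + k by rewrite /u midf_lt// midf_lt.
  have up : 0 < u by apply: lt_trans us1; exact: le_lt_trans u00 u0s.
  have := error_lower hbasis hadm hf p00 k1 g0 herr up us2.
  by move=> /(le_rate hsup (ltW up)); rewrite leNgt H2.
apply/lee_addgt0Pr => e e0; rewrite -leeBlDr// -EFinB.
case: (leP (us - u0 - e) 0) => [le0|gt0].
  apply: (@le_trans _ _ 0%E); first by rewrite lee_fin.
  pose u := (u0 + us) / 2.
  have [u1 u2] : u0 < u /\ u < us by rewrite /u midf_lt// midf_lt.
  by apply: (compressible_lt u1 (H1 _ u1 u2) (lexx 0)); rewrite subr_gt0.
pose u := us - e / 2.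
have e2 : 0 < e / 2 by rewrite divr_gt0.
have ee : e = e / 2 + e / 2 by exact: splitr.
have u2 : u < us by rewrite /u gtrBl.
have u1 : u0 < u by rewrite /u; lra.
by apply: (compressible_lt u1 (H1 _ u1 u2) (ltW gt0)); rewrite /u; lra.
Qed.

End compressibility_value.


Lemma rinv_inve (R : realType) (u : R) : 0 <= u ->
  (0 < (u%:E)^-1 :> \bar R)%E /\ rinv (u%:E^-1)%E = u.
Proof.
rewrite le_eqVlt => /predU1P[<-|u0]; first by rewrite inve0 rinv_oo; split.
by rewrite inver gt_eqF// lte_fin invr_gt0 rinv_fin ?invr_gt0// invrK.
Qed.

Lemma inve_rinv (R : realType) (p : \bar R) : (0 < p)%E -> (p^-1)%E = (rinv p)%:E.
Proof.
case: p => [r|_|//]; last by rewrite rinv_oo invey.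
by rewrite lte_fin => r0; rewrite (rinv_fin r0) inver gt_eqF.
Qed.

Theorem theorem5p6 (R : realType)
    (phi0 phi1 : R -> R) (hphi : dyadic_partition phi0 phi1)
    (X : nat -> finType) (Psi : forall j, X j -> testT R)
    (hbasis : wavelet_basis Psi) (hadm : wavelet_admissible Psi phi0 phi1)
    (q : \bar R) (hq : (0 < q)%E)
    (p0 : \bar R) (hp0 : (0 < p0)%E) (s0 : R)
    (f : testT R -> R[i]) (hf : periodic_distribution f)
    (hfS : ~ exists u : testT R, f = embedT u)
    (hs : (s0%:E < crit_smoothness phi0 phi1 q f p0)%E) :
  [/\ (alpha0 phi0 phi1 q f = 1 ->
       (forall p : \bar R, (0 < p)%E ->
          crit_smoothness phi0 phi1 q f p =
            (p^-1 + crit_smoothness phi0 phi1 q f +oo)%E) /\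
       compressibility Psi phi0 phi1 p0 s0 f = +oo%E),
      (alpha0 phi0 phi1 q f < 1 ->
       exists2 pf : R,
         unique (fun p : R => [/\ 0 < p, (p%:E < p0)%E &
           crit_smoothness phi0 phi1 q f p%:E =
             ((p^-1 - rinv p0) + s0)%:E]) pf &
         compressibility Psi phi0 phi1 p0 s0 f = (pf^-1 - rinv p0)%:E /\
         (compressibility Psi phi0 phi1 p0 s0 f < +oo)%E),
      (forall pt : R, 0 < pt ->
         crit_dleft phi0 phi1 q f pt%:E = 1 ->
         crit_dright phi0 phi1 q f pt%:E = 0 ->
         [/\ compressibility Psi phi0 phi1 p0 s0 f =
               (crit_smoothness phi0 phi1 q f pt%:E - s0%:E)%E,
             cvg (crit_smoothness phi0 phi1 q f p%:E @[p --> 0^'+]) &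
             compressibility Psi phi0 phi1 p0 s0 f =
               (lim (crit_smoothness phi0 phi1 q f p%:E @[p --> 0^'+])
                - s0%:E)%E]) &
      (crit_dright phi0 phi1 q f +oo%E = 0 ->
         [/\ compressibility Psi phi0 phi1 p0 s0 f =
               (crit_smoothness phi0 phi1 q f +oo - s0%:E)%E,
             cvg (crit_smoothness phi0 phi1 q f p%:E @[p --> 0^'+]),
             compressibility Psi phi0 phi1 p0 s0 f =
               (lim (crit_smoothness phi0 phi1 q f p%:E @[p --> 0^'+])
                - s0%:E)%E &
             forall p : \bar R, (0 < p)%E ->
               crit_smoothness phi0 phi1 q f p =
                 crit_smoothness phi0 phi1 q f +oo])].
Proof.
have hsup := growth_rates_finite hphi hbasis hadm hf hq hp0 hfS hs.
have critE p : (0 < p)%E -> crit_smoothness phi0 phi1 q f p =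
    (rate (acoef Psi f) (rinv p) + rinv p)%:E.
  by move=> p_gt0; exact: (crit_smoothnessE hadm hf hsup hq p_gt0).
pose S := crit_smoothness_inv phi0 phi1 q f.
have SE u : 0 <= u -> S u = rate (acoef Psi f) u + u.
  move=> u0; have [h1 h2] := rinv_inve u0.
  by rewrite /S /crit_smoothness_inv (critE _ h1) h2.
have critS p : (0 < p)%E -> crit_smoothness phi0 phi1 q f p = (S (rinv p))%:E.
  by move=> p_gt0; rewrite (critE _ p_gt0) (SE _ (rinv_ge0 p_gt0)).
have a0 := @acoef_ge0 R X Psi f.
have [K hK] := card_level_le hbasis.
have S_nd u v : 0 <= u -> u <= v -> S u <= S v.
  move=> u0 uv; rewrite (SE _ u0) (SE _ (le_trans u0 uv)).
  by have := rate_lip a0 hsup hK u0 uv; move: (rate _ u) (rate _ v) => x y; lra.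
have S_lip u v : 0 <= u -> u <= v -> S v <= S u + (v - u).
  move=> u0 uv; rewrite (SE _ u0) (SE _ (le_trans u0 uv)).
  by have := rate_anti a0 hsup u0 uv; move: (rate _ u) (rate _ v) => x y; lra.
have S_conc u v th : 0 <= u -> 0 <= v -> 0 < th < 1 ->
    (1 - th) * S u + th * S v <= S ((1 - th) * u + th * v).
  move=> u0 v0 th01; have /andP[t0 t1] := th01.
  have w0 : 0 <= (1 - th) * u + th * v.
    by rewrite addr_ge0// mulr_ge0// ?(ltW t0)// subr_ge0 (ltW t1).
  rewrite (SE _ u0) (SE _ v0) (SE _ w0).
  have := rate_concave a0 hsup u0 v0 th01.
  move: (rate _ u) (rate _ v) (rate _ ((1 - th) * u + th * v)) => x y z H.
  rewrite -subr_ge0 in H; rewrite -subr_ge0; apply: le_trans H _.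
  by rewrite le_eqVlt; apply/orP; left; apply/eqP; ring.
have alphaE : alpha0 phi0 phi1 q f = dright_oo S.
  have e1 p : 0 < p -> crit_dright phi0 phi1 q f p%:E = dright S p^-1.
    by move=> p_gt0; rewrite /crit_dright (rinv_fin p_gt0).
  have H : {near 0^'+, (fun p => crit_dright phi0 phi1 q f p%:E) =1 (fun p => dright S p^-1)}.
    by near=> p; apply: e1; near: p; exact: nbhs_right_gt.
  have H' : {near 0^'+, (fun p => dright S p^-1) =1 (fun p => crit_dright phi0 phi1 q f p%:E)}.
    by near=> p; symmetry; apply: e1; near: p; exact: nbhs_right_gt.
  have E : crit_dright phi0 phi1 q f p%:E @[p --> 0^'+] = dright S p^-1 @[p --> 0^'+].
    by apply/seteqP; split; [exact: (near_eq_cvg H)|exact: (near_eq_cvg H')].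
  by rewrite /alpha0 E.
have u00 := rinv_ge0 hp0; set u0 := rinv p0 in u00 *.
pose c := s0 - u0.
have cS : c < S u0 - u0.
  by move: hs; rewrite (critS _ hp0) lte_fin /c ltrD2r.
have rateE u : 0 <= u -> rate (acoef Psi f) u = S u - u.
  by move=> v0; rewrite (SE _ v0) addrK.
have g0 : grows (acoef Psi f) u0 c by apply: (lt_rate hsup u00); rewrite rateE.
(* the compressibility is read off the crossing of S with the line of slope 1
   through (u0, s0) *)
have kappaE us : u0 < us -> S us - us = c ->
    compressibility Psi phi0 phi1 p0 s0 f = (us - u0)%:E.
  move=> u0s cs; apply: (compressibility_fin hbasis hadm hf hsup hp0 u0s _ _ _ g0).
  - by rewrite (rateE _ u00) (ltW cS).
  - move=> u uu us1; rewrite (rateE _ (le_trans u00 (ltW uu))).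
    exact: (below_crossing S_conc u00 cS cs (ltW uu) us1).
  - move=> u us1; rewrite (rateE _ (le_trans u00 (ltW (lt_trans u0s us1)))).
    exact: (above_crossing S_conc u00 cS cs u0s us1).
(* when the crossing occurs where S is constant, it is at u0 + (S ut - s0) *)
have plateau ut : 0 <= ut -> (forall v, ut <= v -> S v = S ut) ->
    u0 < u0 + (S ut - s0) -> ut <= u0 + (S ut - s0) ->
    [/\ compressibility Psi phi0 phi1 p0 s0 f = ((S ut)%:E - s0%:E)%E,
      cvg (crit_smoothness phi0 phi1 q f p%:E @[p --> 0^'+]) &
      compressibility Psi phi0 phi1 p0 s0 f =
               (lim (crit_smoothness phi0 phi1 q f p%:E @[p --> 0^'+]) - s0%:E)%E].
  move=> ut0 Sut u0s uts.
  have cl : crit_smoothness phi0 phi1 q f p%:E @[p --> 0^'+] --> (S ut)%:E.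
    have w0 : 0 < ut + 1 by rewrite ltr_wpDl.
    have wV : 0 < (ut + 1)^-1 by rewrite invr_gt0.
    apply: cvg_near_cst; near=> p.
    have p_gt0 : 0 < p by near: p; exact: nbhs_right_gt.
    have p_gt0' : (0 < p%:E)%E by rewrite lte_fin.
    have utp : ut <= p^-1.
      apply: (@le_trans _ _ (ut + 1)); first by rewrite lerDl.
      have pw : p < (ut + 1)^-1 by near: p; exact: nbhs_right_lt.
      by rewrite -[X in X <= _]invrK (lef_pV2 wV p_gt0) (ltW pw).
    by rewrite (critS _ p_gt0') (rinv_fin p_gt0) (Sut _ utp).
  have k : compressibility Psi phi0 phi1 p0 s0 f = ((S ut)%:E - s0%:E)%E.
    rewrite (kappaE _ u0s); first by rewrite addrAC subrr add0r.
    by rewrite (Sut _ uts) /c; ring.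
  split; [exact: k|by apply/cvg_ex; exists (S ut)%:E|].
  rewrite k; congr (_ - _)%E; symmetry; apply: (cvg_lim _ cl); exact: ereal_hausdorff.
split.
- rewrite alphaE => al1; split.
    move=> p p_gt0; rewrite (critS _ p_gt0) (critS _ (@lt0y R)) rinv_oo (inve_rinv p_gt0).
    by rewrite -EFinD (affine_of_dright_oo S_nd S_lip S_conc al1 (rinv_ge0 p_gt0)).
  apply: (compressibility_oo hbasis hadm hf hsup hp0) => u uu.
  have up := le_trans u00 (ltW uu).
  rewrite (rateE _ up) (affine_of_dright_oo S_nd S_lip S_conc al1 up) -/u0.
  move: cS; rewrite (affine_of_dright_oo S_nd S_lip S_conc al1 u00) /c.
  by move: (S 0) => x; lra.
- rewrite alphaE => al1.
  have [us u0s cs] := crossing_exists S_nd S_lip S_conc u00 cS al1.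
  have us0 : 0 < us := le_lt_trans u00 u0s.
  have usV : 0 < us^-1 by rewrite invr_gt0.
  have usVe : (0 < (us^-1)%:E)%E by rewrite lte_fin.
  exists us^-1; last by rewrite invrK (kappaE _ u0s cs); split; [reflexivity|exact: ltry].
  split.
    split; first exact: usV.
      move: u0s; rewrite /u0; case: (p0) hp0 => [r|_|//]; last by rewrite ltry.
      rewrite lte_fin => r0; rewrite (rinv_fin r0) lte_fin => rs.
      have rV : 0 < r^-1 by rewrite invr_gt0.
      by rewrite -[X in _ < X]invrK (ltf_pV2 us0 rV).
    rewrite (critS _ usVe) (rinv_fin usV) invrK; congr EFin.
    by move: cs; rewrite /c; move: (S us) => x; lra.
  move=> p [p_gt0 pp0]; have p_gt0' : (0 < p%:E)%E by rewrite lte_fin.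
  rewrite (critS _ p_gt0') (rinv_fin p_gt0) => -[E].
  have pV : 0 < p^-1 by rewrite invr_gt0.
  have u0p : u0 < p^-1.
    move: pp0; rewrite /u0; case: (p0) hp0 => [r|_|//]; last by rewrite rinv_oo.
    by rewrite !lte_fin => r0 pr; rewrite (rinv_fin r0) (ltf_pV2 r0 p_gt0).
  have Ec : S p^-1 - p^-1 = c by rewrite E /c -/u0; ring.
  rewrite -[RHS]invrK; congr (_^-1); apply/eqP; rewrite eq_le !leNgt; apply/andP; split; apply/negP => lt.
    by have := below_crossing S_conc u00 cS cs (ltW u0p) lt; rewrite Ec ltxx.
  by have := above_crossing S_conc u00 cS cs u0s lt; rewrite Ec ltxx.
- move=> pt pt0; rewrite /crit_dleft /crit_dright (rinv_fin pt0) => d1 d0.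
  have ut0 : 0 <= pt^-1 by rewrite invr_ge0 ltW.
  set ut := pt^-1 in ut0 d1 d0.
  have Sut v : ut <= v -> S v = S ut.
    by move=> uv; exact: (const_of_dright0 S_nd S_lip S_conc ut0 uv d0).
  have Saff u : 0 <= u -> u <= ut -> S ut = S u + (ut - u).
    by move=> v0 uv; exact: (affine_of_dleft1 S_nd S_lip S_conc v0 uv d1).
  have pt0' : (0 < pt%:E)%E by rewrite lte_fin.
  rewrite (critS _ pt0') (rinv_fin pt0) -/ut.
  have [uu|uu] := leP u0 ut.
    have := Saff _ u00 uu; move: cS; rewrite /c => H1 H2.
    by apply: (plateau _ ut0 Sut); move: H1 H2 uu; move: (S u0) (S ut) => x y; lra.
  have := Sut _ (ltW uu); move: cS; rewrite /c => H1 H2.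
  by apply: (plateau _ ut0 Sut); move: H1 H2 uu; move: (S u0) (S ut) => x y; lra.
- rewrite /crit_dright rinv_oo => d0.
  have Sut v : 0 <= v -> S v = S 0.
    by move=> v0; exact: (const_of_dright0 S_nd S_lip S_conc (lexx 0) v0 d0).
  have H2 := Sut _ u00; move: cS; rewrite /c => H1.
  have [||k1 k2 k3] := plateau 0 (lexx 0) Sut.
  - by move: H1 H2; move: (S u0) (S 0) => x y; lra.
  - by move: H1 H2 u00; move: (S u0) (S 0) => x y; lra.
  rewrite (critS +oo%E (@lt0y R)) rinv_oo; split; [exact: k1|exact: k2|exact: k3|] => p p_gt0.
  by rewrite (critS _ p_gt0) (Sut _ (rinv_ge0 p_gt0)).
Unshelve. all: by end_near. Qed.
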